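(* Let $\mathcal X\subseteq\mathbb R^d$ be compact. Suppose that $|h(x_1,\xi)-h(x_2,\xi)|\le M(\xi)\|x_1-x_2\|$ for all $x_1,x_2\in\mathcal X$ with $E[M^2(\xi)]<\infty$ ($\|\cdot\|$ the $l_2$ norm), that $E[\sup_{x\in\mathcal X}|h(x,\xi)|^2]<\infty$, and that, for some constant $\delta>0$, $E[\sup_{x\in\mathcal X}|h(x,\xi)-h(x,\xi')|^{2+\delta}]<\infty$, where $\xi,\xi'$ are i.i.d. from $F$. Suppose also that the problem $Z^*=\min_{x\in\mathcal X}E[h(x,\xi)]$ has an essentially unique optimal solution. Let $x^*$ be an optimal solution and assume $Var(h(x^*,\xi))>0$. Then for an arbitrary choice of resample sizes $k=k_n\le n$ with $k\to\infty$, $$\sqrt n\,(U_{n,k}-W_k)\Rightarrow N(0,Var(h(x^*,\xi)))\quad\text{as }n\to\infty.$$ Moreover, $W_k-Z^*=o(1/\sqrt k)$ as $k\to\infty$, and if $\epsilon n\le k\le n$ for some constant $\epsilon>0$, then $$\sqrt n\,(U_{n,k}-Z^* )\Rightarrow N(0,Var(h(x^*,\xi))).$$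
   Context: $F$ is a probability distribution on a measurable space $\Xi$, $h:\mathcal X\times\Xi\to\mathbb R$ is a (measurable) cost function, and $\xi,\xi_1,\xi_2,\ldots$ are i.i.d. from $F$. The problem has an essentially unique optimal solution if $h(x_1,\xi)=h(x_2,\xi)$ almost surely for any two optimal solutions $x_1,x_2\in\mathcal X$. For $k\ge1$, $H_k(\xi_1,\ldots,\xi_k)=\min_{x\in\mathcal X}\frac1k\sum_{i=1}^kh(x,\xi_i)$ and $W_k=E[H_k(\xi_1,\ldots,\xi_k)]$. For $k\le n$, $U_{n,k}=\binom nk^{-1}\sum_{(i_1,\ldots,i_k)\in\mathcal C_k}H_k(\xi_{i_1},\ldots,\xi_{i_k})$, where $\mathcal C_k$ is the collection of all size-$k$ subsets of $\{1,\ldots,n\}$. ''$\Rightarrow$'' denotes convergence in distribution. *)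

(* Defs.v *)
From HB Require Import structures.
From mathcomp Require Import all_boot all_order all_algebra.
From mathcomp Require Import all_classical all_reals all_analysis.

Set Implicit Arguments.
Unset Strict Implicit.
Unset Printing Implicit Defensive.

Export Order.TTheory GRing.Theory Num.Theory.
Export numFieldNormedType.Exports.

Local Open Scope classical_set_scope.
Local Open Scope ring_scope.

(* The library's norm on 'rV[R]_d is the sup norm; it induces the same topology
   (hence the same compact sets) but not the same Lipschitz constants. *)
Definition l2norm (R : realType) (d : nat) (v : 'rV[R]_d) : R :=
  Num.sqrt (\sum_(i < d) v ord0 i ^+ 2).

Definition borel_rV (R : realType) (d : nat) :=
  g_sigma_algebraType (@open 'rV[R]_d).

Section sampling.
Context {dO dX : measure_display} {R : realType}.
Context {Omega : measurableType dO} {Xi : measurableType dX}.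

Definition mutually_independent (P : probability Omega R)
    (xi : nat -> Omega -> Xi) : Prop :=
  forall (J : seq nat) (A : nat -> set Xi), uniq J ->
    (forall j, measurable (A j)) ->
    P (\big[setI/setT]_(j <- J) (xi j @^-1` A j)) =
    (\prod_(j <- J) P (xi j @^-1` A j))%E.

Definition iid_from (P : probability Omega R) (F : probability Xi R)
    (xi : nat -> Omega -> Xi) : Prop :=
  [/\ forall i, measurable_fun setT (xi i),
      forall i (A : set Xi), measurable A -> P (xi i @^-1` A) = F A
    & mutually_independent P xi].

(* [Y n] => mu: each Y n is a random variable, and the distribution functions
   converge at every continuity point of the limiting one. *)
Definition cvg_in_distribution (P : probability Omega R)
    (Y : nat -> Omega -> R) (mu : set R -> \bar R) : Prop :=
  (forall n, measurable_fun setT (Y n)) /\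
  forall x : R, {for x, continuous (fun y : R => mu `]-oo, y]%classic)} ->
    P (Y n @^-1` `]-oo, x]%classic) @[n --> \oo] --> mu `]-oo, x]%classic.

End sampling.

Section optimization.
Context {dO dX : measure_display} {R : realType} {d : nat}.
Context {Omega : measurableType dO} {Xi : measurableType dX}.
Implicit Types (X : set 'rV[R]_d) (h : 'rV[R]_d -> Xi -> R).

(* The cost is only meaningful on X * Xi; values of h off X are never used. *)
Definition measurable_cost X h : Prop :=
  measurable_fun ([set p | X p.1] : set (borel_rV R d * Xi))
    (fun p => h p.1 p.2).

Definition optimal_solution (F : probability Xi R) X h (x : 'rV[R]_d) : Prop :=
  X x /\ forall y, X y -> ('E_F[h x] <= 'E_F[h y])%E.

Definition essentially_unique_solution (F : probability Xi R) X h : Prop :=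
  forall x1 x2, optimal_solution F X h x1 -> optimal_solution F X h x2 ->
    {ae F, forall z, h x1 z = h x2 z}.

Definition optimal_value (F : probability Xi R) X h : R :=
  inf [set fine 'E_F[h x] | x in X].

(* H_k(z_1, ..., z_k), with k the length of s. The infimum is a minimum when X
   is nonempty and compact and h is continuous in x. *)
Definition saa_value X h (s : seq Xi) : R :=
  inf [set (size s)%:R^-1 * \sum_(z <- s) h x z | x in X].

(* W_k; samples are indexed from 0. *)
Definition expected_saa_value (P : probability Omega R)
    (xi : nat -> Omega -> Xi) X h (k : nat) : R :=
  fine 'E_P[fun w => saa_value X h [seq xi i w | i <- iota 0 k]].

(* U_{n,k}; the sum is over the size-k subsets A of the n sample indices, and
   saa_value does not depend on the order in which A is enumerated. *)
Definition saa_Ustat (xi : nat -> Omega -> Xi) X h (n k : nat) (w : Omega) : R :=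
  'C(n, k)%:R^-1 *
  \sum_(A : {set 'I_n} | #|A| == k)
    saa_value X h [seq xi (nat_of_ord i) w | i <- enum A].

End optimization.

(* Main.v *)
(* Let tau_k >= 0 be the amount by which the empirical minimum H_k falls below
   the empirical cost of x*, so that U_{n,k} is the sample mean of h(x*, .) minus
   a U-statistic u built on tau_k, and E u = Z* - W_k = E tau_k.
   - sqrt k * E tau_k -> 0: chaining (Rademacher symmetrisation along the nets of X)
     makes the oscillation of the centred empirical process over pairs at distance
     4^-J at most C 2^-J / sqrt k. By compactness every x is within 4^-J of one of
     finitely many optimal solutions, whose costs are a.s. equal to that of x*, or
     else is suboptimal by a fixed gap, and then contributes only O(1/k).
   - n * Var u -> 0: by the Efron-Stein inequality it suffices that replacing one
     observation changes k tau_k by o(1) in L2; the Lipschitz bound turns such a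
     change into the distance of near-minimisers from the optimal solutions.
   - The sample mean obeys the central limit theorem, proved by Lindeberg's
     replacement in Trotter's form: translations by independent variables act on
     functions as commuting contractions, and the n-th power of the one-step
     operator is compared with that of a normal law, on logistic test functions,
     which also approximate indicators of half-lines. *)

Require Import Defs.
From HB Require Import structures.
From mathcomp Require Import all_boot all_order all_algebra.
From mathcomp Require Import finmap.
From mathcomp Require Import all_classical all_reals all_analysis.
From mathcomp Require Import measurable_realfun ring lra zify.

Set Implicit Arguments.
Unset Strict Implicit.
Unset Printing Implicit Defensive.

Import Order.TTheory GRing.Theory Num.Theory.
Import numFieldNormedType.Exports HBNNSimple.

Local Open Scope classical_set_scope.
Local Open Scope ring_scope.

(** * Square-integrable random variables *)

(** Since [k] varies with [n], so does the kernel of the U-statistic; peeling off the cost at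
    [xstar] leaves a main part that does not depend on [k] at all. The remainder is nonnegative, so
    its L1 norm is its mean, and the bias rate suffices when [k] is of order [n]. For [k] much
    smaller than [n], [sqrt n] times the bias need not vanish, and only the fluctuation can be
    small: the variance bound must then be uniform in [n]. It is, because one observation lies in a
    fraction [k / n] of the subsets and moves each [tau] by [o(1 / k)], so every Efron-Stein
    increment is [o(1 / n)]. The Lipschitz constant has just two moments, hence truncations
    [f <= l + max (f - l) 0] without rates. Radii [4^-j] are matched with Gaussian levels [2^j]: the
    logarithm of the net sizes is linear in [j], far below [4^j], and the products [2^-j] are
    summable. No supremum over [X] is integrated directly: maxima over finite nets are bounded
    independently of the size of the net, which is then refined. *)

Section real_expectation.
Context {d : measure_display} {T : measurableType d} {R : realType}.
Variable P : probability T R.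
Implicit Types f g : T -> R.

(** Expectations are real numbers, so that linear arithmetic applies to them; [Ex] is meaningful
    only on [L1], whence the side conditions everywhere below. *)
Definition L1 f : Prop := P.-integrable setT (EFin \o f).
Definition Ex f : R := \int[P]_x f x.
Definition L2 f : Prop := measurable_fun setT f /\ L1 (fun x => f x ^+ 2).

Lemma L1_meas f : L1 f -> measurable_fun setT f.
Proof. by move=> /integrableP[/measurable_EFinP]. Qed.

Lemma EFin_Ex f : L1 f -> (Ex f)%:E = (\int[P]_x (f x)%:E)%E.
Proof. by move=> fi; rewrite fineK//; exact: integrable_fin_num. Qed.

Lemma eq_L1 f g : f =1 g -> L1 f -> L1 g.
Proof. by move=> /funext ->. Qed.

Lemma eq_Ex f g : f =1 g -> Ex f = Ex g.
Proof. by move=> /funext ->. Qed.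

Lemma L1_cst c : L1 (fun=> c).
Proof. exact: (finite_measure_integrable_cst P c measurableT). Qed.

Lemma Ex_cst c : Ex (fun=> c) = c.
Proof.
rewrite /Ex Rintegral_cst// -[RHS]mulr1; congr (_ * _).
exact: (congr1 fine (probability_setT P)).
Qed.

Lemma L1D f g : L1 f -> L1 g -> L1 (fun x => f x + g x).
Proof. by move=> fi gi; apply: (integrableD _ fi gi). Qed.

Lemma L1Z c f : L1 f -> L1 (fun x => c * f x).
Proof. by move=> fi; apply: (integrableZl _ c fi). Qed.

Lemma L1N f : L1 f -> L1 (fun x => - f x).
Proof. by move=> /(L1Z (-1)); under eq_fun do rewrite mulN1r. Qed.

Lemma L1B f g : L1 f -> L1 g -> L1 (fun x => f x - g x).
Proof. by move=> fi gi; apply: L1D => //; exact: L1N. Qed.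

Lemma L1_norm f : L1 f -> L1 (fun x => `|f x|).
Proof. by move=> fi; apply: integrable_norm. Qed.

Lemma L1_le f g : measurable_fun setT f -> (forall x, `|f x| <= g x) ->
  L1 g -> L1 f.
Proof.
move=> mf fg gi; apply: (le_integrable measurableT _ _ gi).
  exact/measurable_EFinP.
by move=> x _ /=; rewrite lee_fin (le_trans (fg x))// ler_norm.
Qed.

Lemma L1_sum (I : Type) (s : seq I) (Q : pred I) (F : I -> T -> R) :
  (forall i, Q i -> L1 (F i)) -> L1 (fun x => \sum_(i <- s | Q i) F i x).
Proof.
move=> Fi; elim: s => [|i s ih].
  by apply: eq_L1 (L1_cst 0) => x; rewrite big_nil.
case Qi : (Q i).
  by apply: eq_L1 (L1D (Fi _ Qi) ih) => x; rewrite big_cons Qi.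
by apply: eq_L1 ih => x; rewrite big_cons Qi.
Qed.

Lemma ExD f g : L1 f -> L1 g -> Ex (fun x => f x + g x) = Ex f + Ex g.
Proof. by move=> fi gi; apply: RintegralD. Qed.

Lemma ExB f g : L1 f -> L1 g -> Ex (fun x => f x - g x) = Ex f - Ex g.
Proof. by move=> fi gi; apply: RintegralB. Qed.

Lemma ExZ c f : L1 f -> Ex (fun x => c * f x) = c * Ex f.
Proof. by move=> fi; apply: RintegralZl. Qed.

Lemma Ex_sum (I : Type) (s : seq I) (Q : pred I) (F : I -> T -> R) :
  (forall i, Q i -> L1 (F i)) ->
  Ex (fun x => \sum_(i <- s | Q i) F i x) = \sum_(i <- s | Q i) Ex (F i).
Proof.
move=> Fi; elim: s => [|i s ih].
  by under eq_Ex do rewrite big_nil; rewrite Ex_cst big_nil.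
rewrite big_cons; under eq_Ex do rewrite big_cons; case Qi : (Q i) => //.
by rewrite ExD ?ih//; [exact: Fi|exact: L1_sum].
Qed.

Lemma Ex_le f g : L1 f -> L1 g -> (forall x, f x <= g x) -> Ex f <= Ex g.
Proof. by move=> fi gi fg; apply: le_Rintegral. Qed.

Lemma Ex_ge0 f : (forall x, 0 <= f x) -> 0 <= Ex f.
Proof. by move=> f0; apply: Rintegral_ge0. Qed.

Lemma Ex_norm f : L1 f -> `|Ex f| <= Ex (fun x => `|f x|).
Proof. by move=> fi; apply: le_normr_Rintegral. Qed.

Lemma ge0_L1 f : measurable_fun setT f -> (forall x, 0 <= f x) ->
  (\int[P]_x (f x)%:E < +oo)%E -> L1 f.
Proof.
move=> mf f0 foo; apply/integrableP; split; first exact/measurable_EFinP.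
by under eq_integral => x _ do rewrite /= ger0_norm//.
Qed.

Lemma bounded_L1 f c : measurable_fun setT f -> (forall x, `|f x| <= c) -> L1 f.
Proof. by move=> mf fc; apply: L1_le (L1_cst c). Qed.

Lemma L2_sqr f : L2 f -> L1 (fun x => f x ^+ 2).
Proof. by case. Qed.

Lemma L2M_L1 f g : L2 f -> L2 g -> L1 (fun x => f x * g x).
Proof.
move=> [mf f2] [mg g2]; apply: L1_le (L1D f2 g2).
  exact: measurable_funM.
move=> x; rewrite normrM.
have := sqr_ge0 (`|f x| - `|g x|); rewrite -(real_normK (num_real (f x))).
rewrite -(real_normK (num_real (g x))).
by have := normr_ge0 (f x); have := normr_ge0 (g x); nra.
Qed.

Lemma L2_cst c : L2 (fun=> c).
Proof. by split => //; exact: L1_cst. Qed.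

Lemma L2_L1 f : L2 f -> L1 f.
Proof.
by move=> f2; apply: eq_L1 (L2M_L1 f2 (L2_cst 1)) => x; rewrite mulr1.
Qed.

Lemma L2D f g : L2 f -> L2 g -> L2 (fun x => f x + g x).
Proof.
move=> f2 g2; have [mf fi] := f2; have [mg gi] := g2.
split; first exact: measurable_funD.
apply: eq_L1 (L1D (L1D fi gi) (L1Z 2 (L2M_L1 f2 g2))) => x; ring.
Qed.

Lemma L2Z c f : L2 f -> L2 (fun x => c * f x).
Proof.
move=> [mf fi]; split; first exact: measurable_funM.
by apply: eq_L1 (L1Z (c ^+ 2) fi) => x; rewrite exprMn.
Qed.

Lemma L2N f : L2 f -> L2 (fun x => - f x).
Proof. by move=> /(L2Z (-1)); under eq_fun do rewrite mulN1r. Qed.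

Lemma L2B f g : L2 f -> L2 g -> L2 (fun x => f x - g x).
Proof. by move=> f2 g2; apply: L2D => //; exact: L2N. Qed.

Lemma L2_sum (I : Type) (s : seq I) (Q : pred I) (F : I -> T -> R) :
  (forall i, Q i -> L2 (F i)) -> L2 (fun x => \sum_(i <- s | Q i) F i x).
Proof.
move=> Fi; elim: s => [|i s ih].
  by under eq_fun do rewrite big_nil; exact: L2_cst.
under eq_fun do rewrite big_cons; case Qi : (Q i) => //.
by apply: L2D => //; exact: Fi.
Qed.

Lemma L2_le f g : measurable_fun setT f -> (forall x, `|f x| <= g x) ->
  L2 g -> L2 f.
Proof.
move=> mf fg [mg gi]; split => //; apply: L1_le gi.
  exact: measurable_funX.
move=> x; rewrite normrX lerXn2r// ?nnegrE//.
by rewrite (le_trans _ (fg x)).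
Qed.

(* AM-GM in place of Cauchy-Schwarz avoids square roots of expectations. *)
Lemma Ex_abs_le f c : 0 < c -> L2 f ->
  Ex (fun x => `|f x|) <= (Ex (fun x => f x ^+ 2) / c + c) / 2.
Proof.
move=> c0 f2; have fi := L2_L1 f2; have f2i := L2_sqr f2.
rewrite (_ : (_ + c) / 2 = Ex (fun x => (2 * c)^-1 * f x ^+ 2 + c / 2)).
  apply: Ex_le; [exact: L1_norm|apply: L1D; [exact: L1Z|exact: L1_cst]|].
  move=> x; rewrite -(real_normK (num_real (f x))).
  rewrite -subr_ge0 (_ : _ - _ = (2 * c)^-1 * (`|f x| - c) ^+ 2).
    by apply: mulr_ge0; rewrite ?sqr_ge0// invr_ge0 mulr_ge0// ltW.
  by field; rewrite gt_eqF.
rewrite (ExD (L1Z _ f2i) (L1_cst _)) (ExZ _ f2i) Ex_cst.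
by field; rewrite gt_eqF.
Qed.

End real_expectation.

(** * Samples as random sequences *)

Section same_law.
Context {d1 d2 d3 : measure_display} {R : realType}.
Context {T1 : measurableType d1} {T2 : measurableType d2} {Y : measurableType d3}.
Variables (P : probability T1 R) (Q : probability T2 R).
Variables (phi : T1 -> Y) (psi : T2 -> Y).
Hypotheses (mphi : measurable_fun setT phi) (mpsi : measurable_fun setT psi).
Hypothesis law : forall A, measurable A -> P (phi @^-1` A) = Q (psi @^-1` A).

(** Both sides are integrals over [Y] against image measures, which coincide by [law]. The two
    source spaces may differ: the lemma serves to compare two subsamples under [P], and [xi i] under
    [P] with the identity under [F]. *)
Lemma ge0_same_law (f : Y -> \bar R) : measurable_fun setT f ->
  (forall y, 0 <= f y)%E ->
  (\int[P]_x f (phi x) = \int[Q]_x f (psi x))%E.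
Proof.
move=> mf f0.
rewrite -[LHS](@ge0_integral_pushforward _ _ _ _ _ phi mphi P setT f)//.
rewrite -[RHS](@ge0_integral_pushforward _ _ _ _ _ psi mpsi Q setT f)//.
by apply: eq_measure_integral => A mA _; exact: law.
Qed.

Lemma same_law_L1 (f : Y -> R) : measurable_fun setT f ->
  L1 P (f \o phi) -> L1 Q (f \o psi).
Proof.
move=> mf /integrableP[_ foo]; apply/integrableP; split.
  by apply/measurable_EFinP; exact: measurableT_comp.
rewrite -(@ge0_same_law (fun y => `|(f y)%:E|)%E)//.
by apply: measurableT_comp => //; exact/measurable_EFinP.
Qed.

Lemma same_law_Ex (f : Y -> R) : measurable_fun setT f ->
  L1 P (f \o phi) -> Ex P (f \o phi) = Ex Q (f \o psi).
Proof.
move=> mf fi; have gi := same_law_L1 mf fi.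
have mfE : measurable_fun setT (EFin \o f) by exact/measurable_EFinP.
congr fine.
rewrite -[LHS](@integral_pushforward _ _ _ _ _ phi mphi P setT (EFin \o f))//.
rewrite -[RHS](@integral_pushforward _ _ _ _ _ psi mpsi Q setT (EFin \o f))//.
by apply: eq_measure_integral => A mA _; exact: law.
Qed.

End same_law.

(** * Product sigma-algebra on sequences *)

Section sequence_space.
Context {dX : measure_display} {Xi : measurableType dX}.

(** Boxes over an initial segment rather than general cylinders: they form a pi-system containing
    [setT], and independence gives their probability at once as a finite product. *)
Definition cylinders : set (set (nat -> Xi)) :=
  [set C | exists n (A : nat -> set Xi), (forall j, measurable (A j)) /\
     C = [set s | forall j, (j < n)%N -> A j (s j)]].

Definition seq_space := g_sigma_algebraType cylinders.

Lemma cylinders_setI : setI_closed cylinders.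
Proof.
move=> _ _ [n [A [mA ->]]] [m [B [mB ->]]].
exists (maxn n m), (fun j => (if (j < n)%N then A j else setT) `&`
  (if (j < m)%N then B j else setT)); split.
  by move=> j; apply: measurableI; case: ifP.
apply/seteqP; split => s /=.
  move=> [sA sB] j _; split.
    by case: ifPn => // jn; exact: sA.
  by case: ifPn => // jm; exact: sB.
move=> sAB; split => j jn.
  by have [] := sAB j (leq_trans jn (leq_maxl _ _)); rewrite jn.
by have [_] := sAB j (leq_trans jn (leq_maxr _ _)); rewrite jn.
Qed.

Lemma cylinders_setT : cylinders setT.
Proof. by exists 0%N, (fun=> setT); split=> //; apply/seteqP; split. Qed.

Lemma measurable_coord i :
  measurable_fun [set: seq_space] (fun s : seq_space => s i : Xi).
Proof.
move=> _ A mA; rewrite setTI; apply: sub_sigma_algebra.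
exists i.+1, (fun j => if j == i then A else setT); split.
  by move=> j; case: ifP.
apply/seteqP; split => s /=.
  by move=> sA j ji; case: eqP => // ->.
by move=> /(_ i (ltnSn _)); rewrite eqxx.
Qed.

Lemma measurable_to_seq d (T : measurableType d) (f : T -> seq_space) :
  (forall i, measurable_fun setT (fun t => f t i)) -> measurable_fun setT f.
Proof.
move=> mf; apply: (@measurability _ _ T seq_space setT f cylinders) => //.
move=> _ [_ [n [A [mA ->]] <-]]; rewrite setTI.
rewrite (_ : _ @^-1` _ = \bigcap_(j in `I_n) ((fun t => f t j) @^-1` A j)).
  apply: bigcap_measurableType => j _.
  by rewrite -[X in measurable X]setTI; exact: mf.
by apply/seteqP; split.
Qed.

Lemma seq_space_measure_unique {R : realType}
    (m1 m2 : {measure set seq_space -> \bar R}) :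
  (forall C, cylinders C -> m1 C = m2 C) -> (m1 setT < +oo)%E ->
  forall A, measurable A -> m1 A = m2 A.
Proof.
move=> m12 m1T A mA.
apply: (measure_unique (T := seq_space) cylinders (fun=> setT)) => //.
- exact: cylinders_setI.
- by move=> _; exact: cylinders_setT.
- by apply/seteqP; split => // x _; exists 0%N.
Qed.

Lemma measurable_subseq (s : nat -> nat) :
  measurable_fun [set: seq_space] (fun x : seq_space => (x \o s) : seq_space).
Proof. by apply: measurable_to_seq => i; exact: measurable_coord. Qed.

End sequence_space.
Arguments seq_space {dX} Xi.
Arguments cylinders {dX} Xi.

Section iid.
Context {dO dX : measure_display} {R : realType}.
Context {Omega : measurableType dO} {Xi : measurableType dX}.
Variables (P : probability Omega R) (F : probability Xi R).
Variable xi : nat -> Omega -> Xi.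
Hypothesis Hiid : iid_from P F xi.

(** Subsampling, exchanging and refreshing observations are all changes of the index map [s]; a
    statistic is a fixed function on sequences, and injectivity of [s] is what preserves the law. *)
Definition sample (s : nat -> nat) (w : Omega) : seq_space Xi :=
  fun i => xi (s i) w.

Let mxi i : measurable_fun setT (xi i).
Proof. by case: Hiid. Qed.

Lemma measurable_sample s : measurable_fun setT (sample s).
Proof. by apply: measurable_to_seq => i; exact: mxi. Qed.

Lemma measurable_sample_preimage s A : measurable A ->
  measurable (sample s @^-1` A).
Proof.
by move=> mA; rewrite -[X in measurable X]setTI; exact: measurable_sample.
Qed.

(** The index type is arbitrary so that [nat + nat] can later enumerate two disjoint blocks at
    once. *)
Lemma law_family (I : eqType) (J : seq I) (r : I -> nat) (A : I -> set Xi) :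
  injective r -> uniq J -> (forall j, measurable (A j)) ->
  P (\big[setI/setT]_(j <- J) (xi (r j) @^-1` A j)) =
  (\prod_(j <- J) F (A j))%E.
Proof.
case: Hiid => _ Pxi indep rinj uJ mA.
have rJ : uniq [seq r j | j <- J] by rewrite map_inj_uniq.
case: J rJ {uJ} => [|j0 J] rJ; first by rewrite !big_nil probability_setT.
(* [mutually_independent] wants sets indexed by the observation numbers themselves, so [A] is
   transported along [r] through the position of [r j] in the list. The default [j0] of [nth] is the
   reason for treating the empty list apart. *)
have AE : {in j0 :: J, forall j,
    A (nth j0 (j0 :: J) (index (r j) [seq r j | j <- j0 :: J])) = A j}.
  by move=> j jJ; rewrite nth_index_map//; exact: in2W.
have := indep _ (fun i => A (nth j0 (j0 :: J) (index i [seq r j | j <- j0 :: J])))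
  rJ (fun j => mA _).
rewrite !(big_map r) => {}indep.
transitivity (P (\big[setI/setT]_(j <- j0 :: J)
    (xi (r j) @^-1` A (nth j0 (j0 :: J) (index (r j) [seq r j | j <- j0 :: J]))))).
  by congr (P _); apply: eq_big_seq => j jJ; rewrite AE.
rewrite indep; apply: eq_big_seq => j jJ; rewrite AE//; exact: Pxi.
Qed.

Let cyl_preimage s n (A : nat -> set Xi) :
  sample s @^-1` [set x | forall j, (j < n)%N -> A j (x j)] =
  \big[setI/setT]_(j <- iota 0 n) (xi (s j) @^-1` A j).
Proof.
rewrite -bigcap_seq; apply/seteqP; split => w /= h j.
  by rewrite /= mem_iota add0n => /= jn; exact: h.
by move=> jn; apply: h; rewrite /= mem_iota.
Qed.

Let X s : {mfun Omega >-> seq_space Xi} :=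
  HB.pack (sample s) (isMeasurableFun.Build _ _ _ _ _ (measurable_sample s)).

(** On a box both probabilities equal the same product of values of [F]; uniqueness of measures on a
    pi-system does the rest. *)
Lemma exchangeable s s' A : injective s -> injective s' -> measurable A ->
  P (sample s @^-1` A) = P (sample s' @^-1` A).
Proof.
move=> sinj sinj' mA.
apply: (@seq_space_measure_unique _ _ R
  (distribution P (X s)) (distribution P (X s'))) => //.
- move=> C [n [B [mB CE]]].
  rewrite -[LHS]/(P (sample s @^-1` C)) -[RHS]/(P (sample s' @^-1` C)) CE.
  by rewrite !cyl_preimage !law_family// iota_uniq.
- exact: (le_lt_trans (probability_le1 (distribution P (X s)) measurableT) (ltry _)).
Qed.

(** The pi-lambda argument is run twice: from boxes to arbitrary [A] with the second set a fixed
    box, then from boxes to arbitrary [B] with [A] fixed. Each time both sides are finite measures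
    in the free set, a restriction of [P] and a multiple of a law. *)
Lemma block_independence s s' A B : injective s -> injective s' ->
  (forall i j, s i <> s' j) -> measurable A -> measurable B ->
  P (sample s @^-1` A `&` sample s' @^-1` B) =
  (P (sample s @^-1` A) * P (sample s' @^-1` B))%E.
Proof.
move=> sinj sinj' ss' mA mB.
have PB b C : measurable C -> (P (sample b @^-1` C) < +oo)%E.
  move=> mC; rewrite (le_lt_trans (probability_le1 _ _)) ?ltry//.
  exact: measurable_sample_preimage.
have cyl C D : cylinders Xi C -> cylinders Xi D ->
    P (sample s @^-1` C `&` sample s' @^-1` D) =
    (P (sample s @^-1` C) * P (sample s' @^-1` D))%E.
  move=> [n [C' [mC' ->]]] [m [D' [mD' ->]]].
  rewrite !cyl_preimage !law_family ?iota_uniq//.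
  have := @law_family _ ([seq inl j | j <- iota 0 n] ++ [seq inr j | j <- iota 0 m])
    (fun i => match i with inl j => s j | inr j => s' j end)
    (fun i => match i with inl j => C' j | inr j => D' j end).
  rewrite !big_cat !big_map /= => -> //.
  - move=> [i|i] [j|j] => [/sinj->|/ss'|/esym/ss'|/sinj'->] //.
  - rewrite cat_uniq !map_inj_uniq ?iota_uniq//= ?andbT; last 2 first.
    + by move=> ? ? [].
    + by move=> ? ? [].
    by apply/hasPn => _ /mapP[j _ ->]; apply/negP => /mapP[i].
  - by case.
have mP b C : measurable C -> measurable (sample b @^-1` C).
  exact: measurable_sample_preimage.
have half D : cylinders Xi D -> P (sample s @^-1` A `&` sample s' @^-1` D) =
    (P (sample s @^-1` A) * P (sample s' @^-1` D))%E.
  move=> cD.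
  have mD : measurable (sample s' @^-1` D).
    by apply: mP; exact: sub_sigma_algebra.
  have fD : P (sample s' @^-1` D) \is a fin_num.
    by rewrite ge0_fin_numE// PB//; exact: sub_sigma_algebra.
  have fD0 : 0 <= fine (P (sample s' @^-1` D)) by exact: fine_ge0.
  rewrite muleC -(fineK fD).
  apply: (@seq_space_measure_unique _ _ R
    (pushforward (mrestr P mD) (X s))
    (mscale (NngNum fD0) (distribution P (X s)))) => //.
  - move=> C cC.
    transitivity (P (sample s @^-1` C `&` sample s' @^-1` D)); first by [].
    by rewrite cyl// muleC -{1}(fineK fD).
  - suff : (P (sample s @^-1` setT `&` sample s' @^-1` D) < +oo)%E by [].
    by rewrite preimage_setT setTI; apply: PB; exact: sub_sigma_algebra.
have fA : P (sample s @^-1` A) \is a fin_num by rewrite ge0_fin_numE// PB.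
have fA0 : 0 <= fine (P (sample s @^-1` A)) by exact: fine_ge0.
rewrite -(fineK fA) setIC.
apply: (@seq_space_measure_unique _ _ R
    (pushforward (mrestr P (mP s _ mA)) (X s'))
    (mscale (NngNum fA0) (distribution P (X s')))) => //.
- move=> C cC.
  transitivity (P (sample s' @^-1` C `&` sample s @^-1` A)); first by [].
  by rewrite setIC half// -{1}(fineK fA).
- suff : (P (sample s' @^-1` setT `&` sample s @^-1` A) < +oo)%E by [].
  by rewrite preimage_setT setTI PB.
Qed.

(** The joint law of the two blocks is the product of their laws, by uniqueness of product measures
    on rectangles. *)
Lemma block_Tonelli s s' (g : seq_space Xi * seq_space Xi -> \bar R) :
  injective s -> injective s' -> (forall i j, s i <> s' j) ->
  measurable_fun setT g -> (forall x, 0 <= g x)%E ->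
  (\int[P]_w g (sample s w, sample s' w) =
   \int[P]_w \int[P]_v g (sample s w, sample s' v))%E.
Proof.
move=> sinj sinj' ss' mg g0.
have mp : measurable_fun setT (fun w => (sample s w, sample s' w)).
  by apply/measurable_fun_pairP; split; exact: measurable_sample.
pose XX : {mfun Omega >-> (seq_space Xi * seq_space Xi)%type} :=
  HB.pack (fun w => (sample s w, sample s' w))
    (isMeasurableFun.Build _ _ _ _ _ mp).
transitivity (\int[distribution P XX]_x g x)%E.
  by rewrite ge0_integral_distribution.
transitivity (\int[distribution P (X s) \x distribution P (X s')]_x g x)%E.
  apply: eq_measure_integral => /= A mA _; apply/esym.
  apply: (@product_measure_unique _ _ _ _ _ (distribution P (X s))
    (distribution P (X s')) (distribution P XX)) => // C D mC mD.
  by rewrite -block_independence.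
rewrite fubini_tonelli1//.
rewrite ge0_integral_distribution//; last 2 first.
- exact: measurable_fun_fubini_tonelli_F.
- by move=> y; exact: integral_ge0.
apply: eq_integral => w _ /=; rewrite /fubini_F ge0_integral_distribution//.
by apply: measurableT_comp => //; exact: pair1_measurable.
Qed.

End iid.

(** * The Efron-Stein inequality *)

Section iid_moments.
Context {dO dX : measure_display} {R : realType}.
Context {Omega : measurableType dO} {Xi : measurableType dX}.
Variables (P : probability Omega R) (F : probability Xi R).
Variable xi : nat -> Omega -> Xi.
Hypothesis Hiid : iid_from P F xi.

Let mxi i : measurable_fun setT (xi i).
Proof. by case: Hiid. Qed.

Let law_xi i A : measurable A -> P (xi i @^-1` A) = F (id @^-1` A).
Proof. by case: Hiid => _ + _; exact. Qed.

Lemma L1_coord (v : Xi -> R) i : L1 F v -> L1 P (v \o xi i).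
Proof.
move=> vi; apply: (@same_law_L1 _ _ _ _ _ _ _ F P id (xi i)) => //.
- by move=> A mA; rewrite law_xi.
- exact: (L1_meas vi).
Qed.

Lemma Ex_coord (v : Xi -> R) i : L1 F v -> Ex P (v \o xi i) = Ex F v.
Proof.
move=> vi; rewrite -(@same_law_Ex _ _ _ _ _ _ _ F P id (xi i))//.
- by move=> A mA; rewrite law_xi.
- exact: (L1_meas vi).
Qed.

Lemma L2_coord (v : Xi -> R) i : L2 F v -> L2 P (v \o xi i).
Proof.
move=> [mv vi]; split; first exact: measurableT_comp.
exact: (@L1_coord (fun z => v z ^+ 2)).
Qed.

Lemma L1_sample (f : seq_space Xi -> R) s s' : measurable_fun setT f ->
  injective s -> injective s' ->
  L1 P (f \o sample xi s) -> L1 P (f \o sample xi s').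
Proof.
move=> mf sinj sinj'.
apply: (@same_law_L1 _ _ _ _ _ _ _ P P (sample xi s) (sample xi s')) => //.
- exact: (measurable_sample Hiid).
- exact: (measurable_sample Hiid).
- by move=> A mA; exact: (exchangeable Hiid).
Qed.

Lemma Ex_sample (f : seq_space Xi -> R) s s' : measurable_fun setT f ->
  injective s -> injective s' -> L1 P (f \o sample xi s) ->
  Ex P (f \o sample xi s) = Ex P (f \o sample xi s').
Proof.
move=> mf sinj sinj' fi.
apply: (@same_law_Ex _ _ _ _ _ _ _ P P (sample xi s) (sample xi s')) => //.
- exact: (measurable_sample Hiid).
- exact: (measurable_sample Hiid).
- by move=> A mA; exact: (exchangeable Hiid).
Qed.

Lemma L2_sample (f : seq_space Xi -> R) s s' : measurable_fun setT f ->
  injective s -> injective s' ->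
  L2 P (f \o sample xi s) -> L2 P (f \o sample xi s').
Proof.
move=> mf sinj sinj' [_ fi]; split.
  by apply: measurableT_comp => //; exact: (measurable_sample Hiid).
apply: (@L1_sample (fun x => f x ^+ 2) s s') => //.
exact: measurable_funX.
Qed.

Lemma Ex_block_mul (f g : seq_space Xi -> R) s s' :
  measurable_fun setT f -> measurable_fun setT g ->
  (forall x, 0 <= f x) -> (forall x, 0 <= g x) ->
  injective s -> injective s' -> (forall i j, s i <> s' j) ->
  L1 P (f \o sample xi s) -> L1 P (g \o sample xi s') ->
  Ex P (fun w => f (sample xi s w) * g (sample xi s' w)) =
  Ex P (f \o sample xi s) * Ex P (g \o sample xi s').
Proof.
move=> mf mg f0 g0 sinj sinj' ss' fi gi.
have inner w : (\int[P]_v (f (sample xi s w) * g (sample xi s' v))%:E =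
    (f (sample xi s w))%:E * (Ex P (g \o sample xi s'))%:E)%E.
  under eq_integral => v _ do rewrite EFinM.
  rewrite ge0_integralZl//=; last 3 first.
  - exact/measurable_EFinP/(L1_meas gi).
  - by move=> v _; rewrite lee_fin.
  - by rewrite lee_fin.
  by rewrite (EFin_Ex gi).
have tonelli := @block_Tonelli _ _ _ _ _ P F xi Hiid s s'
  (fun x => (f x.1 * g x.2)%:E) sinj sinj' ss' _ _.
rewrite /Ex /Rintegral tonelli; last 2 first.
- apply/measurable_EFinP; apply: measurable_funM; exact: measurableT_comp.
- by move=> x; rewrite lee_fin mulr_ge0.
transitivity (fine (\int[P]_w ((f (sample xi s w))%:E *
    (Ex P (g \o sample xi s'))%:E))%E).
  by congr fine; apply: eq_integral => w _; exact: inner.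
rewrite ge0_integralZr//=; last 3 first.
- exact/measurable_EFinP/(L1_meas fi).
- by move=> v _; rewrite lee_fin.
- by rewrite lee_fin Ex_ge0// => w; exact: g0.
by rewrite -[X in (X * _)%E](EFin_Ex fi) -EFinM.
Qed.

(** Past their heads the two sequences exceed [i] and [j] and have opposite parity, so they are
    injective and disjoint. *)
Let pair_block (i j : nat) : i != j -> exists s s' : nat -> nat,
  [/\ injective s, injective s', (forall k l, s k <> s' l), s 0%N = i & s' 0%N = j].
Proof.
move=> ij.
exists (fun k => if k == 0%N then i else (2 * (k + i + j))%N).
exists (fun k => if k == 0%N then j else (2 * (k + i + j)).+1).
by split => //= [k l|k l|k l]; do 2 case: eqP => ?; move: ij; lia.
Qed.

Lemma Ex_pair_mul_ge0 (a b : Xi -> R) i j : i != j -> L1 F a -> L1 F b ->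
  (forall z, 0 <= a z) -> (forall z, 0 <= b z) ->
  Ex P (fun w => a (xi i w) * b (xi j w)) = Ex F a * Ex F b.
Proof.
move=> /pair_block[s [s' [sinj sinj' ss' <- <-]]] ai bi a0 b0.
rewrite -(Ex_coord (s 0%N) ai) -(Ex_coord (s' 0%N) bi).
apply: (@Ex_block_mul (fun x => a (x 0%N)) (fun x => b (x 0%N)) s s') => //.
- apply: measurableT_comp; [exact: (L1_meas ai)|exact: measurable_coord].
- apply: measurableT_comp; [exact: (L1_meas bi)|exact: measurable_coord].
- exact: L1_coord.
- exact: L1_coord.
Qed.

Lemma Ex_pair_mul (v : Xi -> R) i j : i != j -> L2 F v ->
  Ex P (fun w => v (xi i w) * v (xi j w)) = Ex F v ^+ 2.
Proof.
move=> ij v2.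
have vi := L2_L1 v2; have ai := L1_norm vi.
(* Tonelli covers only nonnegative factors, so [v] is written as a difference of the nonnegative
   functions [|v|] and [b], and the product is expanded into four. *)
pose b z := `|v z| - v z.
have a2 : L2 F (fun z => `|v z|).
  apply: (L2_le (g := fun z => `|v z|)) => //.
  - exact: (L1_meas ai).
  - by move=> z; rewrite normr_id.
  - split; first exact: (L1_meas ai).
    by apply: eq_L1 (L2_sqr v2) => z; rewrite real_normK// num_real.
have b2 : L2 F b by exact: L2B.
have bi : L1 F b := L2_L1 b2.
have b0 z : 0 <= b z by rewrite subr_ge0 ler_norm.
have vE z : v z = `|v z| - b z by rewrite /b opprB addrC subrK.
have L1M (f g : Xi -> R) : L2 F f -> L2 F g ->
    L1 P (fun w => f (xi i w) * g (xi j w)).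
  by move=> f2 g2; apply: L2M_L1; exact: L2_coord.
transitivity (Ex P (fun w =>
    (`|v (xi i w)| * `|v (xi j w)| - `|v (xi i w)| * b (xi j w)) -
    (b (xi i w) * `|v (xi j w)| - b (xi i w) * b (xi j w)))).
  by apply: eq_Ex => w; rewrite {1}[v (xi i w)]vE {1}[v (xi j w)]vE; ring.
have -> : Ex F v = Ex F (fun z => `|v z|) - Ex F b by rewrite -ExB//; exact: eq_Ex.
rewrite (ExB (L1B (L1M _ _ a2 a2) (L1M _ _ a2 b2))
             (L1B (L1M _ _ b2 a2) (L1M _ _ b2 b2))).
rewrite (ExB (L1M _ _ a2 a2) (L1M _ _ a2 b2)).
rewrite (ExB (L1M _ _ b2 a2) (L1M _ _ b2 b2)).
have v0 z : 0 <= `|v z| by [].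
rewrite (Ex_pair_mul_ge0 ij ai ai v0 v0) (Ex_pair_mul_ge0 ij ai bi v0 b0).
rewrite (Ex_pair_mul_ge0 ij bi ai b0 v0) (Ex_pair_mul_ge0 ij bi bi b0 b0).
ring.
Qed.

Lemma Ex_sqr_sum (v : Xi -> R) (J : seq nat) : uniq J -> L2 F v -> Ex F v = 0 ->
  Ex P (fun w => (\sum_(i <- J) v (xi i w)) ^+ 2) =
  (size J)%:R * Ex F (fun z => v z ^+ 2).
Proof.
move=> + v2 v0; elim: J => [|j J ih] /=.
  by move=> _; under eq_Ex do rewrite big_nil expr0n; rewrite Ex_cst mul0r.
move=> /andP[jJ uJ].
have vP i : L2 P (fun w => v (xi i w)) by exact: L2_coord.
have SP : L2 P (fun w => \sum_(i <- J) v (xi i w)) by exact: L2_sum.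
transitivity (Ex P (fun w => v (xi j w) ^+ 2 + (\sum_(i <- J) v (xi i w)) ^+ 2 +
    2 * \sum_(i <- J) v (xi j w) * v (xi i w))).
  by apply: eq_Ex => w; rewrite big_cons -mulr_sumr; ring.
have LM i : L1 P (fun w => v (xi j w) * v (xi i w)) by exact: L2M_L1.
rewrite ExD; last 2 first.
- by apply: L1D; exact: L2_sqr.
- by apply: L1Z; exact: L1_sum.
rewrite ExD; [|exact: L2_sqr..].
rewrite ih// (ExZ _ (L1_sum _ _)); last by move=> i _; exact: LM.
rewrite Ex_sum; last by move=> i _; exact: LM.
rewrite big1_seq ?mulr0 ?addr0; last first.
  move=> i /andP[_ iJ]; rewrite Ex_pair_mul ?v0 ?expr0n//.
  by apply: contraNneq jJ => ->.
have := Ex_coord j (L2_sqr v2); rewrite /comp/= => ->.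
by rewrite -[in RHS]natr1 mulrDl mul1r addrC.
Qed.

End iid_moments.

(** Conditions without a nested conditional are split first, so that compositions of index maps end
    as goals for [lia]. *)
Ltac split_ifs := repeat match goal with
  | |- context [if ?b then _ else _] =>
    lazymatch b with
    | context [if _ then _ else _] => fail
    | _ => let H := fresh in case H : b
    end
  end.

Section efron_stein.
Context {dO dX : measure_display} {R : realType}.
Context {Omega : measurableType dO} {Xi : measurableType dX}.
Variables (P : probability Omega R) (F : probability Xi R).
Variable xi : nat -> Omega -> Xi.
Hypothesis Hiid : iid_from P F xi.
Variables (n : nat) (f : seq_space Xi -> R).
Hypothesis mf : measurable_fun setT f.
Hypothesis f_ge0 : forall x, 0 <= f x.
Hypothesis f_local : forall x y : seq_space Xi,
  (forall i, (i < n)%N -> x i = y i) -> f x = f y.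
Hypothesis f2 : L2 P (f \o sample xi id).

(** Observation [i] becomes the fresh one [n + i]. Indices from [n] on are irrelevant to [f] by
    [f_local]; they are pushed to [2 n] and beyond only to keep the map injective. *)
Definition replace_one (n i j : nat) : nat :=
  if j == i then (n + i)%N else if (j < n)%N then j else (n + j)%N.

Let V s (w : Omega) := f (sample xi s w).
(** The first [i] observations are refreshed: as far as [f] can see, this interpolates between the
    sample itself at [i = 0] and an independent copy at [i = n]. *)
Let hybrid (i j : nat) : nat :=
  if (j < i)%N then (n + j)%N else if (j < n)%N then j else (n + j)%N.
Let swap (i j : nat) : nat :=
  if j == i then (n + i)%N else if j == (n + i)%N then i else j.

Let hybrid_inj i : (i <= n)%N -> injective (hybrid i).
Proof. by move=> lin j k; rewrite /hybrid; split_ifs; lia. Qed.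

Let replace_one_inj i : (i < n)%N -> injective (replace_one n i).
Proof. by move=> lin j k; rewrite /replace_one; split_ifs; lia. Qed.

Let swap_inj i : (i < n)%N -> injective (swap i).
Proof. by move=> lin j k; rewrite /swap; split_ifs; lia. Qed.

Let V_local s s' : (forall j, (j < n)%N -> s j = s' j) -> V s = V s'.
Proof.
move=> ss'; apply/funext => w; apply: f_local => j jn.
by rewrite /sample ss'.
Qed.

Let V2 s : injective s -> L2 P (V s).
Proof. by move=> sinj; exact: (L2_sample Hiid mf (@inj_id nat) sinj f2). Qed.

Let m := Ex P (V id).

(** [s] and [s'] agree below [n] with [id] and [hybrid n], and continue with large even and odd
    numbers; this makes the blocks disjoint without changing [V]. *)
Let Vmul : Ex P (fun w => V id w * V (hybrid n) w) = m ^+ 2.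
Proof.
pose s j := if (j < n)%N then j else (2 * (j + n))%N.
pose s' j := if (j < n)%N then (n + j)%N else (2 * (j + n)).+1.
have sinj : injective s by move=> j k; rewrite /s; split_ifs; lia.
have sinj' : injective s' by move=> j k; rewrite /s'; split_ifs; lia.
rewrite (@V_local id s); last by move=> j jn; rewrite /s jn.
rewrite (@V_local (hybrid n) s'); last by move=> j jn; rewrite /s' /hybrid jn.
rewrite (Ex_block_mul Hiid)//; last 3 first.
- by move=> j k; rewrite /s /s'; split_ifs; lia.
- exact: L2_L1 (V2 sinj).
- exact: L2_L1 (V2 sinj').
have fi := L2_L1 f2.
by rewrite -!(Ex_sample Hiid mf (@inj_id nat) _ fi)// expr2.
Qed.

(** Exchanging observations [i] and [n + i] preserves the law, interchanges the two hybrids and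
    turns [V id] into [V (replace_one n i)]. Hence the left side is half the mean of a product of
    two differences; these have the same second moment, and [a b <= (a^2 + b^2) / 2] concludes. *)
Let telescope_term i : (i < n)%N ->
  Ex P (fun w => V id w * (V (hybrid i) w - V (hybrid i.+1) w)) <=
  Ex P (fun w => (V id w - V (replace_one n i) w) ^+ 2) / 2.
Proof.
move=> lin.
have hi := hybrid_inj (ltnW lin); have hi1 := hybrid_inj lin.
have ri := replace_one_inj lin.
have D2 : L2 P (fun w => V (hybrid i) w - V (hybrid i.+1) w).
  by apply: L2B; exact: V2.
have I2 : L2 P (V id) := V2 (@inj_id nat).
have E1 : Ex P (fun w => V id w * (V (hybrid i) w - V (hybrid i.+1) w)) =
    - Ex P (fun w => V (replace_one n i) w *
        (V (hybrid i) w - V (hybrid i.+1) w)).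
  pose g (x : seq_space Xi) := f x *
    (f ((x \o hybrid i) : seq_space Xi) - f ((x \o hybrid i.+1) : seq_space Xi)).
  have mg : measurable_fun setT g.
    apply: measurable_funM => //; apply: measurable_funB.
      by apply: (measurableT_comp mf); exact: measurable_subseq.
    by apply: (measurableT_comp mf); exact: measurable_subseq.
  have := Ex_sample Hiid mg (@inj_id nat) (swap_inj lin) (L2M_L1 I2 D2).
  rewrite {1}/comp {1}/g => -> /=.
  rewrite -mulN1r -ExZ; last by apply: L2M_L1 => //; exact: V2.
  apply: eq_Ex => w /=; rewrite /g.
  rewrite -[f (sample xi (swap i) w)]/(V (swap i) w).
  rewrite -[f (_ \o hybrid i)]/(V (swap i \o hybrid i) w).
  rewrite -[f (_ \o hybrid i.+1)]/(V (swap i \o hybrid i.+1) w).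
  rewrite (@V_local (swap i) (replace_one n i)); last first.
    by move=> j jn; rewrite /swap /replace_one jn; split_ifs; lia.
  rewrite (@V_local (swap i \o hybrid i) (hybrid i.+1)); last first.
    move=> j jn; rewrite /swap /hybrid /= jn ltnS.
    by split_ifs; lia.
  rewrite (@V_local (swap i \o hybrid i.+1) (hybrid i)); last first.
    move=> j jn; rewrite /swap /hybrid /= jn ltnS.
    by split_ifs; lia.
  by ring.
have E2 : Ex P (fun w => (V (hybrid i) w - V (hybrid i.+1) w) ^+ 2) =
    Ex P (fun w => (V id w - V (replace_one n i) w) ^+ 2).
  pose g (x : seq_space Xi) := (f x - f ((x \o replace_one n i) : seq_space Xi)) ^+ 2.
  have mg : measurable_fun setT g.
    apply: measurable_funX; apply: measurable_funB => //.
    by apply: (measurableT_comp mf); exact: measurable_subseq.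
  (* Below [n], [s] coincides with [hybrid i]. It fixes [n + i], where [replace_one n i] sends [i],
     so that [s \o replace_one n i] coincides there with [hybrid i.+1]. *)
  pose s j := if (j < i)%N then (n + j)%N
    else if (j < n)%N || (j == n + i)%N then j else (2 * n + j)%N.
  have sinj : injective s.
    move=> j k; rewrite /s.
    by split_ifs; lia.
  have gi : L1 P (g \o sample xi id).
    by apply: L2_sqr; apply: L2B => //; exact: V2.
  have := Ex_sample Hiid mg (@inj_id nat) sinj gi.
  rewrite {1}/comp {1}/g => -> /=; apply: eq_Ex => w /=; rewrite /g.
  rewrite -[f (sample xi s w)]/(V s w).
  rewrite -[f (_ \o replace_one n i)]/(V (s \o replace_one n i) w).
  rewrite (@V_local s (hybrid i)); last first.
    by move=> j jn; rewrite /s /hybrid jn.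
  rewrite (@V_local (s \o replace_one n i) (hybrid i.+1))//.
  move=> j jn; rewrite /s /hybrid /replace_one /= jn ltnS.
  by split_ifs; lia.
have -> : Ex P (fun w => V id w * (V (hybrid i) w - V (hybrid i.+1) w)) =
    Ex P (fun w => (V id w - V (replace_one n i) w) *
        (V (hybrid i) w - V (hybrid i.+1) w)) / 2.
  rewrite (_ : Ex P (fun w => (V id w - _) * _) =
      Ex P (fun w => V id w * (V (hybrid i) w - V (hybrid i.+1) w)) -
      Ex P (fun w => V (replace_one n i) w * (V (hybrid i) w - V (hybrid i.+1) w))).
    by lra.
  rewrite -ExB; [|exact: L2M_L1|by apply: L2M_L1 => //; exact: V2].
  by apply: eq_Ex => w; rewrite mulrBl.
rewrite ler_pM2r ?invr_gt0//.
have J2 : L2 P (fun w => V id w - V (replace_one n i) w).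
  by apply: L2B => //; exact: V2.
apply: (@le_trans _ _ (Ex P (fun w =>
   2^-1 * ((V id w - V (replace_one n i) w) ^+ 2 +
           (V (hybrid i) w - V (hybrid i.+1) w) ^+ 2)))).
  apply: Ex_le; [exact: L2M_L1|apply: L1Z; apply: L1D; exact: L2_sqr|].
  move=> w; set a := V id w - _; set b := V (hybrid i) w - _.
  by have := sqr_ge0 (a - b); lra.
rewrite (ExZ _ (L1D (L2_sqr J2) (L2_sqr D2))) (ExD (L2_sqr J2) (L2_sqr D2)) E2.
lra.
Qed.

Theorem Efron_Stein :
  Ex P (fun w => (V id w - Ex P (V id)) ^+ 2) <=
  2^-1 * \sum_(i < n) Ex P (fun w => (V id w - V (replace_one n i) w) ^+ 2).
Proof.
have I2 : L2 P (V id) := V2 (@inj_id nat).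
have Ii := L2_L1 I2.
have -> : Ex P (fun w => (V id w - Ex P (V id)) ^+ 2) =
    Ex P (fun w => V id w ^+ 2) - m ^+ 2.
  rewrite -/m (_ : (fun _ => _) = fun w => V id w ^+ 2 + (- (2 * m) * V id w + m ^+ 2)).
    rewrite (ExD (L2_sqr I2) (L1D (L1Z _ Ii) (L1_cst _ _))).
    by rewrite (ExD (L1Z _ Ii) (L1_cst _ _)) (ExZ _ Ii) Ex_cst -/m; ring.
  by apply/funext => w; ring.
(* Writing the squared mean as a product with an independent copy turns the variance into the mean
   of [V id * (V id - V (hybrid n))], which telescopes along the hybrids. *)
rewrite -Vmul -ExB; [|exact: L2_sqr|by apply: L2M_L1 => //; exact: V2 (hybrid_inj (leqnn n))].
rewrite (_ : (fun _ => _) = fun w =>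
    \sum_(i < n) V id w * (V (hybrid i) w - V (hybrid i.+1) w)); last first.
  apply/funext => w; rewrite -mulr_sumr.
  rewrite -(big_mkord xpredT (fun i => V (hybrid i) w - V (hybrid i.+1) w)).
  rewrite (_ : \sum_(0 <= i < n) _ = V (hybrid 0) w - V (hybrid n) w); last first.
    have := @telescope_sumr R 0 n (fun i => V (hybrid i) w) (leq0n n).
    move=> /(congr1 -%R); rewrite opprB => <-; rewrite -sumrN.
    by apply: eq_bigr => i _; rewrite opprB.
  rewrite (@V_local (hybrid 0) id); last by move=> j jn; rewrite /hybrid jn.
  by ring.
rewrite Ex_sum; last first.
  move=> i _; apply: L2M_L1 => //; apply: L2B; apply: V2; apply: hybrid_inj => //.
  exact: ltnW.
rewrite mulr_sumr; apply: ler_sum => i _.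
by rewrite mulrC; exact: telescope_term.
Qed.

End efron_stein.

(** * Nets *)

Section nets.
Context {R : realType} {d : nat}.
Implicit Types (X : set 'rV[R]_d) (x y : 'rV[R]_d).

Lemma rV_norm_le x (e : R) : 0 <= e ->
  (forall i, `|x ord0 i| <= e) -> `|x| <= e.
Proof.
move=> e0 xe; rewrite /Num.norm /= mx_normrE.
by apply/bigmax_leP; split => // -[i j] _ /=; rewrite ord1.
Qed.

Lemma rV_coord_le x i : `|x ord0 i| <= `|x|.
Proof.
rewrite [leRHS]/Num.norm /= mx_normrE.
exact: (le_bigmax _ (fun ij : 'I_1 * 'I_d => `|x ij.1 ij.2|) (ord0, i)).
Qed.

Lemma l2norm_le x : l2norm x <= Num.sqrt d%:R * `|x|.
Proof.
rewrite /l2norm -(ger0_norm (normr_ge0 x)) -sqrtr_sqr -sqrtrM//.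
apply: ler_wsqrtr; apply: (@le_trans _ _ (\sum_(i < d) `|x| ^+ 2)).
  apply: ler_sum => i _; rewrite -(real_normK (num_real (x _ _))).
  by rewrite lerXn2r ?nnegrE// rV_coord_le.
by rewrite sumr_const card_ord mulr_natl.
Qed.

(** Distances are in the sup norm. Base [B.+1] is at least 1, so the bound on the size is monotone
    in [j] and two consecutive nets can be bounded together. *)
Definition has_nets X (K B : nat) := forall j : nat, exists s : seq 'rV[R]_d,
  [/\ forall y, y \in s -> X y, (size s <= K * B.+1 ^ j)%N &
   forall x, X x -> exists2 y, y \in s & `|x - y| <= (4 ^+ j)^-1].

(** A cube containing [X] is cut into cells of side [4^-j], namely [2 m 4^j] per coordinate, and one
    point of [X] is kept from each cell that meets [X]. The number of cells is [(2 m)^d (4^d)^j],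
    hence the witnesses. *)
Lemma compact_has_nets X : compact X -> exists K B, has_nets X K B.
Proof.
move=> /compact_bounded/pinfty_ex_gt0[b b0 Xb].
pose m := (Num.truncn b).+1.
have bm : b < m%:R by have /andP[] := truncn_itv (ltW b0).
exists ((2 * m) ^ d)%N, (4 ^ d).-1%N => j.
pose N := (2 * m * 4 ^ j)%N.
have N0 : (0 < N)%N by rewrite /N !muln_gt0 expn_gt0.
pose cell x : {ffun 'I_d -> 'I_N} := [ffun i =>
  (* The default value is never taken on [X], whose coordinates lie in [[-b, b]] with [b < m]. *)
  insubd (Ordinal N0) (Num.truncn ((x ord0 i + b) * 4 ^+ j))].
have p4 : 0 < 4 ^+ j :> R by rewrite exprn_gt0.
have cellP x y : X x -> X y -> cell x = cell y -> `|x - y| <= (4 ^+ j)^-1.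
  move=> Xx Xy xy; apply: rV_norm_le => [|i]; first by rewrite invr_ge0 ltW.
  have coordP z : X z -> 0 <= (z ord0 i + b) * 4 ^+ j < N%:R.
    move=> /Xb; move/(le_trans (rV_coord_le z i)); rewrite ler_norml => /andP[zl zr].
    rewrite mulr_ge0 ?(ltW p4)//=; last by lra.
    by rewrite /N natrM natrX ltr_pM2r// natrM; lra.
  have cellE z : X z -> cell z i = Num.truncn ((z ord0 i + b) * 4 ^+ j) :> nat.
    move=> /coordP/andP[z0 zN]; rewrite ffunE val_insubd ifT//.
    by rewrite truncn_lt_nat.
  have /andP[x0 _] := coordP _ Xx; have /andP[y0 _] := coordP _ Xy.
  have /andP[xl xr] := truncn_itv x0; have /andP[yl yr] := truncn_itv y0.
  move: xl xr yl yr; rewrite -!cellE// xy !mxE.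
  set c : R := _%:R; rewrite -natr1 -/c => xl xr yl yr.
  rewrite -(ler_pM2r p4) mulVf ?gt_eqF// -[X in _ * X](gtr0_norm p4) -normrM.
  by rewrite ler_norml; apply/andP; split; lra.
have /choice[rep repP] : forall c : {ffun 'I_d -> 'I_N}, exists o,
    if o is Some y then X y /\ cell y = c else forall x, X x -> cell x <> c.
  move=> c.
  have [[y [Xy yc]]|no] := pselect (exists y, X y /\ cell y = c).
    by exists (Some y).
  by exists None => x Xx xc; apply: no; exists x.
exists (pmap rep (enum {ffun 'I_d -> 'I_N})); split.
- move=> y; rewrite mem_pmap => /mapP[c _ yc].
  by have := repP c; rewrite -yc => -[].
- rewrite size_pmap (leq_trans (count_size _ _))// size_map.
  rewrite -enumT -cardE card_ffun !card_ord /N prednK ?expn_gt0// expnMn -!(expnM 4) (mulnC d j).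
  exact: leqnn.
- move=> x Xx; have := repP (cell x).
  case E : (rep (cell x)) => [y|]; last by move=> /(_ _ Xx).
  move=> [Xy yx]; exists y; last exact: cellP.
  by rewrite mem_pmap; apply/mapP; exists (cell x) => //; rewrite mem_enum.
Qed.

End nets.

(** * Chaining for Rademacher sums *)

Section rademacher.
Context {R : realType}.

Lemma le_expR (x : R) : x <= expR x.
Proof. by have := expR_ge1Dx x; lra. Qed.

(** The constant 2 (1/2 would be sharp) leaves room for an elementary proof. If [|x| > 1] then
    [|x| <= 2 x^2]. Otherwise, with [h = x / 2], [expR h <= 1 / (1 - h)] bounds the left side by a
    rational function of [h^2 <= 1/4], itself at most [1 + 8 h^2]. *)
Lemma cosh_le (x : R) : (expR x + expR (- x)) / 2 <= expR (2 * x ^+ 2).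
Proof.
have [x1|x1] := leP `|x| 1; last first.
  have h y : `|y| = `|x| -> expR y <= expR (2 * x ^+ 2).
    move=> yx; rewrite ler_expR (le_trans (ler_norm _))// yx.
    rewrite -(real_normK (num_real x)); have := normr_ge0 x; nra.
  by have := h x erefl; have := h (- x) (normrN x); lra.
move: x1; rewrite ler_norml => /andP[xl xr].
pose h := x / 2.
pose p := expR h; pose q := expR (- h).
have pq : p * q = 1 by rewrite /p /q -expRD subrr expR0.
have p1 : 1 + h <= p by exact: expR_ge1Dx.
have q1 : 1 - h <= q by exact: expR_ge1Dx.
have -> : expR x = p ^+ 2 by rewrite /p -expRM_natl; congr expR; rewrite /h; lra.
have -> : expR (- x) = q ^+ 2.
  by rewrite /q -expRM_natl; congr expR; rewrite /h; lra.
have hl : - (2^-1) <= h by rewrite /h; lra.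
have hr : h <= 2^-1 by rewrite /h; lra.
have p0 : 0 < p by exact: expR_gt0.
have q0 : 0 < q by exact: expR_gt0.
have hp : p <= (1 - h)^-1.
  by rewrite -(@ler_pM2r _ (1 - h)) ?mulVf; [nra|lra|lra].
have hq : q <= (1 + h)^-1.
  by rewrite -(@ler_pM2r _ (1 + h)) ?mulVf; [nra|lra|lra].
apply: (@le_trans _ _ (1 + 2 * x ^+ 2)); last exact: expR_ge1Dx.
apply: (@le_trans _ _ (((1 - h)^-1 ^+ 2 + (1 + h)^-1 ^+ 2) / 2)).
  rewrite ler_pM2r// lerD// lerXn2r// ?nnegrE ?ltW// invr_gt0; lra.
have -> : x = 2 * h by rewrite /h; lra.
have u0 : 0 < (1 - h ^+ 2) ^+ 2 by rewrite exprn_gt0//; nra.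
rewrite (_ : _ / 2 = (1 + h ^+ 2) / (1 - h ^+ 2) ^+ 2); last first.
  by field; apply/and3P; split; apply/eqP; nra.
rewrite ler_pdivrMr//.
have h2 : 0 <= h ^+ 2 <= 4^-1 by rewrite sqr_ge0/=; nra.
move: h2; set u := h ^+ 2; rewrite exprMn -/u => /andP[u1 u2]; nra.
Qed.

(** Expectation over independent fair signs, as a finite average: no probability space has to carry
    the signs beside the sample. *)
Definition rad_mean k (g : {ffun 'I_k -> bool} -> R) : R :=
  (2 ^+ k)^-1 * \sum_e g e.

Lemma rad_mean_le k (f g : {ffun 'I_k -> bool} -> R) :
  (forall e, f e <= g e) -> rad_mean f <= rad_mean g.
Proof.
move=> fg; rewrite ler_wpM2l ?invr_ge0 ?exprn_ge0//.
by apply: ler_sum => e _; exact: fg.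
Qed.

Lemma rad_meanD k (f g : {ffun 'I_k -> bool} -> R) :
  rad_mean (fun e => f e + g e) = rad_mean f + rad_mean g.
Proof. by rewrite /rad_mean big_split mulrDr. Qed.

Lemma rad_meanZ k c (f : {ffun 'I_k -> bool} -> R) :
  rad_mean (fun e => c * f e) = c * rad_mean f.
Proof. by rewrite /rad_mean -mulr_sumr; ring. Qed.

Lemma rad_mean_cst k c : rad_mean (fun _ : {ffun 'I_k -> bool} => c) = c.
Proof.
rewrite /rad_mean sumr_const card_ffun card_bool card_ord -[c *+ _]mulr_natr natrX.
by rewrite mulrCA mulVf ?mulr1// expf_neq0.
Qed.

Lemma rad_mean_sum k (I : Type) (s : seq I) (F : I -> {ffun 'I_k -> bool} -> R) :
  rad_mean (fun e => \sum_(i <- s) F i e) = \sum_(i <- s) rad_mean (F i).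
Proof. by rewrite /rad_mean exchange_big mulr_sumr. Qed.

(** The exponential of the sum factorises, the average over sign vectors distributes over the
    product, and each factor is a hyperbolic cosine. *)
Lemma rademacher_mgf k (a : 'I_k -> R) (l : R) :
  rad_mean (fun e => expR (l * \sum_i (-1) ^+ e i * a i)) <=
  expR (2 * l ^+ 2 * \sum_i a i ^+ 2).
Proof.
rewrite /rad_mean.
have -> : \sum_(e : {ffun 'I_k -> bool}) expR (l * \sum_i (-1) ^+ e i * a i) =
    \prod_(i < k) \sum_(b : bool) expR (l * ((-1) ^+ b * a i)).
  rewrite bigA_distr_bigA; apply: eq_bigr => e _.
  by rewrite mulr_sumr expR_sum.
rewrite mulr_sumr expR_sum -exprVn -[in X in X * _](card_ord k).
rewrite -prodr_const -big_split /=; apply: ler_prod => i _.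
rewrite big_bool /= expr1 expr0 mulr_ge0 ?invr_ge0 ?addr_ge0 ?expR_ge0//=.
have := cosh_le (l * a i); rewrite exprMn mul1r mulN1r mulrN mulrA.
by rewrite mulrC addrC.
Qed.

Lemma le_bigmax_mem (I : eqType) (s : seq I) (f : I -> R) i : i \in s ->
  f i <= \big[Num.max/0]_(j <- s) f j.
Proof. by move=> ls; exact: le_bigmax_seq. Qed.

Lemma bigmax_le_mem (I : eqType) (s : seq I) (f : I -> R) c : 0 <= c ->
  (forall i, i \in s -> f i <= c) -> \big[Num.max/0]_(j <- s) f j <= c.
Proof. by move=> c0 fc; rewrite big_seq; apply: bigmax_le. Qed.

Lemma bigmax_ge0 (I : eqType) (s : seq I) (f : I -> R) :
  0 <= \big[Num.max/0]_(j <- s) f j.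
Proof. by elim: s => [|i s ih]; rewrite ?big_nil// big_cons le_max ih orbT. Qed.

(** The excess of [|Y|] over [t r] is at most [expR (l (|Y| - t r)) / l]; summed over [E] and
    averaged, this costs [2 |E| expR (- t^2 / 8) / l <= 1 / l = 4 r / t], and [t >= 1] gives
    [t r + 4 r / t <= 5 t r]. *)
Lemma rademacher_max k (I : eqType) (E : seq I) (a : I -> 'I_k -> R) (r t : R) :
  0 < r -> 1 <= t -> (forall p, p \in E -> \sum_i a p i ^+ 2 <= r ^+ 2) ->
  2 * (size E)%:R <= expR (t ^+ 2 / 8) ->
  rad_mean (fun e => \big[Num.max/0]_(p <- E) `|\sum_i (-1) ^+ e i * a p i|)
    <= 5 * t * r.
Proof.
(* This [l] minimises the exponent [- l t r + 2 l^2 r^2], with minimum [- t^2 / 8]. *)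
move=> r0 t1 aE sE; pose l := t / (4 * r).
have t0 : 0 < t by exact: lt_le_trans t1.
have l0 : 0 < l by rewrite divr_gt0// mulr_gt0.
pose Y p (e : {ffun 'I_k -> bool}) := \sum_i (-1) ^+ e i * a p i.
apply: (@le_trans _ _ (rad_mean (fun e => t * r + l^-1 * expR (- (l * (t * r))) *
    \sum_(p <- E) (expR (l * Y p e) + expR (- l * Y p e))))).
  apply: rad_mean_le => e; apply: bigmax_le_mem.
    rewrite addr_ge0 ?mulr_ge0 ?invr_ge0 ?expR_ge0 ?(ltW t0) ?(ltW r0) ?(ltW l0)//.
    by apply: sumr_ge0 => p _; rewrite addr_ge0 ?expR_ge0.
  move=> p pE; rewrite -/(Y p e) -lerBlDl -mulrA ler_pdivlMl//.
  apply: (@le_trans _ _ (expR (l * (`|Y p e| - t * r)))); first exact: le_expR.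
  rewrite mulrBr addrC expRD ler_wpM2l ?expR_ge0//.
  rewrite (big_rem p)//= -[leLHS]addr0 lerD//; last first.
    by apply: sumr_ge0 => q _; rewrite addr_ge0 ?expR_ge0.
  case: (ger0P (Y p e)) => _; first by rewrite ler_wpDr ?expR_ge0.
  by rewrite mulrN mulNr ler_wpDl ?expR_ge0.
rewrite rad_meanD rad_mean_cst rad_meanZ rad_mean_sum.
apply: (@le_trans _ _ (t * r + l^-1 * expR (- (l * (t * r))) *
    \sum_(p <- E) (2 * expR (2 * l ^+ 2 * r ^+ 2)))).
  rewrite lerD2l ler_wpM2l ?mulr_ge0 ?invr_ge0 ?expR_ge0 ?(ltW l0)//.
  rewrite big_seq [leRHS]big_seq; apply: ler_sum => p pE; rewrite rad_meanD.
  have h m : m ^+ 2 = l ^+ 2 -> rad_mean (fun e => expR (m * Y p e)) <=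
      expR (2 * l ^+ 2 * r ^+ 2).
    move=> ml; apply: le_trans (rademacher_mgf (a p) m) _.
    by rewrite ler_expR ml ler_wpM2l ?aE// mulr_ge0// sqr_ge0.
  by have := h l erefl; have := h (- l) (sqrrN l); lra.
rewrite big_const_seq count_predT iter_addr_0 -[_ *+ size E]mulr_natr.
have -> : l^-1 * expR (- (l * (t * r))) *
    (2 * expR (2 * l ^+ 2 * r ^+ 2) * (size E)%:R) =
    l^-1 * (2 * (size E)%:R) * expR (- (t ^+ 2 / 8)).
  have -> : - (t ^+ 2 / 8) = - (l * (t * r)) + 2 * l ^+ 2 * r ^+ 2.
    by rewrite /l; field; rewrite gt_eqF.
  by rewrite expRD; ring.
apply: (@le_trans _ _ (t * r + l^-1)).
  rewrite lerD2l -mulrA -[leRHS]mulr1 ler_wpM2l ?invr_ge0 ?(ltW l0)//.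
  by rewrite expRN ler_pdivrMr ?expR_gt0// mul1r.
have -> : l^-1 = 4 * (r / t) by rewrite /l invf_div mulrA.
have : r / t <= t * r.
  have t2 : 0 <= (t - 1) * (t + 1) by rewrite mulr_ge0//; lra.
  by rewrite ler_pdivrMr//; have := mulr_ge0 (ltW r0) t2; lra.
rewrite -mulrA; set u := r / t; set v := t * r; lra.
Qed.

Lemma pow4V_small (s e : R) : 0 < e ->
  exists L0, forall L, (L0 <= L)%N -> (4 ^+ L)^-1 * s <= e.
Proof.
move=> e0; exists (Num.truncn (`|s| / e)) => L LL.
have h : `|s| / e < L.+1%:R.
  have /andP[_] := truncn_itv (divr_ge0 (normr_ge0 s) (ltW e0)).
  by move=> /lt_le_trans; apply; rewrite ler_nat.
have p0 : 0 < 4 ^+ L :> R by rewrite exprn_gt0.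
rewrite ler_pdivrMl// (le_trans (ler_norm s))//.
move: h; rewrite ltr_pdivrMr// => /ltW/le_trans; apply.
rewrite ler_wpM2r ?(ltW e0)// (_ : 4 ^+ L = (4 ^ L)%:R :> R) ?ler_nat ?natrX//.
exact: ltn_expl.
Qed.

Lemma sum_pow2V_le J n : \sum_(J <= j < n) (2 ^+ j)^-1 <= 2 / 2 ^+ J :> R.
Proof.
have [Jn|nJ] := leqP J n; last first.
  by rewrite big_geq ?(ltnW nJ)// divr_ge0// exprn_ge0.
suff : \sum_(J <= j < n) (2 ^+ j)^-1 <= 2 / 2 ^+ J - 2 / 2 ^+ n :> R.
  by move=> /le_trans; apply; rewrite gerBl divr_ge0// exprn_ge0.
elim: n Jn => [|n ih] Jn.
  by move: Jn; rewrite leqn0 => /eqP ->; rewrite big_geq// subrr.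
move: Jn; rewrite leq_eqVlt => /orP[/eqP <-|]; first by rewrite big_geq// subrr.
rewrite ltnS => Jn; rewrite big_nat_recr//=; have := ih Jn.
rewrite [2 ^+ n.+1]exprS invfM mulrA divff// mul1r.
by set u := _ / 2 ^+ J; set v := (2 ^+ n)^-1; lra.
Qed.

End rademacher.

(** * Chaining along the nets *)

Section chaining.
Context {R : realType} {d : nat}.
Variables (X : set 'rV[R]_d) (K B : nat).
Hypothesis nets : has_nets X K B.

(* [chain_const * 2 ^ j] is the Gaussian tail level at which the number of pairs
   of points of the [j]-th and [j+1]-st nets is beaten. *)
Definition chain_const : R :=
  8 * (8 * K%:R ^+ 2 * B.+1%:R ^+ 2 + B.+1%:R ^+ 2) + 1.

Lemma chain_const_ge1 : 1 <= chain_const.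
Proof.
by rewrite /chain_const lerDr mulr_ge0// addr_ge0// ?mulr_ge0// ?sqr_ge0.
Qed.

(** Here [2 N^2 <= u b^(2 j)] with [b = B.+1] and [u = 8 K^2 b^2]. By [x <= expR x] and [j <= 4^j]
    this is at most [expR ((u + b^2) 4^j)], and [chain_const^2 >= chain_const >= 8 (u + b^2)]. *)
Lemma chain_const_card j (N : nat) : (N <= 2 * K * B.+1 ^ j.+1)%N ->
  2 * (N * N)%:R <= expR ((chain_const * 2 ^+ j) ^+ 2 / 8).
Proof.
move=> NK; set b : R := B.+1%:R; set q : R := K%:R.
have NR : N%:R <= 2 * q * b ^+ j.+1 :> R.
  by rewrite /q /b -natrX -!natrM ler_nat.
apply: (@le_trans _ _ (8 * q ^+ 2 * b ^+ 2 * (b ^+ 2) ^+ j)).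
  rewrite natrM.
  have -> : 8 * q ^+ 2 * b ^+ 2 * (b ^+ 2) ^+ j =
     2 * ((2 * q * b ^+ j.+1) * (2 * q * b ^+ j.+1)).
    have -> : (b ^+ 2) ^+ j = (b ^+ j) ^+ 2 by rewrite -!exprM mulnC.
    by rewrite [b ^+ j.+1]exprS; set p := b ^+ j; ring.
  by rewrite ler_wpM2l// ler_pM.
have p1 : 1 <= 4 ^+ j :> R by rewrite exprn_ege1// ler1n.
have jp : j%:R <= 4 ^+ j :> R.
  rewrite (_ : 4 ^+ j = (4 ^ j)%:R :> R) ?ler_nat ?natrX//.
  by rewrite ltnW// ltn_expl.
set u := 8 * q ^+ 2 * b ^+ 2.
have u0 : 0 <= u by rewrite /u !mulr_ge0 ?sqr_ge0.
have b0 : 0 <= b ^+ 2 by exact: sqr_ge0.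
apply: (@le_trans _ _ (expR (u * 4 ^+ j) * expR (b ^+ 2 * 4 ^+ j))).
  apply: ler_pM => //; first by rewrite exprn_ge0.
    by apply: le_trans (le_expR _); rewrite ler_peMr.
  apply: (@le_trans _ _ (expR (b ^+ 2) ^+ j)).
    by rewrite lerXn2r ?nnegrE ?expR_ge0// le_expR.
  by rewrite -expRM_natl mulrC ler_expR ler_wpM2l.
rewrite -expRD ler_expR exprMn -exprM mulnC exprM -mulrDl.
have -> : (2 : R) ^+ 2 = 4 by rewrite expr2 -natrM.
rewrite mulrAC ler_wpM2r ?exprn_ge0//.
have := chain_const_ge1; rewrite /chain_const -/q -/b -/u => c1.
set c := 8 * (u + b ^+ 2) + 1 in c1 *.
apply: (@le_trans _ _ (c / 8)); first by rewrite /c; lra.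
by rewrite ler_pM2r// expr2; nra.
Qed.

Section process.
Variables (k : nat) (phi : 'I_k -> 'rV[R]_d -> R) (b : 'I_k -> R) (r : R).
Hypothesis phi_lip : forall i x y, X x -> X y ->
  `|phi i x - phi i y| <= b i * `|x - y|.
Hypotheses (r_gt0 : 0 < r) (br : \sum_i b i ^+ 2 <= r ^+ 2).

Let Y e x y := \sum_i (-1) ^+ (e : {ffun 'I_k -> bool}) i * (phi i x - phi i y).

Let YD e x y z : Y e x z = Y e x y + Y e y z.
Proof. by rewrite -big_split; apply: eq_bigr => i _ /=; ring. Qed.

Let YN e x y : Y e x y = - Y e y x.
Proof. by rewrite -sumrN; apply: eq_bigr => i _ /=; ring. Qed.

Let Y_lip e x y : X x -> X y -> `|Y e x y| <= (\sum_i `|b i|) * `|x - y|.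
Proof.
move=> Xx Xy; rewrite mulr_suml (le_trans (ler_norm_sum _ _ _))//.
apply: ler_sum => i _; rewrite normrM normrX normrN1 expr1n mul1r.
by rewrite (le_trans (phi_lip i Xx Xy))// ler_wpM2r// ler_norm.
Qed.

(** The bound ignores the length of [Q]: only links between nets are counted. At level [j] links
    have scale [3 r / 4^j] and Gaussian level [chain_const * 2^j], so [rademacher_max] gives
    [15 chain_const r / 2^j]. Two chains and one middle link, and a geometric sum of ratio 1/2,
    account for [90 = 3 * 15 * 2]. *)
Lemma chaining J (Q : seq ('rV[R]_d * 'rV[R]_d)) :
  (forall p, p \in Q -> [/\ X p.1, X p.2 & `|p.1 - p.2| <= (4 ^+ J)^-1]) ->
  rad_mean (fun e => \big[Num.max/0]_(p <- Q)
     `|\sum_i (-1) ^+ e i * (phi i p.1 - phi i p.2)|)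
  <= 90 * chain_const * r / 2 ^+ J.
Proof.
move=> XQ.
have /choice[net netP] := nets.
have /choice[proj projP] : forall jx : nat * 'rV[R]_d, exists y,
    X jx.2 -> y \in net jx.1 /\ `|jx.2 - y| <= (4 ^+ jx.1)^-1.
  move=> [j x] /=; have [Xx|nX] := pselect (X x); last by exists 0.
  by have [_ _ /(_ x Xx)[y yn xy]] := netP j; exists y.
pose pr j x := proj (j, x).
have prn j x : X x -> pr j x \in net j by move=> Xx; have [] := projP (j, x) Xx.
have prd j x : X x -> `|x - pr j x| <= (4 ^+ j)^-1.
  by move=> Xx; have [] := projP (j, x) Xx.
have netX j y : y \in net j -> X y by move=> yn; have [h _ _] := netP j; exact: h.
have prX j x : X x -> X (pr j x) by move=> Xx; exact: netX (prn j x Xx).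
pose two j := net j ++ net j.+1.
(* Radius [3 / 4^j] accommodates both kinds of link: from the projection at level [j] to that at
   level [j+1], and, at level [J], between the projections of two points at distance at most
   [4^-J]. *)
pose links j := [seq p <- [seq (x, y) | x <- two j, y <- two j]
                | `|p.1 - p.2| <= 3 / 4 ^+ j].
pose mx j e := \big[Num.max/0]_(p <- links j) `|Y e p.1 p.2|.
have linkP j x y : x \in two j -> y \in two j -> `|x - y| <= 3 / 4 ^+ j ->
    forall e, `|Y e x y| <= mx j e.
  move=> xn yn xy e.
  apply: (@le_bigmax_mem _ _ (links j) (fun p => `|Y e p.1 p.2|) (x, y)).
  by rewrite mem_filter /= xy; apply: allpairs_f.
have pow4 j : (4 ^+ j.+1)^-1 <= (4 ^+ j)^-1 :> R.
  by rewrite lef_pV2 ?posrE ?exprn_gt0// exprS ler_peMl ?exprn_ge0// ler1n.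
have mx_mean j : rad_mean (mx j) <= 15 * chain_const * r / 2 ^+ j.
  have t1 : 1 <= chain_const * 2 ^+ j.
    rewrite -[leLHS]mulr1 ler_pM// ?chain_const_ge1//.
    by rewrite exprn_ege1// ler1n.
  have r0 : 0 < 3 / 4 ^+ j * r by rewrite mulr_gt0// divr_gt0// exprn_gt0.
  apply: le_trans (@rademacher_max R k _ (links j)
    (fun p i => phi i p.1 - phi i p.2) _ _ r0 t1 _ _) _.
  - move=> [x y]; rewrite mem_filter /= => /andP[xy /allpairsP[[x' y'] /=]].
    move=> [xn yn [xE yE]].
    have twoX z : z \in two j -> X z by rewrite mem_cat => /orP[]; exact: netX.
    rewrite -xE -yE in xn yn; rewrite [leRHS]exprMn.
    apply: (@le_trans _ _ (\sum_i (3 / 4 ^+ j) ^+ 2 * b i ^+ 2)).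
      apply: ler_sum => i _; rewrite -exprMn -(real_normK (num_real (_ - _))).
      have := phi_lip i (twoX _ xn) (twoX _ yn) => h.
      have b0 : 0 <= b i * `|x - y| by exact: le_trans h.
      have [bi|bi] := leP 0 (b i).
        rewrite lerXn2r ?nnegrE ?mulr_ge0 ?invr_ge0 ?exprn_ge0//.
        by rewrite (le_trans h)// mulrC ler_wpM2r.
      (* No sign is assumed on [b i]; a negative Lipschitz constant forces the two points to
         coincide. *)
      have xy0 : `|x - y| = 0.
        by apply/eqP; rewrite eq_le normr_ge0 andbT -(nmulr_rge0 _ bi).
      move: h; rewrite xy0 mulr0 normr_le0 => /eqP ->.
      by rewrite normr0 expr0n sqr_ge0.
    by rewrite -mulr_sumr ler_wpM2l// sqr_ge0.
  - apply: le_trans (chain_const_card (leqnn _)).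
    rewrite ler_wpM2l// ler_nat (leq_trans (size_subseq (filter_subseq _ _)))//.
    have s2 : (size (two j) <= 2 * K * B.+1 ^ j.+1)%N.
      rewrite size_cat; have [_ s1 _] := netP j; have [_ s2 _] := netP j.+1.
      rewrite (leq_trans (leq_add s1 s2))// -mulnA mul2n -addnn leq_add2r.
      by rewrite leq_mul2l leq_pexp2l ?orbT.
    by rewrite size_allpairs leq_mul.
  - have -> : (4 : R) ^+ j = 2 ^+ j * 2 ^+ j by rewrite -exprMn -natrM.
    have p0 : (2 : R) ^+ j != 0 by rewrite expf_neq0.
    by rewrite le_eqVlt; apply/orP; left; apply/eqP; field.
(* The chains stop at level [L]; what remains between a point and its projection there is bounded by
   the Lipschitz property alone and vanishes as [L] grows. *)
have key L : (J <= L)%N -> forall e p, p \in Q ->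
    `|Y e p.1 p.2| <= 2 * ((4 ^+ L)^-1 * \sum_i `|b i|) +
      3 * \sum_(J <= j < L.+1) mx j e.
  move=> JL e [x y] /XQ /= [Xx Xy xy].
  have mx0 j : 0 <= mx j e by exact: bigmax_ge0.
  have tail z : X z -> `|Y e z (pr L z)| <= (4 ^+ L)^-1 * \sum_i `|b i|.
    move=> Xz; rewrite (le_trans (Y_lip e Xz (prX L z Xz)))//.
    by rewrite mulrC ler_pM ?prd// sumr_ge0.
  have chain z l : X z -> (J <= l)%N ->
      `|Y e (pr J z) (pr l z)| <= \sum_(J <= j < l) mx j e.
    move=> Xz; elim: l => [|l ih] Jl.
      by move: Jl; rewrite leqn0 => /eqP ->; rewrite big_geq// /Y big1 ?normr0// => i _; rewrite subrr mulr0.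
    move: Jl; rewrite leq_eqVlt => /orP[/eqP <-|].
      by rewrite big_geq// /Y big1 ?normr0// => i _; rewrite subrr mulr0.
    rewrite ltnS => Jl; rewrite big_nat_recr//= (YD e _ (pr l z)).
    rewrite (le_trans (ler_normD _ _))// lerD ?ih//.
    apply: linkP; rewrite ?mem_cat ?prn ?orbT//.
    rewrite -[pr l z](subrK z) -addrA (le_trans (ler_normD _ _))//.
    rewrite distrC; have := prd l z Xz; have := prd l.+1 z Xz; have := pow4 l.
    have : 0 <= 4 ^- l :> R by rewrite invr_ge0 exprn_ge0.
    set u := 4 ^- l; set v := 4 ^- l.+1; lra.
  have mid : `|Y e (pr J x) (pr J y)| <= mx J e.
    apply: linkP; rewrite ?mem_cat ?prn//.
    rewrite (_ : _ - _ = (pr J x - x) + (x - y) + (y - pr J y)); last first.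
      by rewrite !subrKA.
    rewrite (le_trans (ler_normD _ _))// (le_trans (lerD (ler_normD _ _) (lexx _)))//.
    rewrite (distrC _ x); have := prd J x Xx; have := prd J y Xy; move: xy.
    by set u := (4 ^+ J)^-1; lra.
  have -> : Y e x y = Y e x (pr L x) - Y e (pr J x) (pr L x) +
      Y e (pr J x) (pr J y) + Y e (pr J y) (pr L y) - Y e y (pr L y).
    have := YD e x (pr J x) (pr L x); have := YD e x (pr J x) y.
    have := YD e (pr J x) (pr J y) y; have := YD e y (pr J y) (pr L y).
    by have := YN e (pr J y) y; lra.
  have Sle : mx J e <= \sum_(J <= j < L.+1) mx j e.
    by rewrite big_ltn// lerDl sumr_ge0.
  have Sle2 : \sum_(J <= j < L) mx j e <= \sum_(J <= j < L.+1) mx j e.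
    by rewrite big_nat_recr//= lerDl.
  have := tail x Xx; have := tail y Xy; have := chain x L Xx JL; have := chain y L Xy JL.
  set S := \sum_(J <= j < L.+1) _ in Sle Sle2 *.
  move=> c1 c2 t1 t2.
  rewrite (le_trans (ler_normB _ _))//.
  have := ler_normD (Y e x (pr L x) - Y e (pr J x) (pr L x) + Y e (pr J x) (pr J y)) (Y e (pr J y) (pr L y)).
  have := ler_normD (Y e x (pr L x) - Y e (pr J x) (pr L x)) (Y e (pr J x) (pr J y)).
  have := ler_normB (Y e x (pr L x)) (Y e (pr J x) (pr L x)).
  by lra.
apply/ler_addgt0Pr => eps eps0.
have [L0 L0P] := @pow4V_small R (\sum_i `|b i|) (eps / 2) (divr_gt0 eps0 (ltr0Sn _ 1)).
pose L := maxn J L0.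
have JL : (J <= L)%N by rewrite leq_maxl.
apply: (@le_trans _ _ (rad_mean (fun e : {ffun 'I_k -> bool} =>
    eps + 3 * \sum_(J <= j < L.+1) mx j e))).
  apply: rad_mean_le => e; apply: bigmax_le_mem.
    rewrite addr_ge0 ?(ltW eps0)// mulr_ge0// sumr_ge0// => j _.
    exact: bigmax_ge0.
  move=> p pQ; apply: le_trans (key L JL e p pQ) _.
  by rewrite lerD2r; have := L0P L (leq_maxr _ _); lra.
rewrite rad_meanD rad_mean_cst rad_meanZ rad_mean_sum addrC lerD2r.
apply: (@le_trans _ _ (3 * \sum_(J <= j < L.+1) 15 * chain_const * r * (2 ^+ j)^-1)).
  by rewrite ler_wpM2l// ler_sum.
have c0 : 0 <= 15 * chain_const * r.
  by rewrite !mulr_ge0 ?(ltW r_gt0)// (le_trans _ chain_const_ge1).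
rewrite -mulr_sumr; have := ler_wpM2l c0 (sum_pow2V_le J L.+1).
by set u := \sum_(_ <= _ < _) _; set v := (2 ^+ J)^-1; lra.
Qed.

End process.

End chaining.

(** * Oscillation of the empirical process *)

(** The form in which the hypotheses are used: sup norm instead of l2 norm, and a Lipschitz constant
    normalised to be at least 1, so that [Ex F M] may be divided by. *)
Record regular_problem {dX : measure_display} {R : realType} {d : nat}
    {Xi : measurableType dX} (F : probability Xi R) (X : set 'rV[R]_d)
    (h : 'rV[R]_d -> Xi -> R) (M : Xi -> R) (K B : nat) : Prop := RegularProblem {
  reg_M_ge1 : forall z, 1 <= M z;
  reg_M_L2 : L2 F M;
  reg_h_L2 : forall x, X x -> L2 F (h x);
  reg_lip : forall z x y, X x -> X y -> `|h x z - h y z| <= M z * `|x - y|;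
  reg_nets : has_nets X K B }.

Section sample_mean.
Context {R : realType} {T : Type}.

Definition smean (J : seq nat) (s : nat -> T) (v : T -> R) : R :=
  (size J)%:R^-1 * \sum_(i <- J) v (s i).

Lemma smeanB J s u v :
  smean J s (fun z => u z - v z) = smean J s u - smean J s v.
Proof. by rewrite /smean sumrB mulrBr. Qed.

Lemma smean_cst J s c : (0 < size J)%N -> smean J s (fun=> c) = c.
Proof.
move=> J0; rewrite /smean big_const_seq count_predT iter_addr_0 -[c *+ _]mulr_natl.
by rewrite mulKf// pnatr_eq0 -lt0n.
Qed.

Lemma smeanZ J s c v : smean J s (fun z => c * v z) = c * smean J s v.
Proof. by rewrite /smean -mulr_sumr mulrCA. Qed.

Lemma smean_le J s u v : (forall z, u z <= v z) -> smean J s u <= smean J s v.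
Proof. by move=> uv; rewrite ler_wpM2l ?invr_ge0// ler_sum. Qed.

Lemma smean_ge0 J s v : (forall z, 0 <= v z) -> 0 <= smean J s v.
Proof. by move=> v0; rewrite mulr_ge0 ?invr_ge0// sumr_ge0. Qed.

Lemma ler_norm_smean J s v : `|smean J s v| <= smean J s (fun z => `|v z|).
Proof.
rewrite normrM ger0_norm ?invr_ge0// ler_wpM2l ?invr_ge0//.
exact: ler_norm_sum.
Qed.

End sample_mean.

Section smean_moments.
Context {dO dX : measure_display} {R : realType}.
Context {Omega : measurableType dO} {Xi : measurableType dX}.
Variables (P : probability Omega R) (F : probability Xi R).
Variable xi : nat -> Omega -> Xi.
Hypothesis Hiid : iid_from P F xi.

Let mxi i : measurable_fun setT (xi i).
Proof. by case: Hiid. Qed.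

Lemma measurable_smean J (v : Xi -> R) : measurable_fun setT v ->
  measurable_fun setT (fun s : seq_space Xi => smean J s v).
Proof.
move=> mv; apply: measurable_funM => //; apply: measurable_sum => i.
by apply: measurableT_comp => //; exact: measurable_coord.
Qed.

Lemma L1_smean J v s : L1 F v -> L1 P (fun w => smean J (sample xi s w) v).
Proof. by move=> vi; apply/L1Z/L1_sum => i _; exact: (L1_coord Hiid). Qed.

Lemma L2_smean J v s : L2 F v -> L2 P (fun w => smean J (sample xi s w) v).
Proof. by move=> v2; apply/L2Z/L2_sum => i _; exact: (L2_coord Hiid). Qed.

Lemma Ex_smean J v s : (0 < size J)%N -> L1 F v ->
  Ex P (fun w => smean J (sample xi s w) v) = Ex F v.
Proof.
move=> J0 vi; have vi' i := L1_coord Hiid (s i) vi.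
rewrite ExZ; last by apply: L1_sum => i _; exact: vi'.
rewrite Ex_sum; last by move=> i _; exact: vi'.
have E i : Ex P (fun w => v (sample xi s w i)) = Ex F v.
  exact: (Ex_coord Hiid (s i)).
under eq_bigr do rewrite E.
rewrite big_const_seq count_predT iter_addr_0 -[Ex F v *+ _]mulr_natl.
by rewrite mulKf// pnatr_eq0 -lt0n.
Qed.

Lemma Ex_sqr_smean J v s : uniq J -> (0 < size J)%N -> injective s ->
  L2 F v -> Ex F v = 0 ->
  Ex P (fun w => smean J (sample xi s w) v ^+ 2) =
  Ex F (fun z => v z ^+ 2) / (size J)%:R.
Proof.
move=> uJ J0 sinj v2 v0.
have := @Ex_sqr_sum _ _ _ _ _ _ _ _ Hiid v [seq s i | i <- J].
rewrite map_inj_uniq// size_map => /(_ uJ v2 v0).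
under eq_Ex do rewrite big_map; move=> E.
transitivity (Ex P (fun w =>
    ((size J)%:R^-1) ^+ 2 * (\sum_(i <- J) v (xi (s i) w)) ^+ 2)).
  by apply: eq_Ex => w; rewrite /smean exprMn.
rewrite ExZ ?E; last first.
  by apply: L2_sqr; apply: L2_sum => i _; exact: (L2_coord Hiid).
by field; rewrite pnatr_eq0 -lt0n.
Qed.

Lemma Ex_abs_smean J v s : uniq J -> (0 < size J)%N -> injective s ->
  L2 F v -> Ex F v = 0 ->
  Ex P (fun w => `|smean J (sample xi s w) v|) <=
  (Ex F (fun z => v z ^+ 2) + 1) / 2 / Num.sqrt (size J)%:R.
Proof.
move=> uJ J0 sinj v2 v0; set q := Num.sqrt _.
have q0 : 0 < q by rewrite sqrtr_gt0 ltr0n.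
have q2 : (size J)%:R = q ^+ 2 by rewrite sqr_sqrtr.
(* With second moment of order [1 / q^2], the free parameter of [Ex_abs_le] is best of order
   [1 / q]. *)
have c0 : 0 < q^-1 by rewrite invr_gt0.
apply: le_trans (Ex_abs_le c0 (L2_smean J s v2)) _.
rewrite (Ex_sqr_smean uJ)// q2 le_eqVlt; apply/orP; left; apply/eqP.
by field; rewrite gt_eqF.
Qed.

End smean_moments.

Section modulus.
Context {dO dX : measure_display} {R : realType} {d : nat}.
Context {Omega : measurableType dO} {Xi : measurableType dX}.
Variables (P : probability Omega R) (F : probability Xi R).
Variable xi : nat -> Omega -> Xi.
Hypothesis Hiid : iid_from P F xi.
Variables (X : set 'rV[R]_d) (h : 'rV[R]_d -> Xi -> R) (M : Xi -> R) (K B : nat).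
Hypothesis reg : regular_problem F X h M K B.

Definition centered x z := h x z - Ex F (h x).

Lemma L2_centered x : X x -> L2 F (centered x).
Proof. by move=> /(reg_h_L2 reg) ?; apply: L2B => //; exact: L2_cst. Qed.

Lemma Ex_centered x : X x -> Ex F (centered x) = 0.
Proof.
move=> /(reg_h_L2 reg)/L2_L1 hi.
by rewrite ExB ?Ex_cst ?subrr//; exact: L1_cst.
Qed.

Definition modulus k (Q : seq ('rV[R]_d * 'rV[R]_d)) (s : nat -> Xi) : R :=
  \big[Num.max/0]_(p <- Q)
    `|smean (iota 0 k) s (centered p.1) - smean (iota 0 k) s (centered p.2)|.

Variables (J : nat) (Q : seq ('rV[R]_d * 'rV[R]_d)).
Hypothesis XQ : forall p, p \in Q ->
  [/\ X p.1, X p.2 & `|p.1 - p.2| <= (4 ^+ J)^-1].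

Lemma measurable_modulus k :
  measurable_fun setT (modulus k Q : seq_space Xi -> R).
Proof.
have H (S : seq ('rV[R]_d * 'rV[R]_d)) : {subset S <= Q} ->
    measurable_fun setT (modulus k S : seq_space Xi -> R).
  elim: S => [|p S ih] SQ.
    rewrite (_ : modulus k [::] = fun=> 0)//.
    by apply/funext => s; rewrite /modulus big_nil.
  rewrite (_ : modulus k (p :: S) = fun s => Num.max
    `|smean (iota 0 k) s (centered p.1) - smean (iota 0 k) s (centered p.2)|
    (modulus k S s)); last by apply/funext => s; rewrite /modulus big_cons.
  apply: measurable_maxr; last first.
    by apply: ih => q qS; apply: SQ; rewrite inE qS orbT.
  have [Xp1 Xp2 _] := XQ (SQ p (mem_head _ _)).
  apply: measurableT_comp => //; apply: measurable_funB.
    by apply: measurable_smean; have [] := L2_centered Xp1.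
  by apply: measurable_smean; have [] := L2_centered Xp2.
exact: H.
Qed.

Let modulus_le_sum k s : modulus k Q s <= \sum_(p <- Q)
    `|smean (iota 0 k) s (fun z => centered p.1 z - centered p.2 z)|.
Proof.
apply: bigmax_le_mem => [|p pQ]; first by rewrite sumr_ge0.
by rewrite -smeanB (big_rem p)//= lerDl sumr_ge0.
Qed.

Let L2_diff p : p \in Q -> L2 F (fun z => centered p.1 z - centered p.2 z).
Proof. by move=> /XQ[X1 X2 _]; apply: L2B; exact: L2_centered. Qed.

Let L1_sum_diff k s : L1 P (fun w => \sum_(p <- Q)
  `|smean (iota 0 k) (sample xi s w) (fun z => centered p.1 z - centered p.2 z)|).
Proof.
under eq_fun do rewrite big_seq.
by apply: L1_sum => p pQ; apply/L1_norm/L2_L1/(L2_smean Hiid)/L2_diff.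
Qed.

Lemma L1_modulus k s : L1 P (fun w => modulus k Q (sample xi s w)).
Proof.
apply: L1_le (L1_sum_diff k s) => [|w].
  apply: measurableT_comp; first exact: measurable_modulus.
  exact: (measurable_sample Hiid).
by rewrite ger0_norm ?bigmax_ge0//; exact: modulus_le_sum.
Qed.

Definition mean_modulus k := Ex P (fun w => modulus k Q (sample xi id w)).

(** Here [C] depends on [Q]. The bound serves only to start the doubling argument, where its
    contribution dies out geometrically. *)
Lemma mean_modulus_crude : exists2 C, 0 <= C &
  forall k, (0 < k)%N -> mean_modulus k <= C / Num.sqrt k%:R.
Proof.
exists (\sum_(p <- Q) (Ex F (fun z => (centered p.1 z - centered p.2 z) ^+ 2) + 1) / 2).
  rewrite sumr_ge0// => p _; rewrite divr_ge0// addr_ge0// Ex_ge0// => z.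
  exact: sqr_ge0.
move=> k k0; apply: le_trans (Ex_le (L1_modulus k _) (L1_sum_diff k _)
  (fun w => modulus_le_sum k _)) _.
under eq_Ex do rewrite big_seq.
rewrite Ex_sum; last first.
  by move=> p pQ; apply/L1_norm/L2_L1/(L2_smean Hiid)/L2_diff.
rewrite -big_seq mulr_suml big_seq [leRHS]big_seq; apply: ler_sum => p pQ.
have := Ex_abs_smean Hiid (iota_uniq 0 k) _ (@inj_id nat) (L2_diff pQ).
rewrite size_iota; apply => //.
have [X1 X2 _] := XQ pQ; rewrite ExB ?Ex_centered ?subrr//.
  exact: L2_L1 (L2_centered X1).
exact: L2_L1 (L2_centered X2).
Qed.

Definition modulus_const : R :=
  90 * chain_const K B * (4 * Ex F (fun z => M z ^+ 2) + 1) / 4.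

Lemma modulus_const_ge0 : 0 <= modulus_const.
Proof.
rewrite /modulus_const !mulr_ge0// ?(le_trans _ (chain_const_ge1 _ _))//.
by rewrite addr_ge0// mulr_ge0// Ex_ge0// => z; exact: sqr_ge0.
Qed.

(** From each pair of observations [j], [k + j] with [j < k], the sign [e j] selects one; the
    remaining indices are shifted out of the way to keep the map injective. *)
Let half k (e : {ffun 'I_k -> bool}) (j : nat) : nat :=
  if insub j is Some i then (if e i then (k + j)%N else j) else (k + j)%N.

Let half_inj k e : injective (@half k e).
Proof.
move=> i j; rewrite /half.
case: insubP => [[i' ?] /= ik ii|]; case: insubP => [[j' ?] /= jk jj|];
  try case: ifP; try case: ifP; subst => //; lia.
Qed.

(** Symmetrisation as an identity: a half-sample mean is the full-sample mean plus a Rademacher sum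
    of the pair differences. *)
Let smean_half k (e : {ffun 'I_k -> bool}) (s : nat -> Xi) (v : Xi -> R) : (0 < k)%N ->
  smean (iota 0 k) (s \o half e) v = smean (iota 0 (k + k)) s v +
  (2 * k%:R)^-1 * \sum_(i < k) (-1) ^+ e i * (v (s i) - v (s (k + i)%N)).
Proof.
move=> k0; have kn0 : k%:R != 0 :> R by rewrite pnatr_eq0 -lt0n.
rewrite /smean !size_iota iotaD big_cat /= add0n.
have -> : iota k k = [seq (k + j)%N | j <- iota 0 k] by rewrite -iotaDl addn0.
rewrite big_map.
have toord (u : nat -> R) : \sum_(i <- iota 0 k) u i = \sum_(i < k) u i.
  by rewrite -[in iota _ _](subn0 k) -/(index_iota 0 k) big_mkord.
rewrite !toord natrD.
have E (i : 'I_k) : v ((s \o half e) i) = 2^-1 * (v (s i) + v (s (k + i)%N)) +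
    2^-1 * ((-1) ^+ e i * (v (s i) - v (s (k + i)%N))).
  rewrite /half /=; case: insubP => [i' _ ii|]; last by rewrite ltn_ord.
  have -> : i' = i by exact: val_inj.
  by case: (e i); rewrite ?expr1 ?expr0 /=; lra.
rewrite (eq_bigr _ (fun i _ => E i)) big_split -!mulr_sumr big_split /=.
by field; rewrite kn0 -natrD pnatr_eq0 -lt0n addn_gt0 k0.
Qed.

(** All half-samples of [2 k] observations have the same law, so the mean modulus at [k] is also the
    mean of its average over [e]. With the observations frozen, that average is the modulus at [2 k]
    plus a Rademacher maximum, to which [chaining] applies. *)
Lemma mean_modulus_double k : (0 < k)%N ->
  mean_modulus k <= mean_modulus (k + k) + modulus_const / 2 ^+ J / Num.sqrt k%:R.
Proof.
move=> k0; set q := Num.sqrt _.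
have q0 : 0 < q by rewrite sqrtr_gt0 ltr0n.
have q2 : k%:R = q ^+ 2 by rewrite sqr_sqrtr.
pose b (s : nat -> Xi) (i : nat) := M (s i) + M (s (k + i)%N).
(* By AM-GM [r s] dominates the square root of the sum of the [b s i ^+ 2], while its mean needs
   only second moments. The factor [1 / (2 k)] times the mean [(4 E M^2 + 1) q / 2] is the source of
   the final [/ 4] in [modulus_const]. *)
pose r s := (\sum_(i < k) b s i ^+ 2 / q + q) / 2.
pose c := 90 * chain_const K B / 2 ^+ J / (2 * k%:R) : R.
have c0 : 0 <= c.
  by rewrite /c !mulr_ge0 ?invr_ge0 ?exprn_ge0 ?(le_trans _ (chain_const_ge1 _ _))// mulr_ge0.
have rad (s : nat -> Xi) :
    rad_mean (fun e : {ffun 'I_k -> bool} => modulus k Q (s \o half e)) <=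
    modulus (k + k) Q s + c * r s.
  pose phi i x := h x (s i) - h x (s (k + i)%N).
  have b1 i : 2 <= b s i.
    by have := reg_M_ge1 reg (s i); have := reg_M_ge1 reg (s (k + i)%N); rewrite /b; lra.
  have S0 : 0 <= \sum_(i < k) b s i ^+ 2 by rewrite sumr_ge0// => i _; exact: sqr_ge0.
  have r0 : 0 < r s.
    by rewrite divr_gt0// ltr_wpDl// -mulr_suml divr_ge0// ltW.
  have br : \sum_(i < k) b s i ^+ 2 <= r s ^+ 2.
    rewrite /r -mulr_suml; set S := \sum_(i < k) _ in S0 *.
    rewrite -subr_ge0 (_ : _ - _ = ((S / q - q) / 2) ^+ 2) ?sqr_ge0//.
    by field; rewrite gt_eqF.
  have lip (i : 'I_k) x y : X x -> X y -> `|phi i x - phi i y| <= b s i * `|x - y|.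
    move=> Xx Xy; rewrite /phi /b mulrDl.
    have -> : h x (s i) - h x (s (k + i)%N) - (h y (s i) - h y (s (k + i)%N)) =
      (h x (s i) - h y (s i)) - (h x (s (k + i)%N) - h y (s (k + i)%N)) by ring.
    by rewrite (le_trans (ler_normB _ _))// lerD// (reg_lip reg).
  have := @chaining R d X K B (reg_nets reg) k (fun i => phi i) (fun i => b s i)
    (r s) lip r0 br J Q XQ.
  set W := fun e => \big[Num.max/0]_(p <- Q) _ => WQ.
  apply: (@le_trans _ _ (rad_mean (fun e => modulus (k + k) Q s + (2 * k%:R)^-1 * W e))).
    apply: rad_mean_le => e; apply: bigmax_le_mem => [|p pQ].
      by rewrite addr_ge0 ?bigmax_ge0// mulr_ge0 ?invr_ge0 ?mulr_ge0 ?bigmax_ge0.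
    rewrite !smean_half//.
    have -> : forall a b c d : R, a + b - (c + d) = (a - c) + (b - d) by move=> *; ring.
    rewrite (le_trans (ler_normD _ _))// lerD//.
      exact: (@le_bigmax_mem _ _ Q (fun p => `|smean (iota 0 (k + k)) s (centered p.1) -
        smean (iota 0 (k + k)) s (centered p.2)|)).
    rewrite -mulrBr normrM ger0_norm ?invr_ge0 ?mulr_ge0// ler_wpM2l ?invr_ge0 ?mulr_ge0//.
    rewrite -sumrB (eq_bigr (fun i => (-1) ^+ e i * (phi i p.1 - phi i p.2))).
      exact: (@le_bigmax_mem _ _ Q (fun p => `|\sum_i (-1) ^+ e i * (phi i p.1 - phi i p.2)|)).
    by move=> i _; rewrite /phi /centered; ring.
  rewrite rad_meanD rad_mean_cst rad_meanZ lerD2l.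
  rewrite (le_trans (ler_wpM2l _ WQ)) ?invr_ge0 ?mulr_ge0//.
  by rewrite /c le_eqVlt; apply/orP; left; apply/eqP; ring.
have M2 := reg_M_L2 reg.
have mb2 i : L2 P (fun w => b (sample xi id w) i).
  by apply: L2D; exact: (L2_coord Hiid).
have rL : L1 P (fun w => r (sample xi id w)).
  rewrite /r; under eq_fun do rewrite mulrC.
  apply: L1Z; apply: L1D; last exact: L1_cst.
  apply: L1_sum => i _; under eq_fun do rewrite mulrC.
  by apply: L1Z; exact: L2_sqr.
have rE : Ex P (fun w => r (sample xi id w)) <= (4 * Ex F (fun z => M z ^+ 2) + 1) * q / 2.
  pose m := Ex F (fun z => M z ^+ 2).
  have Mi j : L1 P (fun w => M (xi j w) ^+ 2).
    exact: (L1_coord Hiid j (L2_sqr M2)).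
  have ME j : Ex P (fun w => M (xi j w) ^+ 2) = m.
    exact: (Ex_coord Hiid j (L2_sqr M2)).
  have ub w : r (sample xi id w) <= (2 * q)^-1 *
      \sum_(i < k) 2 * (M (xi i w) ^+ 2 + M (xi (k + i)%N w) ^+ 2) + q / 2.
    rewrite /r mulrDl lerD2r -mulr_suml invfM -[leRHS]mulrA mulrC ler_wpM2l ?invr_ge0//.
    rewrite mulrC ler_wpM2l ?invr_ge0 ?(ltW q0)// ler_sum// => i _.
    rewrite /b /sample /=; set u := M _; set v := M (xi _ _).
    by have := sqr_ge0 (u - v); lra.
  have ubL : L1 P (fun w => \sum_(i < k) 2 * (M (xi i w) ^+ 2 + M (xi (k + i)%N w) ^+ 2)).
    by apply: L1_sum => i _; apply: L1Z; exact: L1D.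
  apply: le_trans (Ex_le rL (L1D (L1Z _ ubL) (L1_cst _ _)) ub) _.
  rewrite (ExD (L1Z _ ubL) (L1_cst _ _)) (ExZ _ ubL) Ex_cst Ex_sum; last first.
    by move=> i _; apply: L1Z; exact: L1D.
  under eq_bigr => i _ do rewrite (ExZ _ (L1D (Mi _) (Mi _))) (ExD (Mi _) (Mi _)) !ME.
  rewrite sumr_const card_ord -[_ *+ k]mulr_natl q2 -/m.
  by rewrite le_eqVlt; apply/orP; left; apply/eqP; field; rewrite gt_eqF.
have E e : Ex P (fun w => modulus k Q (sample xi id w \o @half k e)) = mean_modulus k.
  apply/esym/(Ex_sample Hiid (measurable_modulus k) (@inj_id nat) (@half_inj k e)).
  exact: L1_modulus.
have L e : L1 P (fun w => modulus k Q (sample xi id w \o @half k e)).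
  exact: (L1_modulus k (@half k e)).
have -> : mean_modulus k = Ex P (fun w =>
    rad_mean (fun e : {ffun 'I_k -> bool} => modulus k Q (sample xi id w \o half e))).
  rewrite ExZ; last by apply: L1_sum => e _; exact: L.
  rewrite Ex_sum; last by move=> e _; exact: L.
  by under eq_bigr do rewrite E; rewrite -/(rad_mean _) rad_mean_cst.
apply: le_trans (Ex_le _ (L1D (L1_modulus (k + k) id) (L1Z c rL)) (fun w => rad _)) _.
  by apply: L1Z; apply: L1_sum => e _; exact: L.
rewrite (ExD (L1_modulus (k + k) id) (L1Z c rL)) (ExZ _ rL) lerD2l.
apply: le_trans (ler_wpM2l c0 rE) _.
rewrite /c q2 /modulus_const le_eqVlt; apply/orP; left; apply/eqP.
by field; rewrite gt_eqF//= expf_neq0.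
Qed.

(** Put [a_k = sqrt k * mean_modulus k] and [D = modulus_const / 2^J]. Doubling reads
    [a_k <= a_(2k) / sqrt 2 + D], and [1 / sqrt 2 <= 3 / 4], so [n] doublings give
    [4 D + C (3/4)^n]: [4 D] is the fixed point of [x = 3/4 x + D]. *)
Lemma mean_modulus_le k : (0 < k)%N ->
  Num.sqrt k%:R * mean_modulus k <= 4 * modulus_const / 2 ^+ J.
Proof.
move=> k0; have [C C0 crude] := mean_modulus_crude.
set D := modulus_const / 2 ^+ J.
have D0 : 0 <= D by rewrite divr_ge0 ?modulus_const_ge0// exprn_ge0.
suff H n : forall k, (0 < k)%N ->
    Num.sqrt k%:R * mean_modulus k <= 4 * D + C * (3 / 4) ^+ n.
  have cv : (fun n => 4 * D + C * (3 / 4 : R) ^+ n) @ \oo --> 4 * D + C * 0.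
    apply: cvgD; first exact: cvg_cst.
    by apply: cvgMr; apply: cvg_expr; rewrite ger0_norm//; lra.
  rewrite mulr0 addr0 in cv; rewrite -mulrA -/D.
  rewrite -(cvg_lim (@Rhausdorff R) cv); apply: limr_ge; first by apply/cvg_ex; eexists; exact: cv.
  by apply: nearW => n; exact: H.
elim: n => [|n ih] {k k0} k k0.
  have q0 : 0 < Num.sqrt k%:R :> R by rewrite sqrtr_gt0 ltr0n.
  rewrite mulr1 mulrC -ler_pdivlMr// (le_trans (crude k k0))// ler_pM2r ?invr_gt0//.
  by rewrite lerDr mulr_ge0.
have q0 : 0 < Num.sqrt k%:R :> R by rewrite sqrtr_gt0 ltr0n.
have := ler_wpM2l (ltW q0) (mean_modulus_double k0).
rewrite mulrDr -/D [_ * (D / _)]mulrC divfK ?gt_eqF// => /le_trans; apply.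
have kk : (0 < k + k)%N by rewrite addn_gt0 k0.
have := ih _ kk.
have -> : Num.sqrt (k + k)%:R = Num.sqrt 2 * Num.sqrt k%:R :> R.
  by rewrite -sqrtrM// -natrM mul2n -addnn.
set a := Num.sqrt k%:R * mean_modulus (k + k).
have a0 : 0 <= a by rewrite mulr_ge0 ?(ltW q0)// /mean_modulus Ex_ge0// => w; exact: bigmax_ge0.
rewrite -mulrA -/a => ak.
have : 4 / 3 * a <= 4 * D + C * (3 / 4) ^+ n.
  apply: le_trans ak; rewrite ler_wpM2r//.
  rewrite -(@ler_pXn2r _ 2) ?nnegrE ?sqrtr_ge0// sqr_sqrtr//; lra.
rewrite exprS; set u := (3 / 4) ^+ n; lra.
Qed.

End modulus.

(** * The expected regret *)

Lemma ae0_Ex {d : measure_display} {T : measurableType d} {R : realType}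
    (P : probability T R) (f : T -> R) :
  measurable_fun setT f -> {ae P, forall x, f x = 0} -> Ex P f = 0.
Proof.
move=> mf f0; rewrite /Ex /Rintegral.
have -> : (\int[P]_x (f x)%:E = \int[P]_x (cst 0 x))%E.
  apply: ae_eq_integral => //; first exact/measurable_EFinP.
  by apply: filterS f0 => x /= -> _.
by rewrite integral0.
Qed.

Record unique_minimizer {dX : measure_display} {R : realType} {d : nat}
    {Xi : measurableType dX} (F : probability Xi R) (X : set 'rV[R]_d)
    (h : 'rV[R]_d -> Xi -> R) (x0 : 'rV[R]_d) (D : R) : Prop := UniqueMinimizer {
  min_in : X x0;
  min_le : forall x, X x -> Ex F (h x0) <= Ex F (h x);
  min_unique : forall x, X x -> Ex F (h x) = Ex F (h x0) ->
    {ae F, forall z, h x z = h x0 z};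
  min_radius : forall x, X x -> `|x - x0| <= D }.

Section optimum.
Context {dO dX : measure_display} {R : realType} {d : nat}.
Context {Omega : measurableType dO} {Xi : measurableType dX}.
Variables (P : probability Omega R) (F : probability Xi R).
Variable xi : nat -> Omega -> Xi.
Hypothesis Hiid : iid_from P F xi.
Variables (X : set 'rV[R]_d) (h : 'rV[R]_d -> Xi -> R) (M : Xi -> R) (K B : nat).
Hypothesis reg : regular_problem F X h M K B.
Variables (x0 : 'rV[R]_d) (D : R).
Hypothesis opt : unique_minimizer F X h x0 D.
Hypothesis cptX : compact X.

Let Z x := Ex F (h x).

Let L1h x : X x -> L1 F (h x).
Proof. by move=> /(reg_h_L2 reg)/L2_L1. Qed.

Let L1M : L1 F M := L2_L1 (reg_M_L2 reg).

Let EM_ge1 : 1 <= Ex F M.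
Proof.
rewrite -(Ex_cst F 1); apply: Ex_le => //; first exact: L1_cst.
exact: reg_M_ge1 reg.
Qed.

Lemma risk_lip x y : X x -> X y -> `|Z x - Z y| <= Ex F M * `|x - y|.
Proof.
move=> Xx Xy; rewrite /Z -(ExB (L1h Xx) (L1h Xy)).
apply: le_trans (Ex_norm (L1B (L1h Xx) (L1h Xy))) _.
rewrite mulrC -(ExZ _ L1M); apply: Ex_le.
- by apply/L1_norm/L1B; exact: L1h.
- exact: L1Z.
- by move=> z; rewrite mulrC (reg_lip reg).
Qed.

(** Cover [X] by balls: radius [rho] around an optimal point, and around any other a radius on which
    the risk, being Lipschitz, loses at most half of its excess. A finite subcover gives [zs] and,
    as the least half-excess, [eta]; the default 1 of the minimum covers the case of optimal centres
    only. *)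
Lemma near_or_suboptimal (rho : R) : 0 < rho ->
  exists (zs : seq 'rV[R]_d) (eta : R),
  [/\ 0 < eta, forall z, z \in zs -> X z /\ Z z = Z x0 &
   forall x, X x -> (exists2 z, z \in zs & `|x - z| <= rho) \/ Z x0 + eta <= Z x].
Proof.
move=> rho0.
pose gap x := (Z x - Z x0) / 2.
pose rad x := if Z x == Z x0 then rho else gap x / Ex F M.
have EM0 : 0 < Ex F M by exact: lt_le_trans EM_ge1.
have gap0 x : X x -> Z x != Z x0 -> 0 < gap x.
  move=> Xx nx; rewrite divr_gt0// subr_gt0 lt_neqAle eq_sym nx.
  exact: (min_le opt).
have rad0 x : X x -> 0 < rad x.
  move=> Xx; rewrite /rad; case: ifPn => // nx.
  by rewrite divr_gt0// gap0.
have := cptX; rewrite compact_cover => /(_ _ X (fun x => ball x (rad x))).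
case=> [x Xx|x Xx|S SX XS]; first by apply: ball_open; exact: rad0.
  by exists x => //; exact: ballxx (rad0 x Xx).
exists [seq z <- S | Z z == Z x0].
exists (\big[Num.min/1]_(z <- S | Z z != Z x0) gap z).
have SX' z : z \in S -> X z by move=> /SX; rewrite inE.
split.
- rewrite big_seq_cond; apply: lt_bigmin => //= z /andP[zS nz].
  exact: gap0 (SX' z zS) nz.
- by move=> z; rewrite mem_filter => /andP[/eqP zZ /SX'].
- move=> x Xx; have [z /= zS] := XS _ Xx.
  rewrite -ball_normE /= /rad => xz.
  case: ifPn xz => [zZ xz|nz xz].
    by left; exists z; [rewrite mem_filter zZ|rewrite distrC ltW].
  right; rewrite -lerBrDl; apply: (@le_trans _ _ (gap z)).
    by apply: ge_bigmin_seq.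
  have := risk_lip (SX' _ zS) Xx.
  have : Ex F M * `|z - x| <= gap z by rewrite -ler_pdivlMl// mulrC ltW.
  by rewrite ler_norml /gap => ? /andP[]; lra.
Qed.

(** The quantity [tau] of the subsample with indices [J], as a function of the whole sequence, so
    that re-indexing acts on it. *)
Definition regret (J : seq nat) (s : nat -> Xi) : R :=
  smean J s (h x0) - saa_value X h [seq s i | i <- J].

Let smean_lip J s x y : X x -> X y ->
  `|smean J s (h x) - smean J s (h y)| <= `|x - y| * smean J s M.
Proof.
move=> Xx Xy; rewrite -smeanB (le_trans (ler_norm_smean _ _ _))//.
rewrite -smeanZ; apply: smean_le => z /=; rewrite mulrC.
exact: (reg_lip reg).
Qed.

Let M_ge0 z : 0 <= M z.
Proof. by rewrite (le_trans _ (reg_M_ge1 reg z)). Qed.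

Let D_ge0 : 0 <= D.
Proof. exact: le_trans (normr_ge0 _) (min_radius opt (min_in opt)). Qed.

Lemma saa_valueE J (s : nat -> Xi) :
  saa_value X h [seq s i | i <- J] = inf [set smean J s (h x) | x in X].
Proof.
rewrite /saa_value size_map /smean; congr inf; apply/seteqP.
by split=> _ [x Xx <-]; exists x => //; rewrite big_map.
Qed.

Let smean_lbound J s : has_lbound [set smean J s (h x) | x in X].
Proof.
exists (smean J s (h x0) - D * smean J s M) => _ [x Xx <-].
have := smean_lip J s Xx (min_in opt); rewrite ler_norml => /andP[+ _].
have : `|x - x0| * smean J s M <= D * smean J s M.
  by rewrite ler_wpM2r ?smean_ge0// (min_radius opt).
lra.
Qed.

Lemma regret_ge J s x : X x ->
  smean J s (h x0) - smean J s (h x) <= regret J s.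
Proof.
by move=> Xx; rewrite lerD2l lerN2 saa_valueE ge_inf//; exists x.
Qed.

Lemma regret_le J s c :
  (forall x, X x -> smean J s (h x0) - smean J s (h x) <= c) -> regret J s <= c.
Proof.
move=> xc; rewrite /regret saa_valueE lerBlDr -lerBlDl; apply: lb_le_inf.
  by exists (smean J s (h x0)), x0 => //; exact: min_in opt.
by move=> _ [x Xx <-]; rewrite lerBlDl -lerBlDr xc.
Qed.

Lemma regret_ge0 J s : 0 <= regret J s.
Proof. by rewrite (le_trans _ (regret_ge _ _ (min_in opt)))// subrr. Qed.

Lemma regret_bound J s : regret J s <= D * smean J s M.
Proof.
apply: regret_le => x Xx; rewrite (le_trans (ler_norm _))// distrC.
rewrite (le_trans (smean_lip _ _ Xx (min_in opt)))//.
by rewrite ler_wpM2r ?smean_ge0// (min_radius opt).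
Qed.

Let net_le (N : seq 'rV[R]_d) L J s c :
  (forall x, X x -> exists2 y, y \in N & `|x - y| <= (4 ^+ L)^-1) ->
  (forall y, y \in N -> X y) ->
  (forall y, y \in N -> smean J s (h x0) - smean J s (h y) <= c) ->
  regret J s <= c + (4 ^+ L)^-1 * smean J s M.
Proof.
move=> Nx NX Nc; apply: regret_le => x Xx; have [y yN xy] := Nx x Xx.
have := smean_lip J s Xx (NX y yN); rewrite ler_norml => /andP[+ _].
have : `|x - y| * smean J s M <= (4 ^+ L)^-1 * smean J s M.
  by rewrite ler_wpM2r ?smean_ge0.
by have := Nc y yN; lra.
Qed.

(** The infimum over [X] is uncountable, but the regret is the pointwise limit of maxima over the
    finite nets, with error at most [4^-L] times the sample mean of [M]. Starting these maxima at 0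
    is harmless as the regret is nonnegative. *)
Lemma measurable_regret J : measurable_fun setT (regret J : seq_space Xi -> R).
Proof.
have /choice[net netP] := reg_nets reg.
pose tau L (s : seq_space Xi) :=
  \big[Num.max/0]_(y <- net L) (smean J s (h x0) - smean J s (h y)).
have mh x : X x -> measurable_fun setT (fun s : seq_space Xi => smean J s (h x)).
  by move=> Xx; apply: measurable_smean; have [] := reg_h_L2 reg Xx.
apply: (@measurable_fun_cvg _ _ _ _ tau) => [L|s _].
  have [NX _ _] := netP L; rewrite /tau.
  elim: (net L) NX => [|y N ih] NX.
    rewrite (_ : (fun _ => _) = fun=> 0)//.
    by apply/funext => s; rewrite big_nil.
  rewrite (_ : (fun _ => _) = fun s : seq_space Xi =>
    Num.max (smean J s (h x0) - smean J s (h y))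
      (\big[Num.max/0]_(y <- N) (smean J s (h x0) - smean J s (h y)))); last first.
    by apply/funext => s; rewrite big_cons.
  apply: measurable_maxr; last by apply: ih => z zN; apply: NX; rewrite inE zN orbT.
  apply: measurable_funB; apply: mh; first exact: min_in opt.
  by apply: NX; rewrite mem_head.
apply/cvgrPdist_le => e e0.
have [L0 L0P] := pow4V_small (smean J s M) e0.
near=> L.
have LL : (L0 <= L)%N by near: L; exists L0.
have [NX _ Nx] := netP L.
have up : regret J s <= tau L s + (4 ^+ L)^-1 * smean J s M.
  apply: (net_le Nx NX) => y yN.
  exact: (@le_bigmax_mem _ _ (net L) (fun y => smean J s (h x0) - smean J s (h y))).
have lo : tau L s <= regret J s.
  apply: bigmax_le_mem; first exact: regret_ge0.
  by move=> y yN; apply: regret_ge; exact: NX.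
by rewrite ger0_norm ?subr_ge0//; have := L0P L LL; lra.
Unshelve. all: by end_near. Qed.

Lemma L2_regret J s : L2 P (fun w => regret J (sample xi s w)).
Proof.
apply: (@L2_le _ _ _ _ _ (fun w => D * smean J (sample xi s w) M)).
- apply: measurableT_comp; first exact: measurable_regret.
  exact: (measurable_sample Hiid).
- by move=> w; rewrite ger0_norm ?regret_ge0// regret_bound.
- by apply: L2Z; exact: (L2_smean Hiid _ _ (reg_M_L2 reg)).
Qed.

Definition mean_regret k := Ex P (fun w => regret (iota 0 k) (sample xi id w)).

Lemma mean_regret_ge0 k : 0 <= mean_regret k.
Proof. by apply: Ex_ge0 => w; exact: regret_ge0. Qed.

(** Only [C] depends on [J] beyond the factor [2^-J]. A point near an optimal [z] gains over [x0] at
    most the modulus, up to an a.s. null term. A point with excess [eta] is compared with a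
    neighbour [c] in the coarse net, and the gap turns a first-order fluctuation into a second-order
    one. *)
Lemma mean_regret_le J : exists2 C, 0 <= C & forall k, (0 < k)%N ->
  Num.sqrt k%:R * mean_regret k <=
  4 * modulus_const F M K B / 2 ^+ J + C / Num.sqrt k%:R.
Proof.
have /choice[net netP] := reg_nets reg.
have [NX _ Nx] := netP J.
have rho0 : 0 < (4 ^+ J)^-1 :> R by rewrite invr_gt0 exprn_gt0.
have [zs [eta [eta0 zsP nearP]]] := near_or_suboptimal rho0.
have X0 := min_in opt.
pose v c z := centered F h x0 z - centered F h c z.
have v2 c : X c -> L2 F (v c).
  by move=> Xc; apply: L2B; exact: (L2_centered reg).
pose C := \sum_(c <- net J) Ex F (fun z => v c z ^+ 2) / (4 * eta).
exists C.
  rewrite sumr_ge0// => c _; rewrite divr_ge0 ?mulr_ge0 ?(ltW eta0)// Ex_ge0// => z.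
  exact: sqr_ge0.
move=> k k0; set q := Num.sqrt k%:R.
have q0 : 0 < q by rewrite sqrtr_gt0 ltr0n.
have q2 : k%:R = q ^+ 2 by rewrite sqr_sqrtr.
pose I := iota 0 k.
have I0 : (0 < size I)%N by rewrite size_iota.
have cE s x : smean I s (centered F h x) = smean I s (h x) - Z x.
  by rewrite smeanB smean_cst.
(* The supremum over [X] is replaced by a maximum over the [L]-th net. The pairs [Q] depend on [L],
   but the bound on their modulus does not, so [L] can go to infinity. *)
suff main L : mean_regret k <= 4 * modulus_const F M K B / 2 ^+ J / q + C / q ^+ 2 +
    (4 ^+ L)^-1 * Ex F M.
  have : mean_regret k <= 4 * modulus_const F M K B / 2 ^+ J / q + C / q ^+ 2.
    apply/ler_addgt0Pr => e e0; have [L LP] := pow4V_small (Ex F M) e0.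
    by apply: le_trans (main L) _; rewrite lerD2l; exact: LP.
  move=> /(ler_wpM2l (ltW q0))/le_trans; apply.
  by rewrite le_eqVlt; apply/orP; left; apply/eqP; field; rewrite ?expf_neq0 ?gt_eqF.
have [LX _ Lx] := netP L.
pose Q := [seq p <- [seq (x, y) | x <- zs ++ net J, y <- net L]
                | `|p.1 - p.2| <= (4 ^+ J)^-1].
have XQ p : p \in Q -> [/\ X p.1, X p.2 & `|p.1 - p.2| <= (4 ^+ J)^-1].
  rewrite mem_filter => /andP[pJ /allpairsP[[x y] /= [xn yn pE]]].
  rewrite pE /= in pJ *; split => //; last exact: LX.
  by move: xn; rewrite mem_cat => /orP[/zsP[]//|]; exact: NX.
have inQ x y s : x \in zs ++ net J -> y \in net L -> `|x - y| <= (4 ^+ J)^-1 ->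
    smean I s (centered F h x) - smean I s (centered F h y) <= modulus F h k Q s.
  move=> xn yn xy; rewrite (le_trans (ler_norm _))//.
  apply: (@le_bigmax_mem _ _ Q (fun p => `|smean I s (centered F h p.1) -
    smean I s (centered F h p.2)|) (x, y)).
  by rewrite mem_filter /= xy; apply: allpairs_f.
pose T1 s := \sum_(z <- zs) `|smean I s (fun u => h x0 u - h z u)|.
pose T2 s := \sum_(c <- net J) (4 * eta)^-1 * smean I s (v c) ^+ 2.
have T10 s : 0 <= T1 s by rewrite sumr_ge0.
have T2t s c : 0 <= (4 * eta)^-1 * smean I s (v c) ^+ 2.
  by rewrite mulr_ge0 ?sqr_ge0// invr_ge0 mulr_ge0// ltW.
have T20 s : 0 <= T2 s by rewrite sumr_ge0.
have ub s : regret I s <= modulus F h k Q s + T1 s + T2 s + (4 ^+ L)^-1 * smean I s M.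
  apply: (net_le Lx LX) => y yn; have Xy := LX y yn.
  have [[z zn yz]|far] := nearP y Xy.
    have [Xz Zz] := zsP z zn.
    have t1 : smean I s (h x0) - smean I s (h z) <= T1 s.
      rewrite -smeanB /T1 (big_rem z)//= (le_trans (ler_norm _))// lerDl.
      exact: sumr_ge0.
    have := inQ z y s; rewrite mem_cat zn /= distrC => /(_ isT yn yz).
    rewrite !cE Zz; have := min_le opt Xy; rewrite -!/(Z _); have := T20 s.
    by move: t1; lra.
  have [c cn yc] := Nx y Xy.
  (* From [a - eta <= a^2 / (4 eta)], a completed square; the mean of [a^2] is of order [1 / k]. *)
  have t2 : smean I s (v c) - eta <= T2 s.
    rewrite /T2 (big_rem c)//=; apply: ler_wpDr; first exact: sumr_ge0.
    set a := smean I s (v c).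
    rewrite -subr_ge0 (_ : _ - _ = (4 * eta)^-1 * (a - 2 * eta) ^+ 2).
      by rewrite mulr_ge0 ?sqr_ge0// invr_ge0 mulr_ge0// ltW.
    by field; rewrite gt_eqF.
  have := inQ c y s; rewrite mem_cat cn orbT distrC => /(_ isT yn yc).
  move: t2; rewrite /v smeanB !cE; have := T10 s; lra.
have mL : L1 P (fun w => modulus F h k Q (sample xi id w)).
  exact: (L1_modulus Hiid reg XQ).
have tL1 z : z \in zs -> L1 P (fun w => `|smean I (sample xi id w) (fun u => h x0 u - h z u)|).
  move=> /zsP[Xz _]; apply/L1_norm/(L1_smean Hiid)/L1B; exact: L1h.
have T1L : L1 P (fun w => T1 (sample xi id w)).
  by rewrite /T1; under eq_fun do rewrite big_seq; apply: L1_sum => z zn; exact: tL1.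
have tL2 c : c \in net J -> L1 P (fun w => smean I (sample xi id w) (v c) ^+ 2).
  by move=> cn; apply/L2_sqr/(L2_smean Hiid)/v2; exact: NX.
have T2L : L1 P (fun w => T2 (sample xi id w)).
  by rewrite /T2; under eq_fun do rewrite big_seq; apply: L1_sum => c cn; apply: L1Z; exact: tL2.
have ML : L1 P (fun w => smean I (sample xi id w) M) by exact: (L1_smean Hiid).
apply: le_trans (Ex_le (L2_L1 (L2_regret I id))
   (L1D (L1D (L1D mL T1L) T2L) (L1Z _ ML)) (fun w => ub _)) _.
rewrite (ExD (L1D (L1D mL T1L) T2L) (L1Z _ ML)) (ExD (L1D mL T1L) T2L).
rewrite (ExD mL T1L) (ExZ _ ML) (Ex_smean Hiid)// lerD2r.
(* Essential uniqueness enters here: the points of [zs] are optimal, so their costs equal that of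
   [x0] almost surely. *)
have -> : Ex P (fun w => T1 (sample xi id w)) = 0.
  rewrite /T1; under eq_Ex do rewrite big_seq.
  rewrite Ex_sum//; apply: big1 => z zn; have [Xz Zz] := zsP z zn.
  apply/eqP; rewrite eq_le Ex_ge0 ?andbT// -[leRHS](_ : Ex F (fun u => `|h x0 u - h z u|) = 0).
    rewrite -(Ex_smean Hiid (J := I) id)//; last by apply/L1_norm/L1B; exact: L1h.
    apply: Ex_le; [exact: tL1| |by move=> w; exact: ler_norm_smean].
    by apply: (L1_smean Hiid); apply/L1_norm/L1B; exact: L1h.
  apply: ae0_Ex; first by apply: (L1_meas (P := F)); apply/L1_norm/L1B; exact: L1h.
  by apply: filterS (min_unique opt Xz Zz) => u ->; rewrite subrr normr0.
have -> : Ex P (fun w => T2 (sample xi id w)) = C / q ^+ 2.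
  rewrite /T2; under eq_Ex do rewrite big_seq.
  rewrite Ex_sum; last by move=> c /tL2 ?; exact: L1Z.
  rewrite -big_seq /C mulr_suml big_seq [RHS]big_seq; apply: eq_bigr => c cn.
  rewrite (ExZ _ (tL2 c cn)) (Ex_sqr_smean Hiid (iota_uniq _ _) I0)//.
  - by rewrite size_iota -q2; ring.
  - by apply: v2; exact: NX.
  - rewrite ExB ?(Ex_centered reg) ?subrr//; first exact: NX.
    + exact: L2_L1 (L2_centered reg X0).
    + exact: L2_L1 (L2_centered reg (NX _ cn)).
rewrite addr0 lerD2r ler_pdivlMr// mulrC.
exact: (mean_modulus_le Hiid reg XQ).
Qed.

Lemma mean_regret_cvg0 : Num.sqrt k%:R * mean_regret k @[k --> \oo] --> (0 : R).
Proof.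
apply/cvgrPdist_le => e e0.
set A := 4 * modulus_const F M K B.
have A0 : 0 <= A by rewrite mulr_ge0// modulus_const_ge0.
(* Smallness is available for powers of 4, so [A / 2^J0 <= e / 2] is obtained in squared form. *)
have [J0 J0P] := pow4V_small (A ^+ 2) (divr_gt0 (exprn_gt0 2 e0) (ltr0Sn _ 3)).
have J1 : A / 2 ^+ J0 <= e / 2.
  rewrite -(@ler_pXn2r _ 2) ?nnegrE ?divr_ge0 ?exprn_ge0 ?(ltW e0)//.
  have -> : (A / 2 ^+ J0) ^+ 2 = (4 ^+ J0)^-1 * A ^+ 2.
    have -> : (4 : R) ^+ J0 = 2 ^+ J0 * 2 ^+ J0 by rewrite -exprMn -natrM.
    by field; rewrite expf_neq0.
  by apply: le_trans (J0P J0 (leqnn _)) _; rewrite exprMn; lra.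
have [C C0 CP] := mean_regret_le J0.
near=> k.
have k0 : (0 < k)%N by near: k; exists 1%N.
have q0 : 0 < Num.sqrt k%:R :> R by rewrite sqrtr_gt0 ltr0n.
rewrite sub0r normrN ger0_norm ?mulr_ge0 ?mean_regret_ge0 ?(ltW q0)//.
apply: le_trans (CP k k0) _; rewrite -/A [e]splitr lerD//.
rewrite ler_pdivrMr// -ler_pdivrMl ?divr_gt0//.
rewrite -(@ler_pXn2r _ 2) ?nnegrE ?mulr_ge0 ?invr_ge0 ?divr_ge0 ?(ltW e0) ?(ltW q0)//.
rewrite sqr_sqrtr//.
near: k; exact: nbhs_infty_ger.
Unshelve. all: by end_near. Qed.

End optimum.

(** * Stability of the regret *)

(** Dominated convergence along integer levels. The excess over [l], unlike [f] cut off at [l],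
    gives the pointwise splitting [f <= l + max (f - l) 0]. *)
Lemma tail_expectation_small {d : measure_display} {T : measurableType d}
    {R : realType} (P : probability T R) (f : T -> R) (e : R) :
  L1 P f -> (forall x, 0 <= f x) -> 0 < e ->
  exists2 l, 0 <= l & Ex P (fun x => Num.max (f x - l) 0) <= e.
Proof.
move=> fi f0 e0.
pose g (n : nat) x := Num.max (f x - n%:R) 0.
have mf := L1_meas fi.
have mg n : measurable_fun setT (g n).
  by apply: measurable_maxr => //; exact: measurable_funB.
have g0 n x : 0 <= g n x by rewrite le_max lexx orbT.
have gf n x : g n x <= f x by rewrite ge_max f0 andbT gerBl.
have gL n : L1 P (g n).
  by apply: L1_le fi => // x; rewrite ger0_norm.
have cv : (fun n => \int[P]_x (g n x)%:E)%E @ \oo --> (\int[P]_x (cst 0 x))%E.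
  apply: (@dominated_cvg _ _ _ P setT measurableT (fun n x => (g n x)%:E) (cst 0%E)
    (EFin \o f)) => //.
  - by move=> n; exact/measurable_EFinP.
  - move=> x _; apply: cvg_near_cst; near=> n.
    rewrite /g max_r// subr_le0.
    by near: n; exact: nbhs_infty_ger.
  - by move=> n x _ /=; rewrite lee_fin ger0_norm.
rewrite integral0 in cv.
have /fine_cvgP[_ /cvgrPdist_le/(_ e e0)] := cv.
move=> [N _ /(_ N (leqnn N))] /=; rewrite sub0r normrN -/(Ex P (g N)).
by rewrite ger0_norm ?Ex_ge0//; exists N%:R.
Unshelve. all: by end_near. Qed.

Lemma sqr_sum_le {R : realType} (I : Type) (r : seq I) (Q : pred I) (a : I -> R) :
  (\sum_(i <- r | Q i) a i) ^+ 2 <=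
  (count Q r)%:R * \sum_(i <- r | Q i) a i ^+ 2.
Proof.
have cross x s : 2 * x * (\sum_(i <- s | Q i) a i) <=
    (count Q s)%:R * x ^+ 2 + \sum_(i <- s | Q i) a i ^+ 2.
  elim: s => [|j s ih]; first by rewrite !big_nil mulr0 mul0r addr0.
  rewrite !big_cons /=; case Qj : (Q j); last by rewrite add0n.
  rewrite -[nat_of_bool true]/1%N natrD mulrDl mul1r mulrDr; have := sqr_ge0 (x - a j).
  move: ih; set u := \sum_(_ <- _ | _) _; set v := \sum_(_ <- _ | _) _.
  set c := (count _ _)%:R; lra.
elim: r => [|i r ih]; first by rewrite !big_nil mulr0 expr0n.
rewrite !big_cons /=; case Qi : (Q i); last by rewrite add0n.
rewrite -[nat_of_bool true]/1%N natrD mulrDl mul1r mulrDr; have := cross (a i) r; move: ih.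
set u := \sum_(_ <- _ | _) _; set v := \sum_(_ <- _ | _) _.
set c := (count _ _)%:R; lra.
Qed.

Section stability.
Context {dO dX : measure_display} {R : realType} {d : nat}.
Context {Omega : measurableType dO} {Xi : measurableType dX}.
Variables (P : probability Omega R) (F : probability Xi R).
Variable xi : nat -> Omega -> Xi.
Hypothesis Hiid : iid_from P F xi.
Variables (X : set 'rV[R]_d) (h : 'rV[R]_d -> Xi -> R) (M : Xi -> R) (K B : nat).
Hypothesis reg : regular_problem F X h M K B.
Variables (x0 : 'rV[R]_d) (D : R).
Hypothesis opt : unique_minimizer F X h x0 D.
Hypothesis cptX : compact X.

Let Z x := Ex F (h x).
Let X0 : X x0 := min_in opt.
Let L1h x : X x -> L1 F (h x).
Proof. by move=> /(reg_h_L2 reg)/L2_L1. Qed.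
Let M2 : L2 F M := reg_M_L2 reg.
Let L1M : L1 F M := L2_L1 M2.
Let M_ge0 z : 0 <= M z.
Proof. by rewrite (le_trans _ (reg_M_ge1 reg z)). Qed.
Let EM_ge0 : 0 <= Ex F M.
Proof. exact: Ex_ge0. Qed.
Let D_ge0 : 0 <= D.
Proof. exact: le_trans (normr_ge0 _) (min_radius opt (min_in opt)). Qed.

Section one_replacement.
Variables (zs : seq 'rV[R]_d) (rho eta : R) (L : nat) (net : seq 'rV[R]_d).
Hypotheses (rho_gt0 : 0 < rho) (eta_gt0 : 0 < eta).
Hypothesis zsP : forall z, z \in zs -> X z /\ Z z = Z x0.
Hypothesis nearP : forall x, X x ->
  (exists2 z, z \in zs & `|x - z| <= rho) \/ Z x0 + eta <= Z x.
Hypothesis netX : forall y, y \in net -> X y.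
Hypothesis netP : forall x, X x -> exists2 y, y \in net & `|x - y| <= (4 ^+ L)^-1.

Let v c z := centered F h x0 z - centered F h c z.
Let v2 c : X c -> L2 F (v c).
Proof. by move=> Xc; apply: L2B; exact: (L2_centered reg). Qed.
Let Ev c : X c -> Ex F (v c) = 0.
Proof.
move=> Xc; rewrite ExB ?(Ex_centered reg) ?subrr//.
- exact: L2_L1 (L2_centered reg X0).
- exact: L2_L1 (L2_centered reg Xc).
Qed.

(** Almost surely zero under [F], by essential uniqueness; it is carried along because the bounds
    below hold for every sequence. *)
Let null z := \sum_(y <- zs) `|h x0 z - h y z|.
(** Scaled so that it is at least 1 as soon as a point with excess [eta] beats [x0] on the sample.
    Its mean bounds the probability of this event, and its truncation [th] replaces the
    indicator. *)
Let dev J s := (\sum_(c <- net) `|smean J s (v c)| +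
  (4 ^+ L)^-1 * (smean J s M + Ex F M)) / eta.
Let th J s := Num.min 1 (dev J s).

Let null_ge0 z : 0 <= null z.
Proof. exact: sumr_ge0. Qed.

Let dev_ge0 J s : 0 <= dev J s.
Proof.
rewrite divr_ge0 ?(ltW eta_gt0)// addr_ge0 ?sumr_ge0//.
by rewrite mulr_ge0 ?invr_ge0 ?exprn_ge0// addr_ge0// smean_ge0.
Qed.

Let th_ge0 J s : 0 <= th J s.
Proof. by rewrite le_min ler01 dev_ge0. Qed.

(** Take a competitor [x] for the sample [s]; changing observation [i] alters its gain through
    [w (s i)] and [w (s' i)] only. Near an optimal point these are small. Far from one, either [x]
    does not beat [x0] on [s] and nothing is to be shown, or [dev] is at least 1 and the crude bound
    [D * M] is affordable. *)
Let half_bound J (s s' : nat -> Xi) i : uniq J -> i \in J ->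
  (forall j, j \in J -> j != i -> s j = s' j) ->
  (size J)%:R * (regret X h x0 J s - regret X h x0 J s') <=
  (rho + D * th J s) * (M (s i) + M (s' i)) + (null (s i) + null (s' i)).
Proof.
move=> uJ iJ ss'.
have J0 : (0 < size J)%N by case: (J) iJ.
have k0 : 0 < (size J)%:R :> R by rewrite ltr0n.
set beta := leRHS.
have beta0 : 0 <= beta.
  by rewrite addr_ge0// ?addr_ge0// mulr_ge0 ?addr_ge0 ?(ltW rho_gt0)// mulr_ge0.
rewrite -ler_pdivlMl// lerBlDr mulrC; apply: (regret_le opt) => x Xx.
pose w z := h x0 z - h x z.
have change : smean J s w = smean J s' w + (w (s i) - w (s' i)) / (size J)%:R.
  rewrite /smean !(big_rem i iJ) /= (eq_big_seq (fun j => w (s' j))).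
    by ring.
  move=> j; rewrite mem_rem_uniq// inE => /andP[ji jJ]; rewrite ss'//.
have wle : smean J s' w <= regret X h x0 J s'.
  by rewrite smeanB (regret_ge reg opt).
have fromw : `|w (s i)| + `|w (s' i)| <= beta ->
    smean J s (h x0) - smean J s (h x) <= beta / (size J)%:R + regret X h x0 J s'.
  move=> wb; rewrite -smeanB -/w change addrC lerD// ler_pM2r ?invr_gt0//.
  have := ler_norm (w (s i)); have := ler_norm (- w (s' i)); rewrite normrN; lra.
case: (nearP Xx) => [[z zn xz]|far].
  apply: fromw; have [Xz _] := zsP zn.
  have wz u : `|w u| <= rho * M u + null u.
    have -> : w u = (h z u - h x u) + (h x0 u - h z u) by rewrite /w; ring.
    rewrite (le_trans (ler_normD _ _))// lerD//.
      rewrite (le_trans (reg_lip reg _ Xz Xx))// mulrC ler_wpM2r//.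
      by rewrite distrC.
    by rewrite /null (big_rem z)//= lerDl sumr_ge0.
  have := wz (s i); have := wz (s' i).
  have : 0 <= D * th J s * (M (s i) + M (s' i)) by rewrite !mulr_ge0// addr_ge0.
  rewrite /beta; lra.
have [w0|w0] := lerP (smean J s w) 0.
  rewrite -smeanB -/w (le_trans w0)// addr_ge0 ?(regret_ge0 reg opt)//.
  by rewrite divr_ge0// ltW.
have dev1 : 1 <= dev J s.
  rewrite ler_pdivlMr// mul1r.
  have cE y : smean J s (centered F h y) = smean J s (h y) - Z y.
    by rewrite smeanB smean_cst.
  have [c cn xc] := netP Xx; have Xc := netX cn.
  have t1 : smean J s (v c) <= \sum_(c <- net) `|smean J s (v c)|.
    by rewrite (big_rem c)//= (le_trans (ler_norm _))// lerDl sumr_ge0.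
  have p4 : 0 <= (4 ^+ L)^-1 :> R by rewrite invr_ge0 exprn_ge0.
  have t2 : smean J s (h c) - smean J s (h x) <= (4 ^+ L)^-1 * smean J s M.
    rewrite -smeanB (le_trans (ler_norm _))// (le_trans (ler_norm_smean _ _ _))//.
    rewrite -smeanZ smean_le// => u; rewrite (le_trans (reg_lip reg u Xc Xx))//.
    by rewrite mulrC ler_wpM2r// distrC.
  have t3 : Z x - Z c <= (4 ^+ L)^-1 * Ex F M.
    rewrite (le_trans (ler_norm _))// (le_trans (risk_lip reg Xx Xc))//.
    by rewrite mulrC ler_wpM2r.
  have vE : smean J s (v c) = smean J s (h x0) - Z x0 - (smean J s (h c) - Z c).
    by rewrite -!cE -smeanB.
  have wE : smean J s w = smean J s (h x0) - smean J s (h x) by rewrite -smeanB.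
  move: w0 t1; rewrite vE wE mulrDr; move: t2 t3 far.
  set S := \sum_(_ <- _) _; lra.
apply: fromw.
have th1 : th J s = 1 by rewrite /th min_l.
have wz u : `|w u| <= D * M u.
  rewrite /w distrC (le_trans (reg_lip reg u Xx X0))// mulrC ler_wpM2r//.
  exact: (min_radius opt).
have := wz (s i); have := wz (s' i); rewrite /beta th1.
have := null_ge0 (s i); have := null_ge0 (s' i).
have := mulr_ge0 (ltW rho_gt0) (M_ge0 (s i)); have := mulr_ge0 (ltW rho_gt0) (M_ge0 (s' i)).
lra.
Qed.

Variable l : R.
Hypothesis l_ge0 : 0 <= l.
Let ex z := Num.max (M z ^+ 2 - l) 0.

(** Squaring yields [th * M^2], two factors that share an observation, so the mean does not
    factorise. Since [th <= 1] and [th <= dev], the splitting [M^2 <= l + ex] bounds it by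
    [l * dev + ex]. The constants come from [(a + b)^2 <= 2 a^2 + 2 b^2] and its three-term
    analogue. *)
Let sq_bound J (s s' : nat -> Xi) i : uniq J -> i \in J ->
  (forall j, j \in J -> j != i -> s j = s' j) ->
  ((size J)%:R * (regret X h x0 J s - regret X h x0 J s')) ^+ 2 <=
  12 * rho ^+ 2 * (M (s i) ^+ 2 + M (s' i) ^+ 2) +
  24 * D ^+ 2 * (l * (dev J s + dev J s') + (ex (s i) + ex (s' i))) +
  4 * (null (s i) ^+ 2 + null (s' i) ^+ 2).
Proof.
move=> uJ iJ ss'.
have h1 := half_bound uJ iJ ss'.
have h2 : (size J)%:R * (regret X h x0 J s' - regret X h x0 J s) <=
    (rho + D * th J s') * (M (s' i) + M (s i)) + (null (s' i) + null (s i)).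
  by apply: half_bound => // j jJ ji; rewrite ss'.
set r := regret X h x0 J s in h1 h2 *; set r' := regret X h x0 J s' in h1 h2 *.
set t := th J s in h1; set t' := th J s' in h2.
set m := M (s i) in h1 h2 *; set m' := M (s' i) in h1 h2 *.
set n := null (s i) in h1 h2 *; set n' := null (s' i) in h1 h2 *.
set e := ex (s i); set e' := ex (s' i).
have m0 : 0 <= m by exact: M_ge0. have m0' : 0 <= m' by exact: M_ge0.
have t0 : 0 <= t by exact: th_ge0. have t0' : 0 <= t' by exact: th_ge0.
have n0 : 0 <= n by exact: null_ge0. have n0' : 0 <= n' by exact: null_ge0.
pose a := (rho + D * t + D * t') * (m + m'); pose b := n + n'.
have absle : `|(size J)%:R * (r - r')| <= a + b.
  have p1 : 0 <= D * t * (m + m') by rewrite !mulr_ge0// addr_ge0.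
  have p2 : 0 <= D * t' * (m + m') by rewrite !mulr_ge0// addr_ge0.
  by rewrite ler_norml /a /b; apply/andP; split; lra.
apply: (@le_trans _ _ ((a + b) ^+ 2)).
  rewrite -(real_normK (num_real (_ * _))) lerXn2r ?nnegrE//.
  by rewrite (le_trans _ absle).
have ab : (a + b) ^+ 2 <= 2 * a ^+ 2 + 2 * b ^+ 2 by have := sqr_ge0 (a - b); lra.
have bb : b ^+ 2 <= 2 * (n ^+ 2 + n' ^+ 2) by rewrite /b; have := sqr_ge0 (n - n'); lra.
have D2 : 0 <= D ^+ 2 by exact: sqr_ge0.
have t1 : t <= 1 by rewrite /t /th ge_min lexx.
have t1' : t' <= 1 by rewrite /t' /th ge_min lexx.
have td : t <= dev J s by rewrite /t /th ge_min lexx orbT.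
have td' : t' <= dev J s' by rewrite /t' /th ge_min lexx orbT.
set S := m ^+ 2 + m' ^+ 2.
have S0 : 0 <= S by rewrite addr_ge0// sqr_ge0.
have mm : (m + m') ^+ 2 <= 2 * S by rewrite /S; have := sqr_ge0 (m - m'); lra.
have rt : (rho + D * t + D * t') ^+ 2 <= 3 * (rho ^+ 2 + D ^+ 2 * (t + t')).
  have q1 : (rho + D * t + D * t') ^+ 2 <=
      3 * (rho ^+ 2 + (D * t) ^+ 2 + (D * t') ^+ 2).
    have := sqr_ge0 (rho - D * t); have := sqr_ge0 (rho - D * t').
    by have := sqr_ge0 (D * t - D * t'); lra.
  apply: le_trans q1 _; rewrite !exprMn.
  have sq_le (x : R) : 0 <= x -> x <= 1 -> x ^+ 2 <= x by move=> ? ?; rewrite expr2 ler_piMl.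
  have := ler_wpM2l D2 (sq_le _ t0 t1); have := ler_wpM2l D2 (sq_le _ t0' t1'); lra.
have aa : a ^+ 2 <= 6 * (rho ^+ 2 * S + D ^+ 2 * ((t + t') * S)).
  rewrite /a exprMn (le_trans (ler_pM (sqr_ge0 _) (sqr_ge0 _) rt mm))//.
  by rewrite le_eqVlt; apply/orP; left; apply/eqP; ring.
have e0 : 0 <= e by rewrite le_max lexx orbT.
have e0' : 0 <= e' by rewrite le_max lexx orbT.
have me : m ^+ 2 <= l + e by have : m ^+ 2 - l <= e; [rewrite le_max lexx|lra].
have me' : m' ^+ 2 <= l + e' by have : m' ^+ 2 - l <= e'; [rewrite le_max lexx|lra].
have tS (x dx : R) : 0 <= x -> x <= 1 -> x <= dx -> x * S <= 2 * (l * dx) + (e + e').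
  move=> x0' x1 xd; apply: (@le_trans _ _ (x * (2 * l + (e + e')))).
    by rewrite ler_wpM2l// /S; lra.
  rewrite mulrDr lerD//; last by rewrite ler_piMl// addr_ge0.
  by rewrite mulrCA ler_wpM2l// mulrC ler_wpM2l.
have key : (t + t') * S <= 2 * (l * (dev J s + dev J s')) + 2 * (e + e').
  by rewrite mulrDl; have := tS _ _ t0 t1 td; have := tS _ _ t0' t1' td'; lra.
have := ler_wpM2l D2 key.
move: aa ab bb; rewrite -/S.
set DtS := D ^+ 2 * ((t + t') * S).
set A2 := a ^+ 2; set B2 := b ^+ 2; set N2 := n ^+ 2 + n' ^+ 2.
set W := l * _; set E := e + e'.
have -> : D ^+ 2 * (2 * W + 2 * E) = 2 * (D ^+ 2 * (W + E)) by ring.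
rewrite -[24 * D ^+ 2 * _]mulrA -[12 * rho ^+ 2 * _]mulrA; lra.
Qed.

Let null2 : L2 F null.
Proof.
rewrite /null; under eq_fun do rewrite big_seq.
apply: L2_sum => y /zsP[Xy _].
have y2 : L2 F (fun z => h x0 z - h y z) by apply: L2B; exact: (reg_h_L2 reg).
split; first by apply: measurableT_comp => //; case: y2.
by apply: eq_L1 (L2_sqr y2) => z; rewrite real_normK// num_real.
Qed.

Let Enull : Ex F (fun z => null z ^+ 2) = 0.
Proof.
apply: ae0_Ex; first by apply: measurable_funX; case: null2.
have : forall ys, {subset ys <= zs} ->
    {ae F, forall z, \sum_(y <- ys) `|h x0 z - h y z| = 0}.
  elim=> [|y ys ih] sub; first by apply: nearW => z; rewrite big_nil.
  have [Xy Zy] := zsP (sub y (mem_head _ _)).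
  apply: filterS2 (min_unique opt Xy Zy) (ih _) => [z hy S0|u uys].
    by rewrite big_cons S0 hy subrr normr0 addr0.
  by apply: sub; rewrite inE uys orbT.
by move=> /(_ zs (fun _ => id)); apply: filterS => z; rewrite /null => ->; rewrite expr0n.
Qed.

Let Ldev J s : L1 P (fun w => dev J (sample xi s w)).
Proof.
rewrite /dev; under eq_fun do rewrite mulrC.
apply: L1Z; apply: L1D.
  under eq_fun do rewrite big_seq.
  apply: L1_sum => c cn; apply/L1_norm/L2_L1/(L2_smean Hiid)/v2; exact: netX.
by apply: L1Z; apply: L1D; [exact: (L1_smean Hiid)|exact: L1_cst].
Qed.

Let Edev J s : uniq J -> (0 < size J)%N -> injective s ->
  Ex P (fun w => dev J (sample xi s w)) <=
  (\sum_(c <- net) (Ex F (fun z => v c z ^+ 2) + 1) / 2 / Num.sqrt (size J)%:R +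
   (4 ^+ L)^-1 * (2 * Ex F M)) / eta.
Proof.
move=> uJ J0 sinj.
have LM := L1_smean Hiid J s L1M.
have Lv c : c \in net -> L1 P (fun w => `|smean J (sample xi s w) (v c)|).
  by move=> cn; apply/L1_norm/L2_L1/(L2_smean Hiid)/v2; exact: netX.
have LS : L1 P (fun w => \sum_(c <- net) `|smean J (sample xi s w) (v c)|).
  by under eq_fun do rewrite big_seq; apply: L1_sum => c cn; exact: Lv.
rewrite /dev; under eq_Ex do rewrite mulrC.
have LT := L1Z (4 ^+ L)^-1 (L1D LM (L1_cst P (Ex F M))).
rewrite (ExZ _ (L1D LS LT)) mulrC ler_wpM2r ?invr_ge0 ?(ltW eta_gt0)//.
rewrite (ExD LS LT) (ExZ _ (L1D LM (L1_cst P _))) (ExD LM (L1_cst P _)) Ex_cst.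
rewrite (Ex_smean Hiid)// lerD//; last first.
  by rewrite ler_wpM2l ?invr_ge0 ?exprn_ge0//; lra.
under eq_Ex do rewrite big_seq.
rewrite Ex_sum; last by move=> c cn; exact: Lv.
rewrite -big_seq big_seq [leRHS]big_seq; apply: ler_sum => c cn.
apply: (Ex_abs_smean Hiid) => //; first by apply: v2; exact: netX.
by apply: Ev; exact: netX.
Qed.

Lemma Ex_regret_replace J s s' i : uniq J -> i \in J -> injective s -> injective s' ->
  (forall j, j \in J -> j != i -> s j = s' j) ->
  (size J)%:R ^+ 2 * Ex P (fun w =>
    (regret X h x0 J (sample xi s w) - regret X h x0 J (sample xi s' w)) ^+ 2) <=
  24 * rho ^+ 2 * Ex F (fun z => M z ^+ 2) +
  48 * D ^+ 2 * (l * ((\sum_(c <- net) (Ex F (fun z => v c z ^+ 2) + 1) / 2 /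
     Num.sqrt (size J)%:R + (4 ^+ L)^-1 * (2 * Ex F M)) / eta) + Ex F ex).
Proof.
move=> uJ iJ sinj sinj' ss'.
have J0 : (0 < size J)%N by case: (J) iJ.
have r2 : L2 P (fun w => regret X h x0 J (sample xi s w) - regret X h x0 J (sample xi s' w)).
  by apply: L2B; exact: (L2_regret Hiid reg opt).
have exL : L1 F ex.
  apply: (L1_le (g := fun z => M z ^+ 2)) (L2_sqr M2).
    apply: measurable_maxr => //; apply: measurable_funB => //.
    exact: L1_meas (L2_sqr M2).
  by move=> z; rewrite ger0_norm ?le_max ?lexx ?orbT// ge_max gerBl l_ge0 sqr_ge0.
have Mi t : L1 P (fun w => M (sample xi t w i) ^+ 2) := L1_coord Hiid (t i) (L2_sqr M2).
have Ni t : L1 P (fun w => null (sample xi t w i) ^+ 2) := L1_coord Hiid (t i) (L2_sqr null2).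
have Xi' t : L1 P (fun w => ex (sample xi t w i)) := L1_coord Hiid (t i) exL.
have EMi t : Ex P (fun w => M (sample xi t w i) ^+ 2) = Ex F (fun z => M z ^+ 2) :=
  Ex_coord Hiid (t i) (L2_sqr M2).
have ENi t : Ex P (fun w => null (sample xi t w i) ^+ 2) = 0.
  by rewrite -Enull; exact: (Ex_coord Hiid (t i) (L2_sqr null2)).
have EXi t : Ex P (fun w => ex (sample xi t w i)) = Ex F ex := Ex_coord Hiid (t i) exL.
rewrite -(ExZ _ (L2_sqr r2)).
have ub w : (size J)%:R ^+ 2 * (regret X h x0 J (sample xi s w) -
     regret X h x0 J (sample xi s' w)) ^+ 2 <=
    12 * rho ^+ 2 * (M (sample xi s w i) ^+ 2 + M (sample xi s' w i) ^+ 2) +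
    24 * D ^+ 2 * (l * (dev J (sample xi s w) + dev J (sample xi s' w)) +
      (ex (sample xi s w i) + ex (sample xi s' w i))) +
    4 * (null (sample xi s w i) ^+ 2 + null (sample xi s' w i) ^+ 2).
  rewrite -exprMn; apply: sq_bound => // j jJ ji.
  by rewrite /sample ss'.
have A1 := L1D (Mi s) (Mi s'). have A2 := L1D (Ldev J s) (Ldev J s').
have A3 := L1D (Xi' s) (Xi' s'). have A4 := L1D (Ni s) (Ni s').
have A5 := L1D (L1Z l A2) A3.
have A6 := L1D (L1Z (12 * rho ^+ 2) A1) (L1Z (24 * D ^+ 2) A5).
apply: le_trans (Ex_le (L1Z _ (L2_sqr r2)) (L1D A6 (L1Z 4 A4)) ub) _.
rewrite (ExD A6 (L1Z 4 A4)) (ExD (L1Z (12 * rho ^+ 2) A1) (L1Z (24 * D ^+ 2) A5)).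
rewrite (ExZ _ A1) (ExZ _ A5) (ExZ _ A4) (ExD (L1Z l A2) A3) (ExZ _ A2).
rewrite (ExD (Mi s) (Mi s')) (ExD (Ldev J s) (Ldev J s')) (ExD (Xi' s) (Xi' s')).
rewrite (ExD (Ni s) (Ni s')) !EMi !ENi !EXi.
have d1 := Edev uJ J0 sinj; have d2 := Edev uJ J0 sinj'.
set T := (_ / eta) in d1 d2 *.
have dd : l * (Ex P (fun w => dev J (sample xi s w)) + Ex P (fun w => dev J (sample xi s' w)))
    <= l * (2 * T) by rewrite ler_wpM2l//; lra.
have D2 : 0 <= 24 * D ^+ 2 by rewrite mulr_ge0// sqr_ge0.
have := ler_wpM2l D2 (lerD dd (lexx (Ex F ex + Ex F ex))).
have -> : 24 * D ^+ 2 * (l * (2 * T) + (Ex F ex + Ex F ex)) =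
  48 * D ^+ 2 * (l * T + Ex F ex) by ring.
rewrite addr0 mulr0 addr0; set U := 24 * D ^+ 2 * _; set V := 48 * D ^+ 2 * _.
set m := Ex F _; lra.
Qed.

End one_replacement.

(** The error has four parts of size [e / 4], and the parameters are fixed in the order forced by
    their dependence: [rho] and the truncation level [l], then [zs] and [eta], then the mesh [L] and
    its net, and last [k0], which makes the fluctuations on that net small. *)
Lemma regret_stability (e : R) : 0 < e -> exists k0 : nat, forall J s s' i,
  (k0 <= size J)%N -> uniq J -> i \in J -> injective s -> injective s' ->
  (forall j, j \in J -> j != i -> s j = s' j) ->
  (size J)%:R ^+ 2 * Ex P (fun w =>
    (regret X h x0 J (sample xi s w) - regret X h x0 J (sample xi s' w)) ^+ 2) <= e.
Proof.
move=> e0; set m := Ex F (fun z => M z ^+ 2).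
have m1 : 1 <= m.
  rewrite -(Ex_cst F 1); apply: Ex_le; [exact: L1_cst|exact: L2_sqr|move=> z].
  by rewrite exprn_ege1// (reg_M_ge1 reg).
have m0 : 0 < m by exact: lt_le_trans m1.
pose rho := Num.sqrt (e / (96 * m)).
have rho0 : 0 < rho by rewrite sqrtr_gt0 divr_gt0// mulr_gt0.
have rho2 : 24 * rho ^+ 2 * m = e / 4.
  rewrite sqr_sqrtr; last by rewrite divr_ge0 ?mulr_ge0 ?(ltW e0) ?(ltW m0).
  by field; rewrite gt_eqF.
(* The added 1 allows division also when [D = 0]. *)
pose D' := 48 * D ^+ 2 + 1.
have D'0 : 0 < D' by rewrite ltr_wpDl// mulr_ge0// sqr_ge0.
have DD : 48 * D ^+ 2 <= D' by rewrite lerDl.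
have e4 : 0 < e / 4 / D' by rewrite !divr_gt0.
have [l l0 lP] := tail_expectation_small (L2_sqr M2) (fun z => sqr_ge0 (M z)) e4.
have [zs [eta [eta0 zsP nearP]]] := near_or_suboptimal reg opt cptX rho0.
have [L LP] := pow4V_small (D' * (l * (2 * Ex F M / eta))) (divr_gt0 e0 (ltr0Sn R 3)).
have [net [netX _ netP]] := reg_nets reg L.
pose C := D' * (l / eta) * \sum_(c <- net)
  (Ex F (fun z => (centered F h x0 z - centered F h c z) ^+ 2) + 1) / 2.
have C0 : 0 <= C.
  apply: mulr_ge0; first by rewrite mulr_ge0 ?divr_ge0 ?(ltW D'0) ?(ltW eta0).
  apply: sumr_ge0 => c _.
  by rewrite divr_ge0// addr_ge0// Ex_ge0// => z; exact: sqr_ge0.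
exists (Num.truncn ((C / (e / 4)) ^+ 2)).+1 => J s s' i kJ uJ iJ sinj sinj' ss'.
apply: le_trans (Ex_regret_replace rho0 eta0 zsP nearP netX netP l0 uJ iJ sinj sinj' ss') _.
rewrite -/m rho2.
have J0 : (0 < size J)%N by case: (J) iJ.
set q := Num.sqrt (size J)%:R.
have q0 : 0 < q by rewrite sqrtr_gt0 ltr0n.
have Cq : C / q <= e / 4.
  rewrite ler_pdivrMr// -ler_pdivrMl ?divr_gt0// mulrC.
  rewrite -(@ler_pXn2r _ 2) ?nnegrE ?divr_ge0 ?(ltW e0) ?(ltW q0)// [q ^+ 2]sqr_sqrtr//.
  have /andP[_ /ltW/le_trans] := truncn_itv (sqr_ge0 (C / (e / 4))); apply.
  by rewrite ler_nat.
set T := (_ / eta); set E := Ex F _.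
have E0 : 0 <= E by apply: Ex_ge0 => z; rewrite le_max lexx orbT.
have T0 : 0 <= T.
  apply: divr_ge0; last exact: ltW.
  apply: addr_ge0; last by rewrite mulr_ge0 ?invr_ge0 ?exprn_ge0// mulr_ge0.
  apply: sumr_ge0 => c _; rewrite divr_ge0 ?(ltW q0)// divr_ge0// addr_ge0// Ex_ge0// => z.
  exact: sqr_ge0.
apply: (@le_trans _ _ (e / 4 + D' * (l * T + E))).
  by rewrite lerD2l ler_wpM2r// addr_ge0// mulr_ge0.
have -> : D' * (l * T + E) = C / q + (4 ^+ L)^-1 * (D' * (l * (2 * Ex F M / eta))) + D' * E.
  rewrite /T /C -mulr_suml; set S := \sum_(_ <- _) _.
  by field; rewrite ?expf_neq0 ?gt_eqF.
have := LP L (leqnn _); have := lP; rewrite -/E ler_pdivlMr// mulrC.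
move: Cq; set u := C / q; set v := (4 ^+ L)^-1 * _; set y := D' * E; lra.
Qed.

End stability.

(** * The U-statistic *)

Local Close Scope classical_set_scope.

Section subsets.
Variables n k : nat.

Definition indices (A : {set 'I_n}) : seq nat := [seq nat_of_ord i | i <- enum A].

Lemma size_indices A : size (indices A) = #|A|.
Proof. by rewrite size_map cardE. Qed.

Lemma uniq_indices A : uniq (indices A).
Proof. by rewrite map_inj_uniq ?enum_uniq//; exact: val_inj. Qed.

Lemma mem_indices A (i : 'I_n) : (nat_of_ord i \in indices A) = (i \in A).
Proof. by rewrite mem_map ?mem_enum//; exact: val_inj. Qed.

Lemma ltn_indices A j : j \in indices A -> (j < n)%N.
Proof. by move=> /mapP[i _ ->]. Qed.

(** Subsets avoiding [i] are the subsets of its complement; the rest is Pascal's rule. *)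
Lemma card_subsets_mem (i : 'I_n) : (0 < k)%N ->
  #|[set A : {set 'I_n} | (#|A| == k) && (i \in A)]| = 'C(n.-1, k.-1).
Proof.
move=> k0; have n0 : (0 < n)%N by exact: leq_ltn_trans (ltn_ord i).
have all := card_draws 'I_n k; rewrite card_ord in all.
have avoid := cards_draws [set~ i] k.
rewrite cardsC1 card_ord in avoid.
have split : (#|[set A : {set 'I_n} | #|A| == k]| =
    #|[set A : {set 'I_n} | (#|A| == k) && (i \in A)]| +
    #|[set A : {set 'I_n} | A \subset [set~ i] & #|A| == k]|)%N.
  rewrite -[LHS](cardsID [set A : {set 'I_n} | i \in A]); congr (_ + _)%N.
    by apply: eq_card => A; rewrite !inE.
  by apply: eq_card => A; rewrite !inE finset.subsetC finset.sub1set !inE.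
move: split; rewrite all avoid; move: #|_| => N.
case: (n) n0 => // n' _; case: (k) k0 => // k' _ /=.
by rewrite binS; lia.
Qed.

End subsets.

Local Open Scope classical_set_scope.

Section Ustat.
Context {dO dX : measure_display} {R : realType} {d : nat}.
Context {Omega : measurableType dO} {Xi : measurableType dX}.
Variables (P : probability Omega R) (F : probability Xi R).
Variable xi : nat -> Omega -> Xi.
Hypothesis Hiid : iid_from P F xi.
Variables (X : set 'rV[R]_d) (h : 'rV[R]_d -> Xi -> R) (M : Xi -> R) (K B : nat).
Hypothesis reg : regular_problem F X h M K B.
Variables (x0 : 'rV[R]_d) (D : R).
Hypothesis opt : unique_minimizer F X h x0 D.
Hypothesis cptX : compact X.

Definition Uregret n k (s : nat -> Xi) : R :=
  'C(n, k)%:R^-1 * \sum_(A : {set 'I_n} | #|A| == k) regret X h x0 (indices A) s.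

(** Averaged over all [k]-subsets, the subsample means of one fixed function give the full sample
    mean: each index lies in ['C(n.-1, k.-1)] subsets, and [n 'C(n.-1, k.-1) = k 'C(n, k)]. *)
Lemma saa_UstatE n k w : (0 < k <= n)%N ->
  saa_Ustat xi X h n k w =
  smean (iota 0 n) (sample xi id w) (h x0) - Uregret n k (sample xi id w).
Proof.
move=> /andP[k0 kn]; have n0 : (0 < n)%N by exact: leq_trans kn.
set s := sample xi id w.
have -> : smean (iota 0 n) s (h x0) = 'C(n, k)%:R^-1 *
    \sum_(A : {set 'I_n} | #|A| == k) smean (indices A) s (h x0).
  rewrite (eq_bigr (fun A : {set 'I_n} => k%:R^-1 *
      \sum_(i : 'I_n) (i \in A)%:R * h x0 (s i))); last first.
    move=> A /eqP Ak; rewrite /smean size_indices Ak big_map big_enum /= big_mkcond.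
    by congr (_ * _); apply: eq_bigr => i _; case: ifP; rewrite ?mul1r ?mul0r.
  rewrite -mulr_sumr exchange_big /=.
  rewrite (eq_bigr (fun i : 'I_n => 'C(n.-1, k.-1)%:R * h x0 (s i))); last first.
    move=> i _; rewrite -mulr_suml; congr (_ * _).
    rewrite -(card_subsets_mem i k0) -sum1_card natr_sum big_mkcond [RHS]big_mkcond.
    by apply: eq_bigr => A _; rewrite inE; case: (_ == k); case: (i \in A).
  rewrite -mulr_sumr /smean size_iota.
  rewrite -[in iota _ _](subn0 n) -/(index_iota 0 n) big_mkord !mulrA.
  congr (_ * _).
  have C0 : 'C(n, k)%:R != 0 :> R by rewrite pnatr_eq0 -lt0n bin_gt0.
  have kR : k%:R != 0 :> R by rewrite pnatr_eq0 -lt0n.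
  have nR : n%:R != 0 :> R by rewrite pnatr_eq0 -lt0n.
  have /(congr1 (fun x : nat => x%:R : R)) : (n * 'C(n.-1, k.-1) = k * 'C(n, k))%N.
    by case: (n) n0 => // n' _; case: (k) k0 => // k' _; rewrite mul_bin_diag.
  rewrite !natrM => E.
  have -> : 'C(n.-1, k.-1)%:R = k%:R * 'C(n, k)%:R / n%:R :> R.
    by rewrite -E; field.
  by field; rewrite C0 kR nR.
rewrite /saa_Ustat /Uregret -mulrBr -sumrB; congr (_ * _).
apply: eq_bigr => A _; rewrite /regret opprB addrC subrK.
by rewrite /indices -map_comp.
Qed.

Lemma measurable_Uregret n k :
  measurable_fun setT (Uregret n k : seq_space Xi -> R).
Proof.
apply: measurable_funM => //.
rewrite (_ : (fun _ => _) = fun s : seq_space Xi => \sum_(A : {set 'I_n})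
    if #|A| == k then regret X h x0 (indices A) s else 0); last first.
  by apply/funext => s; rewrite big_mkcond.
apply: measurable_sum => A; case: (#|A| == k) => //.
exact: (measurable_regret reg opt).
Qed.

Lemma Uregret_ge0 n k s : 0 <= Uregret n k s.
Proof.
rewrite mulr_ge0 ?invr_ge0// sumr_ge0// => A _.
exact: (regret_ge0 reg opt).
Qed.

Lemma L2_Uregret n k s : L2 P (fun w => Uregret n k (sample xi s w)).
Proof. by apply/L2Z/L2_sum => A _; exact: (L2_regret Hiid reg opt). Qed.

Lemma Ex_regret_indices n k (A : {set 'I_n}) : #|A| = k ->
  Ex P (fun w => regret X h x0 (indices A) (sample xi id w)) =
  mean_regret P xi X h x0 k.
Proof.
move=> Ak.
(* An enumeration of [A], prolonged injectively beyond [n], so that exchangeability carries the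
   first [k] observations to those in [A]. *)
pose s j := if (j < k)%N then nth 0%N (indices A) j else (n + j)%N.
have sA j : (j < k)%N -> (s j < n)%N.
  move=> jk; rewrite /s jk; apply: (@ltn_indices n A).
  by rewrite mem_nth// size_indices Ak.
have sinj : injective s.
  move=> i j; have := sA i; have := sA j; rewrite /s.
  case: (ltnP i k) => ik; case: (ltnP j k) => jk //= h1 h2.
  - move=> /eqP; rewrite nth_uniq ?size_indices ?Ak ?uniq_indices//.
    by move=> /eqP.
  - by have := h2 isT; lia.
  - by have := h1 isT; lia.
  - by lia.
have E : indices A = [seq s j | j <- iota 0 k].
  apply: (@eq_from_nth _ 0%N); first by rewrite size_indices size_map size_iota.
  move=> j; rewrite size_indices Ak => jk.
  by rewrite (nth_map 0%N) ?size_iota// nth_iota// add0n /s jk.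
rewrite /mean_regret.
have := Ex_sample Hiid (measurable_regret reg opt (iota 0 k)) (@inj_id nat) sinj
  (L2_L1 (L2_regret Hiid reg opt _ _)).
rewrite /comp => ->; apply: eq_Ex => w.
by rewrite /regret E /smean !size_map -map_comp big_map.
Qed.

Lemma Ex_Uregret n k : (k <= n)%N ->
  Ex P (fun w => Uregret n k (sample xi id w)) = mean_regret P xi X h x0 k.
Proof.
move=> kn; rewrite ExZ; last first.
  by apply: L1_sum => A _; exact: L2_L1 (L2_regret Hiid reg opt _ _).
rewrite Ex_sum; last by move=> A _; exact: L2_L1 (L2_regret Hiid reg opt _ _).
rewrite (eq_bigr (fun=> mean_regret P xi X h x0 k)); last first.
  by move=> A /eqP; exact: Ex_regret_indices.
rewrite sumr_const -[mean_regret P xi X h x0 k *+ _]mulr_natl.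
have -> : #|[pred A : {set 'I_n} | #|A| == k]| = 'C(n, k).
  by rewrite -[in RHS](card_ord n) -card_draws; apply: eq_card => A; rewrite !inE.
by rewrite mulKf// pnatr_eq0 -lt0n bin_gt0.
Qed.

Let regret_local J (s s' : nat -> Xi) : {in J, s =1 s'} ->
  regret X h x0 J s = regret X h x0 J s'.
Proof.
move=> ss'; rewrite /regret (_ : [seq s i | i <- J] = [seq s' i | i <- J]).
  by rewrite /smean (eq_big_seq (fun j => h x0 (s' j)))// => j jJ; rewrite ss'.
exact/eq_in_map.
Qed.

(** Observation [i] affects a fraction [k / n] of the subsets, and each regret by at most
    [sqrt e / k] in L2; so the average moves by at most [sqrt e / n], and Efron-Stein sums [n]
    squares into [e / (2 n)]. The threshold [k0] does not involve [n], which leaves the growth of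
    [k] arbitrary. *)
Lemma Uregret_variance (e : R) : 0 < e -> exists k0 : nat, forall n k,
  (k0 <= k)%N -> (0 < k <= n)%N ->
  n%:R * Ex P (fun w => (Uregret n k (sample xi id w) - mean_regret P xi X h x0 k) ^+ 2)
  <= e.
Proof.
move=> e0; have [k0 k0P] := regret_stability Hiid reg opt cptX e0.
exists k0 => n k k0k /andP[kpos kn].
have npos : (0 < n)%N by exact: leq_trans kn.
have nR : 0 < n%:R :> R by rewrite ltr0n.
have kR : 0 < k%:R :> R by rewrite ltr0n.
have f_local (x y : seq_space Xi) : (forall i, (i < n)%N -> x i = y i) ->
    Uregret n k x = Uregret n k y.
  move=> xy; congr (_ * _); apply: eq_bigr => A _; apply: regret_local => j jA.
  by apply: xy; exact: ltn_indices jA.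
have ES := Efron_Stein Hiid (measurable_Uregret n k) (Uregret_ge0 n k) f_local
  (L2_Uregret n k id).
rewrite (Ex_Uregret kn) in ES.
apply: le_trans (ler_wpM2l (ltW nR) ES) _.
suff one (i : 'I_n) : Ex P (fun w => (Uregret n k (sample xi id w) -
    Uregret n k (sample xi (replace_one n i) w)) ^+ 2) <= e / n%:R ^+ 2.
  apply: (@le_trans _ _ (n%:R * (2^-1 * \sum_(i < n) e / n%:R ^+ 2))).
    by rewrite !ler_wpM2l ?(ltW nR) ?invr_ge0// ler_sum.
  rewrite sumr_const card_ord -[e / _ *+ n]mulr_natl.
  have -> : n%:R * (2^-1 * (n%:R * (e / n%:R ^+ 2))) = e / 2.
    by field; rewrite gt_eqF.
  by lra.
have rinj : injective (replace_one n i).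
  by have := ltn_ord i => lin j l; rewrite /replace_one; split_ifs; lia.
pose c : R := 'C(n, k)%:R; pose N : R := 'C(n.-1, k.-1)%:R.
have c0 : 0 < c by rewrite ltr0n bin_gt0.
have Ncn : N = k%:R * c / n%:R.
  have /(congr1 (fun x : nat => x%:R : R)) : (n * 'C(n.-1, k.-1) = k * 'C(n, k))%N.
    by case: (n) npos => // n' _; case: (k) kpos => // k' _; rewrite mul_bin_diag.
  by rewrite !natrM -/c -/N => <-; rewrite mulrC mulKf// gt_eqF.
have N0 : 0 <= N by [].
pose Dl (A : {set 'I_n}) w := regret X h x0 (indices A) (sample xi id w) -
  regret X h x0 (indices A) (sample xi (replace_one n i) w).
have Dl2 A : L2 P (Dl A) by apply: L2B; exact: (L2_regret Hiid reg opt).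
pose Q (A : {set 'I_n}) := (#|A| == k) && (i \in A).
have diffE w : Uregret n k (sample xi id w) - Uregret n k (sample xi (replace_one n i) w) =
    c^-1 * \sum_(A : {set 'I_n} | Q A) Dl A w.
  rewrite /Uregret -mulrBr -sumrB (bigID (fun A : {set 'I_n} => i \in A)) /=.
  rewrite [X in _ + X]big1 ?addr0// => A /andP[_ iA].
  apply/eqP; rewrite subr_eq0; apply/eqP; apply: regret_local => j jA.
  rewrite /sample /replace_one (ltn_indices jA); case: eqP => // ji.
  by move: jA; rewrite ji mem_indices (negbTE iA).
have NE : (count Q (index_enum {set 'I_n}))%:R = N.
  congr (_%:R); rewrite -(card_subsets_mem i kpos) -sum1_card -sum1_count.
  by apply: eq_bigl => A; rewrite inE.
have term A : Q A -> Ex P (fun w => Dl A w ^+ 2) <= e / k%:R ^+ 2.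
  move=> /andP[/eqP Ak iA]; rewrite ler_pdivlMr ?exprn_gt0// mulrC.
  have := k0P (indices A) id (replace_one n i) i.
  rewrite size_indices Ak mem_indices uniq_indices; apply => //.
  move=> j jA ji; rewrite /replace_one (negbTE ji) (ltn_indices jA)//.
have SL : L1 P (fun w => \sum_(A : {set 'I_n} | Q A) Dl A w ^+ 2).
  by apply: L1_sum => A _; exact: L2_sqr.
(* The sum over the [N] affected subsets is squared by Cauchy-Schwarz at the price of a factor [N],
   matched by [N = k c / n]. *)
have ub w : (Uregret n k (sample xi id w) - Uregret n k (sample xi (replace_one n i) w)) ^+ 2
    <= c^-1 ^+ 2 * N * \sum_(A : {set 'I_n} | Q A) Dl A w ^+ 2.
  rewrite diffE exprMn -mulrA ler_wpM2l ?sqr_ge0// -NE.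
  exact: sqr_sum_le.
have UL : L2 P (fun w => Uregret n k (sample xi id w) -
    Uregret n k (sample xi (replace_one n i) w)) by apply: L2B; exact: L2_Uregret.
apply: le_trans (Ex_le (L2_sqr UL) (L1Z _ SL) ub) _.
rewrite (ExZ _ SL) Ex_sum; last by move=> A _; exact: L2_sqr.
apply: (@le_trans _ _ (c^-1 ^+ 2 * N * (N * (e / k%:R ^+ 2)))).
  apply: ler_wpM2l; first by rewrite mulr_ge0// sqr_ge0.
  apply: (@le_trans _ _ (\sum_(A : {set 'I_n} | Q A) e / k%:R ^+ 2)).
    exact: ler_sum.
  by rewrite big_const_seq iter_addr_0 -NE mulr_natl.
by rewrite Ncn le_eqVlt; apply/orP; left; apply/eqP; field; rewrite !gt_eqF.
Qed.

End Ustat.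

(** * Taylor expansion and logistic functions *)

Section taylor.
Context {R : realType}.
Implicit Types (f g : R -> R) (x y : R).

Lemma mean_value f f' x y : (forall t, is_derive t (1 : R) f (f' t)) ->
  exists2 c, `|c - x| <= `|y - x| & f y - f x = f' c * (y - x).
Proof.
move=> df.
have cf (a b : R) : {within `[a, b], continuous f}.
  apply: continuous_subspaceT => t; apply: differentiable_continuous.
  by apply/derivable1_diffP; case: (df t).
have [xy|yx] := leP x y.
  have [c cxy E] := MVT_segment xy (fun t _ => df t) (cf x y).
  exists c => //; move: cxy; rewrite in_itv /= => /andP[xc cy].
  by rewrite !ger0_norm ?subr_ge0// lerD2r.
have [c cxy E] := MVT_segment (ltW yx) (fun t _ => df t) (cf y x).
exists c => //.
  move: cxy; rewrite in_itv /= => /andP[yc cx].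
  by rewrite !ler0_norm ?subr_le0 ?(ltW yx)// lerN2 lerD2r.
by rewrite -opprB E -mulrN opprB.
Qed.

Lemma increment_le f f' x y C : (forall t, is_derive t (1 : R) f (f' t)) ->
  (forall t, `|t - x| <= `|y - x| -> `|f' t| <= C) ->
  `|f y - f x| <= C * `|y - x|.
Proof.
move=> df fC; have [c cxy ->] := mean_value x y df.
by rewrite normrM ler_wpM2r// fC.
Qed.

Variables (f f1 f2 f3 : R -> R).
Hypothesis df : forall t, is_derive t (1 : R) f (f1 t).
Hypothesis df1 : forall t, is_derive t (1 : R) f1 (f2 t).
Hypothesis df2 : forall t, is_derive t (1 : R) f2 (f3 t).

Let is_derive_shift g g' y t : (forall t, is_derive t (1 : R) g (g' t)) ->
  is_derive t (1 : R) (fun t => g (y + t)) (g' (y + t)).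
Proof.
move=> dg; have sh : is_derive t (1 : R) (fun t : R => y + t) 1.
  by apply: is_derive_eq; rewrite add0r mulr1.
have := @is_derive1_comp _ g (fun t => y + t) t (g' (y + t)) 1 (dg _) sh.
by rewrite mulr1.
Qed.

(** The mean value theorem is applied twice, which loses the factor 1/2 of Taylor's formula; only
    the order in [x] matters later. *)
Lemma taylor1 y x C : (forall t, `|t| <= `|x| -> `|f2 (y + t)| <= C) ->
  `|f (y + x) - f y - x * f1 y| <= C * x ^+ 2.
Proof.
move=> f2C.
have d1 t : `|t| <= `|x| -> `|f1 (y + t) - f1 y| <= C * `|t|.
  move=> tx; have := @increment_le (fun t => f1 (y + t)) (fun t => f2 (y + t)) 0 t C.
  rewrite addr0 subr0; apply; first by move=> u; exact: is_derive_shift.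
  by move=> u; rewrite subr0 => ut; apply: f2C; exact: le_trans tx.
have C0 : 0 <= C by have := f2C 0; rewrite normr0 => /(_ (normr_ge0 _)); exact: le_trans.
pose g t := f (y + t) - t * f1 y.
have dg t : is_derive t (1 : R) g (f1 (y + t) - f1 y).
  have h1 := @is_derive_shift f f1 y t df.
  by apply: is_derive_eq; rewrite /GRing.scale /= mulr1 mulr0 add0r.
have := @increment_le g _ 0 x (C * `|x|) dg.
rewrite /g subr0 addr0 mul0r subr0 => H.
have -> : f (y + x) - f y - x * f1 y = f (y + x) - x * f1 y - f y by ring.
have -> : C * x ^+ 2 = C * `|x| * `|x|.
  by rewrite -mulrA -expr2 real_normK// num_real.
apply: H => t; rewrite subr0 => tx; rewrite (le_trans (d1 t tx))//.
by rewrite ler_wpM2l.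
Qed.

End taylor.

Section taylor2.
Context {R : realType}.
Variables (f f1 f2 f3 : R -> R).
Hypothesis df : forall t, is_derive t (1 : R) f (f1 t).
Hypothesis df1 : forall t, is_derive t (1 : R) f1 (f2 t).
Hypothesis df2 : forall t, is_derive t (1 : R) f2 (f3 t).

Lemma taylor2 y x C : (forall t, `|t| <= `|x| -> `|f3 (y + t)| <= C) ->
  `|f (y + x) - f y - x * f1 y - x ^+ 2 / 2 * f2 y| <= C * `|x| ^+ 3.
Proof.
move=> f3C.
have C0 : 0 <= C by have := f3C 0; rewrite normr0 => /(_ (normr_ge0 _)); exact: le_trans.
pose g t := f (y + t) - t * f1 y - t ^+ 2 / 2 * f2 y.
have dg t : is_derive t (1 : R) g (f1 (y + t) - f1 y - t * f2 y).
  have sh : is_derive t (1 : R) (fun t : R => y + t) 1.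
    by apply: is_derive_eq; rewrite add0r mulr1.
  have h1 := @is_derive1_comp _ f (fun t => y + t) t (f1 (y + t)) 1 (df _) sh.
  rewrite mulr1 in h1; rewrite /g.
  by apply: is_derive_eq; rewrite /GRing.scale /=; field.
have := @increment_le _ g _ 0 x (C * x ^+ 2) dg.
rewrite /g subr0 addr0 mul0r subr0 expr0n mul0r mul0r subr0 => H.
have -> : f (y + x) - f y - x * f1 y - x ^+ 2 / 2 * f2 y =
  f (y + x) - x * f1 y - x ^+ 2 / 2 * f2 y - f y by ring.
have -> : C * `|x| ^+ 3 = C * x ^+ 2 * `|x|.
  by rewrite -mulrA [_ ^+ 3]exprSr real_normK// num_real.
apply: H => t; rewrite subr0 => tx.
apply: (@le_trans _ _ (C * t ^+ 2)).
  apply: (taylor1 df1 df2) => u ut; apply: f3C; exact: le_trans tx.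
rewrite ler_wpM2l// -(real_normK (num_real t)) -(real_normK (num_real x)).
by rewrite lerXn2r ?nnegrE.
Qed.

End taylor2.

(** * Logistic test functions *)

Section logistic.
Context {R : realType}.
Variables (l a : R).
Hypothesis l_ge1 : 1 <= l.

(** A smooth decreasing approximation of the indicator of the half-line up to [a], of steepness [l].
    Since [p' = - l (p - p^2)], all derivatives are polynomials in [p]; the first three are bounded
    by [l^3]. *)
Definition logistic (y : R) : R := (1 + expR (l * (y - a)))^-1.
Let p := logistic.
Definition logistic1 y := - l * (p y - p y ^+ 2).
Definition logistic2 y := l ^+ 2 * (p y - p y ^+ 2) * (1 - 2 * p y).
Definition logistic3 y := - l ^+ 3 * (p y - p y ^+ 2) * (1 - 6 * p y + 6 * p y ^+ 2).

Let den_gt0 y : 0 < 1 + expR (l * (y - a)).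
Proof. by rewrite addr_gt0 ?expR_gt0. Qed.

Lemma logistic_ge0 y : 0 <= logistic y.
Proof. by rewrite invr_ge0 ltW. Qed.

Lemma logistic_le1 y : logistic y <= 1.
Proof. by rewrite invf_le1// lerDl expR_ge0. Qed.

Lemma is_derive_logistic t : is_derive t (1 : R) logistic (logistic1 t).
Proof.
pose q (y : R) : R := 1 + expR (l * (y - a)).
have de : is_derive t (1 : R) q (l * expR (l * (t - a))).
  by apply: is_derive_eq; rewrite /GRing.scale /=; ring.
have n0 : q t != 0 by rewrite (gt_eqF (den_gt0 t)).
have := is_deriveV n0 de; rewrite (_ : (fun x => (q x)^-1) = logistic)//.
move=> H; apply: is_derive_eq H _; rewrite /GRing.scale /= /logistic1 /p /logistic /q.
by field; rewrite gt_eqF.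
Qed.

Lemma is_derive_logistic1 t : is_derive t (1 : R) logistic1 (logistic2 t).
Proof.
have dp := is_derive_logistic t.
rewrite /logistic1; apply: is_derive_eq.
by rewrite /logistic2 /logistic1 /GRing.scale /= /p; ring.
Qed.

Lemma is_derive_logistic2 t : is_derive t (1 : R) logistic2 (logistic3 t).
Proof.
have dp := is_derive_logistic t.
rewrite /logistic2; apply: is_derive_eq.
by rewrite /logistic3 /logistic1 /GRing.scale /= /p; ring.
Qed.

Let pq y : 0 <= p y - p y ^+ 2 <= 1.
Proof.
have := logistic_ge0 y; have := logistic_le1 y; rewrite -/p.
by move=> *; apply/andP; split; nra.
Qed.

Let l_ge0 : 0 <= l.
Proof. exact: le_trans l_ge1. Qed.

Let l_pow n : (n <= 3)%N -> l ^+ n <= l ^+ 3.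
Proof. by move=> n3; rewrite ler_weXn2l. Qed.

Let bound n (u v : R) : (n <= 3)%N -> 0 <= u <= 1 -> `|v| <= 1 ->
  `|l ^+ n * u * v| <= l ^+ 3.
Proof.
move=> n3 /andP[u0 u1] v1; rewrite !normrM (ger0_norm u0) normrX (ger0_norm l_ge0).
rewrite -[leRHS]mulr1 ler_pM ?mulr_ge0 ?exprn_ge0// -[leRHS]mulr1 ler_pM ?exprn_ge0//.
exact: l_pow.
Qed.

Lemma logistic1_le y : `|logistic1 y| <= l ^+ 3.
Proof.
rewrite /logistic1 mulNr normrN -[_ * _]mulr1 -[X in X * _ * _]expr1.
by apply: bound => //; rewrite normr1.
Qed.

Lemma logistic2_le y : `|logistic2 y| <= l ^+ 3.
Proof.
apply: bound => //; have := logistic_ge0 y; have := logistic_le1 y.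
by rewrite ler_norml -/p => *; apply/andP; split; lra.
Qed.

Lemma logistic3_le y : `|logistic3 y| <= l ^+ 3.
Proof.
rewrite /logistic3 !mulNr normrN; apply: bound => //.
have := logistic_ge0 y; have := logistic_le1 y.
by rewrite ler_norml -/p => *; apply/andP; split; nra.
Qed.

Lemma continuous_logistic : continuous logistic.
Proof.
move=> t; apply: differentiable_continuous; apply/derivable1_diffP.
by case: (is_derive_logistic t).
Qed.

Lemma measurable_logistic : measurable_fun setT logistic.
Proof. exact: continuous_measurable_fun continuous_logistic. Qed.

Lemma logistic_lip x y : `|logistic y - logistic x| <= l ^+ 3 * `|y - x|.
Proof.
by apply: (increment_le is_derive_logistic) => t _; exact: logistic1_le.
Qed.

Lemma logistic_taylor y x :
  `|logistic (y + x) - logistic y - x * logistic1 y - x ^+ 2 / 2 * logistic2 y|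
  <= l ^+ 3 * `|x| ^+ 3.
Proof.
apply: (taylor2 is_derive_logistic is_derive_logistic1 is_derive_logistic2) => t _.
exact: logistic3_le.
Qed.

(** For large increments: quadratic growth in [x] is all that a finite second moment can pay for. *)
Lemma logistic_taylor_crude y x :
  `|logistic (y + x) - logistic y - x * logistic1 y - x ^+ 2 / 2 * logistic2 y|
  <= 2 * l ^+ 3 * x ^+ 2.
Proof.
have := @taylor1 R _ _ _ is_derive_logistic is_derive_logistic1 y x (l ^+ 3)
  (fun t _ => logistic2_le _).
have : `|x ^+ 2 / 2 * logistic2 y| <= x ^+ 2 / 2 * l ^+ 3.
  by rewrite normrM ger0_norm ?divr_ge0 ?sqr_ge0// ler_wpM2l ?divr_ge0 ?sqr_ge0// logistic2_le.
have := ler_normB (logistic (y + x) - logistic y - x * logistic1 y) (x ^+ 2 / 2 * logistic2 y).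
have : 0 <= x ^+ 2 * l ^+ 3 by rewrite mulr_ge0 ?sqr_ge0// exprn_ge0.
set u := `|_ - _|; set v := `|_ - _ - _|; set w := `|_ * _|; lra.
Qed.

End logistic.

Lemma logistic_step {R : realType} (d e : R) : 0 < d -> 0 < e ->
  exists2 l : R, 1 <= l & forall a y,
    (y <= a - d -> 1 - e <= logistic l a y) /\ (a + d <= y -> logistic l a y <= e).
Proof.
(* At distance [d] from [a] the exponent is then at least [1 / e] in absolute value, and
   [expR u >= 1 + u] yields the precision [e]; the summand 1 ensures [1 <= l]. *)
move=> d0 e0; exists (1 + (d * e)^-1); first by rewrite lerDl invr_ge0 mulr_ge0 ?(ltW d0) ?(ltW e0).
set l := 1 + (d * e)^-1 => a y.
have l0 : 0 < l by rewrite /l (lt_le_trans ltr01)// lerDl invr_ge0 mulr_ge0 ?(ltW d0) ?(ltW e0).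
have ld : e^-1 <= l * d.
  rewrite /l mulrDl mul1r invfM mulrAC mulVf ?gt_eqF// mul1r.
  by rewrite lerDr ltW.
split=> yd; rewrite /logistic.
  set u := l * (y - a).
  have ue : expR u <= e.
    have : u <= - (e^-1) by rewrite /u; have := ler_wpM2l (ltW l0) yd; lra.
    rewrite -ler_expR expRN => /le_trans; apply.
    rewrite -[leRHS]invrK lef_pV2 ?posrE ?expR_gt0 ?invr_gt0//.
    by have := expR_ge1Dx e^-1; lra.
  have u0 := expR_gt0 u.
  have d1 : 0 < 1 + expR u by rewrite addr_gt0.
  by rewrite -(@ler_pM2r _ (1 + expR u))// mulVf ?gt_eqF//; nra.
set u := l * (y - a).
have ue : e^-1 <= expR u.
  have : e^-1 <= u by rewrite /u; have := ler_wpM2l (ltW l0) yd; lra.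
  by have := expR_ge1Dx u; lra.
rewrite -[leRHS]invrK lef_pV2 ?posrE ?invr_gt0// ?addr_gt0 ?expR_gt0//.
by lra.
Qed.

(** * Normal distributions *)

Section gaussian.
Context {R : realType}.
Notation mu := (@lebesgue_measure R).

Section density.
Variables m s : R.
Local Notation nu := (normal_prob m s).
Let pdf := normal_pdf m s.

Let mpdf : measurable_fun setT pdf.
Proof. exact: measurable_normal_pdf. Qed.

Let pdf_ge0 x : 0 <= pdf x.
Proof. exact: normal_pdf_ge0. Qed.

Let normal_density_nnsfun (f : {nnsfun _ >-> R}) :
  (\int[nu]_x (f x)%:E = \int[mu]_x ((f x)%:E * (pdf x)%:E))%E.
Proof.
rewrite integralT_nnsfun sintegralE.
under [RHS]eq_integral.
  move=> x _; rewrite fimfunE -fsumEFin// ge0_mule_fsuml; last first.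
    by move=> r; rewrite EFinM nnfun_muleindic_ge0.
  over.
rewrite [RHS]ge0_integral_fsum//; last 2 first.
  - move=> r; apply: emeasurable_funM; last exact/measurable_EFinP.
    by apply/measurable_EFinP; apply: measurableT_comp.
  - move=> r x _; apply: mule_ge0; last by rewrite lee_fin.
    by rewrite EFinM nnfun_muleindic_ge0.
apply: eq_fsbigr => r _.
have [r0|r0] := leP 0 r; last first.
  rewrite (_ : f @^-1` [set r] = set0); last first.
    apply/seteqP; split => // x /= fx; move: r0; rewrite -fx ltNge.
    by rewrite fun_ge0.
  rewrite measure0 mule0 integral0_eq// => x _.
  by rewrite indic0 mulr0 mul0e.
have mA : measurable (f @^-1` [set r]) by exact: measurable_funPTI.
transitivity (\int[mu]_x (r%:E * ((fun x => (pdf x)%:E) \_ (f @^-1` [set r])) x))%E.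
  rewrite ge0_integralZl//; first by congr (_ * _)%E; exact: integral_mkcond.
  - apply/(measurable_restrictT _ mA) => //.
    exact/measurable_EFinP/measurable_funTS.
  - by move=> x _; apply: erestrict_ge0 => ? _; rewrite lee_fin.
apply: eq_integral => x _; rewrite patchE indicE.
by case: ifPn => xr; rewrite ?mulr1 ?mulr0 ?mul0e ?mule0.
Qed.

(** The density formula passes from simple functions to nonnegative ones by monotone convergence on
    both sides. *)
Lemma integral_normal_prob (f : _ -> \bar R) :
  measurable_fun setT f -> (forall x, 0 <= f x)%E ->
  (\int[normal_prob m s]_x f x = \int[mu]_x (f x * (normal_pdf m s x)%:E))%E.
Proof.
move=> mf f0; pose f_ := nnsfun_approx measurableT mf.
transitivity (limn (fun n => \int[nu]_x (f_ n x)%:E))%E.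
  rewrite -monotone_convergence//=.
  - apply: eq_integral => x _; apply/esym/cvg_lim => //=.
    exact: cvg_nnsfun_approx.
  - by move=> n; exact/measurable_EFinP/measurable_funTS.
  - by move=> n ? _; rewrite lee_fin.
  - by move=> ? _ ? ? ?; rewrite lee_fin; exact/lefP/nd_nnsfun_approx.
transitivity (limn (fun n => \int[mu]_x ((f_ n x)%:E * (pdf x)%:E)))%E.
  by congr (limn _); apply/funext => n; exact: normal_density_nnsfun.
rewrite -monotone_convergence//=.
- apply: eq_integral => x _; apply/cvg_lim => //; apply: cvgeMr => //.
  exact: cvg_nnsfun_approx.
- move=> n; apply: emeasurable_funM; last exact/measurable_EFinP.
  exact/measurable_EFinP.
- by move=> n x _; rewrite mule_ge0// lee_fin.
- move=> x _ n n' nn'; rewrite lee_wpmul2r ?lee_fin//.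
  exact/lefP/nd_nnsfun_approx.
Qed.

End density.

(** Completing the square in [x]: for independent centred normals [X], [Y] of deviations [a], [b],
    the joint density of [(X, X + Y)] is the density of the sum times the conditional density of [X]
    given the sum. *)
Lemma normal_pdf_mul (a b x z : R) : 0 < a -> 0 < b ->
  let c := Num.sqrt (a ^+ 2 + b ^+ 2) in
  normal_pdf 0 a x * normal_pdf x b z =
  normal_pdf 0 c z * normal_pdf (z * a ^+ 2 / c ^+ 2) (a * b / c) x.
Proof.
move=> a0 b0 c.
have S0 : 0 < a ^+ 2 + b ^+ 2 by rewrite addr_gt0// exprn_gt0.
have c0 : 0 < c by rewrite sqrtr_gt0.
have c2 : c ^+ 2 = a ^+ 2 + b ^+ 2 by rewrite sqr_sqrtr// ltW.
have t0 : 0 < a * b / c by rewrite divr_gt0// mulr_gt0.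
rewrite !normal_pdfE ?gt_eqF//.
rewrite [LHS]mulrACA [RHS]mulrACA; congr (_ * _).
  have pk (s : R) : 0 <= s ^+ 2 * pi *+ 2.
    by apply/mulrn_wge0/mulr_ge0; rewrite ?sqr_ge0 ?pi_ge0.
  rewrite /normal_peak -!invfM -!sqrtrM ?pk//.
  congr (_^-1); congr Num.sqrt; rewrite !exprMn !exprVn c2.
  by field; rewrite gt_eqF.
rewrite /normal_fun -!expRD; congr expR.
rewrite !subr0 !exprMn !exprVn c2.
by field; rewrite !gt_eqF// ?expf_neq0 ?gt_eqF//= mulf_neq0 ?gt_eqF.
Qed.

Let measurable_pdf2 (b : R) : 0 < b ->
  measurable_fun setT (fun xz : R * R => normal_pdf xz.1 b xz.2).
Proof.
move=> b0; rewrite (_ : (fun _ => _) = fun xz : R * R => normal_peak b *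
    expR (- (xz.2 - xz.1) ^+ 2 / (b ^+ 2 *+ 2))); last first.
  by apply/funext => xz; rewrite normal_pdfE ?gt_eqF.
apply: measurable_funM => //; apply: measurableT_comp => //.
apply: measurable_funM => //; apply: measurableT_comp => //.
by apply: measurable_funX; apply: measurable_funB.
Qed.

Lemma normal_prob_shift (f : R -> R) (x b : R) : continuous f ->
  (forall y, 0 <= f y) -> 0 < b ->
  (\int[normal_prob 0 b]_y (f (x + y))%:E =
   \int[mu]_z ((f z)%:E * (normal_pdf x b z)%:E))%E.
Proof.
move=> cf f0 b0.
have mf : measurable_fun setT f by exact: continuous_measurable_fun.
rewrite integral_normal_prob; last 2 first.
- apply/measurable_EFinP; apply: (measurableT_comp mf).
  exact: measurable_funD.
- by move=> y; rewrite lee_fin.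
pose G z := f z * normal_pdf x b z.
pose Sh (y : R) : R := x + y.
have dSh (y : R) : is_derive y (1 : R) Sh 1.
  by rewrite /Sh; apply: is_derive_eq; rewrite add0r ?mulr1.
have Sh' : (Sh^`())%classic = cst 1.
  by apply/funext => y; rewrite derive1E; apply: derive_val.
transitivity (\int[mu]_y (((G \o Sh) * (Sh^`())%classic) y)%:E)%E.
  apply: eq_integral => y _; rewrite Sh' -EFinM; congr EFin.
  rewrite /G /Sh !fctE /= mulr1; congr (_ * _).
  rewrite normal_pdfE ?gt_eqF// normal_pdfE ?gt_eqF//.
  by rewrite /normal_fun subr0 addrAC subrr add0r.
rewrite -increasing_ge0_integration_by_substitutionT//.
- by move=> u v uv; rewrite /Sh ltrD2l.
- by rewrite Sh' => ?; exact: cvg_cst.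
- by rewrite Sh'; exact: is_cvg_cst.
- by rewrite Sh'; exact: is_cvg_cst.
- by rewrite /Sh; under eq_fun do rewrite addrC; exact: cvg_addrr_Ny.
- by rewrite /Sh; under eq_fun do rewrite addrC; exact: cvg_addrr.
- move=> z; apply: cvgM; first exact: cf.
  by apply: continuous_normal_pdf; rewrite gt_eqF.
- by move=> z; rewrite mulr_ge0// normal_pdf_ge0.
Qed.

(** After Tonelli, [normal_pdf_mul] leaves in [x] only a conditional normal density, of integral 1.
    Continuity of [f] is required by the change of variable in [normal_prob_shift]. *)
Lemma normal_convolution (f : R -> R) (a b : R) : continuous f ->
  (forall y, 0 <= f y) -> 0 < a -> 0 < b ->
  (\int[normal_prob 0 a]_x \int[normal_prob 0 b]_y (f (x + y))%:E =
   \int[normal_prob 0 (Num.sqrt (a ^+ 2 + b ^+ 2))]_x (f x)%:E)%E.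
Proof.
move=> cf f0 a0 b0; set c := Num.sqrt _.
have mf : measurable_fun setT f by exact: continuous_measurable_fun.
have mG : measurable_fun setT (fun xz : R * R =>
    ((f xz.2)%:E * (normal_pdf xz.1 b xz.2)%:E)%E).
  apply: emeasurable_funM; last by apply/measurable_EFinP; exact: measurable_pdf2.
  by apply/measurable_EFinP; apply: (measurableT_comp mf measurable_snd).
have G0 (xz : R * R) : (0 <= (f xz.2)%:E * (normal_pdf xz.1 b xz.2)%:E)%E.
  by rewrite mule_ge0// lee_fin ?f0 ?normal_pdf_ge0.
under eq_integral do rewrite normal_prob_shift//.
rewrite [LHS]integral_normal_prob; last 2 first.
- exact: (measurable_fun_fubini_tonelli_F (m2 := mu) _ mG G0).
- by move=> x; apply: integral_ge0 => z _; rewrite mule_ge0// lee_fin ?f0 ?normal_pdf_ge0.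
rewrite [RHS]integral_normal_prob; last 2 first.
- exact/measurable_EFinP.
- by move=> z; rewrite lee_fin.
pose g (xz : R * R) := ((f xz.2)%:E * (normal_pdf xz.1 b xz.2)%:E * (normal_pdf 0 a xz.1)%:E)%E.
have mg : measurable_fun setT g.
  apply: emeasurable_funM => //; apply/measurable_EFinP.
  by apply: measurableT_comp; [exact: measurable_normal_pdf|].
have g0 xz : (0 <= g xz)%E.
  by rewrite !mule_ge0// lee_fin ?f0 ?normal_pdf_ge0.
transitivity (\int[mu]_x \int[mu]_z g (x, z))%E.
  apply: eq_integral => x _; rewrite -ge0_integralZr//.
  - apply: emeasurable_funM; first exact/measurable_EFinP.
    by apply/measurable_EFinP; exact: measurable_normal_pdf.
  - by move=> z _; apply: mule_ge0; rewrite lee_fin; [exact: f0|exact: normal_pdf_ge0].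
  - by rewrite lee_fin normal_pdf_ge0.
transitivity (\int[mu]_z \int[mu]_x g (x, z))%E.
  exact: (fubini_tonelli (m1 := mu) (m2 := mu) g mg g0).
apply: eq_integral => z _.
transitivity (\int[mu]_x (((f z)%:E * (normal_pdf 0 c z)%:E) *
    (normal_pdf (z * a ^+ 2 / c ^+ 2) (a * b / c) x)%:E))%E.
  apply: eq_integral => x _; rewrite /g /= -!EFinM; congr EFin.
  by rewrite -mulrA [_ * normal_pdf 0 a x]mulrC normal_pdf_mul// mulrA.
rewrite ge0_integralZl//.
- by rewrite integral_normal_pdf mule1.
- by apply/measurable_EFinP; exact: measurable_normal_pdf.
- by move=> x _; rewrite lee_fin normal_pdf_ge0.
- by rewrite mule_ge0// lee_fin ?f0 ?normal_pdf_ge0.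
Qed.

Section moments.
Variable b : R.
Hypothesis b_gt0 : 0 < b.
Local Notation nu := (normal_prob 0 b).

Let mexp (l : R) : measurable_fun setT (fun x : R => expR (l * x)).
Proof. by apply: measurableT_comp => //; exact: measurable_funM. Qed.

Let integral_mgf (l : R) :
  (\int[nu]_x (expR (l * x))%:E = (expR (l ^+ 2 * b ^+ 2 / 2))%:E)%E.
Proof.
rewrite integral_normal_prob; last 2 first.
- by apply/measurable_EFinP; exact: mexp.
- by move=> x; rewrite lee_fin expR_ge0.
(* Exponential tilting moves the mean of the normal density to [l b^2]. *)
transitivity (\int[mu]_x ((expR (l ^+ 2 * b ^+ 2 / 2))%:E *
    (normal_pdf (l * b ^+ 2) b x)%:E))%E.
  apply: eq_integral => x _; rewrite -!EFinM; congr EFin.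
  rewrite !normal_pdfE ?gt_eqF// mulrCA [RHS]mulrCA; congr (_ * _).
  rewrite /normal_fun -!expRD; congr expR.
  by field; rewrite gt_eqF.
rewrite ge0_integralZl//.
- by rewrite integral_normal_pdf mule1.
- by apply/measurable_EFinP; exact: measurable_normal_pdf.
- by move=> x _; rewrite lee_fin normal_pdf_ge0.
Qed.

Lemma normal_mgf_L1 (l : R) : L1 nu (fun x => expR (l * x)).
Proof.
apply: ge0_L1; first exact: mexp; first by move=> x; exact: expR_ge0.
by rewrite integral_mgf ltry.
Qed.

Lemma normal_mgf (l : R) :
  Ex nu (fun x => expR (l * x)) = expR (l ^+ 2 * b ^+ 2 / 2).
Proof. by rewrite /Ex /Rintegral integral_mgf. Qed.

End moments.

End gaussian.

Section gaussian_moments.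
Context {R : realType}.

Lemma expr_le_expR (y : R) n : 0 <= y -> y ^+ n <= expR (n%:R * y).
Proof.
move=> y0; rewrite expRM_natl lerXn2r ?nnegrE ?expR_ge0//.
by have := expR_ge1Dx y; lra.
Qed.

Lemma expR_norm_le (x : R) : expR `|x| <= expR x + expR (- x).
Proof.
have [x0|x0] := ger0P x; first by rewrite lerDl expR_ge0.
by rewrite lerDr expR_ge0.
Qed.

Lemma is_derive_expR1 (t : R) : is_derive t (1 : R) expR (expR t).
Proof. exact: is_derive_expR. Qed.

Lemma expR_taylor1 (x : R) : `|expR x - 1 - x| <= expR `|x| * x ^+ 2.
Proof.
have := @taylor1 R expR expR expR is_derive_expR1 is_derive_expR1 0 x (expR `|x|).
rewrite !add0r expR0 mulr1; apply => t tx.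
by rewrite add0r ger0_norm ?expR_ge0// ler_expR (le_trans (ler_norm t)).
Qed.

Lemma expR_taylor2 (x : R) :
  `|expR x - 1 - x - x ^+ 2 / 2| <= expR `|x| * `|x| ^+ 3.
Proof.
have := @taylor2 R expR expR expR expR is_derive_expR1 is_derive_expR1 is_derive_expR1
  0 x (expR `|x|).
rewrite !add0r expR0 !mulr1; apply => t tx.
by rewrite add0r ger0_norm ?expR_ge0// ler_expR (le_trans (ler_norm t)).
Qed.

Variable b : R.
Hypothesis b_gt0 : 0 < b.
Hypothesis b_le1 : b <= 1.
Local Notation nu := (normal_prob 0 b).

(** A majorant of the Taylor remainder [expR |x| |x|^3] whose mean is explicit and of order [b^3].
    With [u = |x| / b], [u^3 <= 27 expR u] from [u / 3 <= expR (u / 3)], and [|x| <= u] because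
    [b <= 1]. *)
Let w (x : R) : R := 27 * b ^+ 3 * (expR (2 / b * x) + expR (- (2 / b) * x)).

Let w_L1 : L1 nu w.
Proof. by apply: L1Z; apply: L1D; exact: normal_mgf_L1. Qed.

Let Ex_w : Ex nu w = 54 * expR 2 * b ^+ 3.
Proof.
rewrite ExZ; last by apply: L1D; exact: normal_mgf_L1.
rewrite ExD; [|exact: normal_mgf_L1|exact: normal_mgf_L1].
rewrite !normal_mgf// sqrrN (_ : (2 / b) ^+ 2 * b ^+ 2 / 2 = 2); first by ring.
by field; rewrite gt_eqF.
Qed.

Let cube_le (x : R) : expR `|x| * `|x| ^+ 3 <= w x.
Proof.
set u := `|x| / b.
have u0 : 0 <= u by rewrite divr_ge0 ?(ltW b_gt0).
have xu : `|x| = b * u by rewrite /u; field; rewrite gt_eqF.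
have xleu : `|x| <= u by rewrite xu ler_piMl.
have u3 : u ^+ 3 <= 27 * expR u.
  have /(expr_le_expR 3) : 0 <= u / 3 by rewrite divr_ge0.
  rewrite (_ : 3 * (u / 3) = u) ?exprMn; last by field.
  by rewrite exprVn; lra.
have e2u : expR u * expR u <= expR (2 / b * x) + expR (- (2 / b) * x).
  rewrite -expRD (_ : u + u = `|2 / b * x|) ?mulNr ?expR_norm_le//.
  by rewrite normrM ger0_norm ?divr_ge0 ?(ltW b_gt0)// /u; ring.
rewrite /w (_ : `|x| ^+ 3 = b ^+ 3 * u ^+ 3); last by rewrite xu exprMn.
apply: (@le_trans _ _ (expR u * (b ^+ 3 * (27 * expR u)))).
  have b3 : 0 <= b ^+ 3 by rewrite exprn_ge0// ltW.
  apply: ler_pM => //.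
  - by rewrite mulr_ge0// exprn_ge0.
  - by rewrite ler_expR.
  - by apply: ler_wpM2l.
rewrite (_ : _ * _ = 27 * b ^+ 3 * (expR u * expR u)); last by ring.
by apply: ler_wpM2l => //; rewrite mulr_ge0// exprn_ge0// ltW.
Qed.

Let cube_L1 : L1 nu (fun x => `|x| ^+ 3).
Proof.
apply: (L1_le _ _ w_L1).
  suff : measurable_fun setT (fun x : R => `|x| ^+ 3) by [].
  by apply: measurable_funX; exact: normr_measurable.
move=> x; rewrite ger0_norm ?exprn_ge0// (le_trans _ (cube_le x))//.
by rewrite ler_peMl ?exprn_ge0// -[leLHS]expR0 ler_expR.
Qed.

Let exp1_L1 (l : R) : L1 nu (fun x => expR (l * x)).
Proof. exact: normal_mgf_L1. Qed.

Let cosh_L1 : L1 nu (fun x => expR x + expR (- x)).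
Proof.
apply: L1D; first by apply: eq_L1 (exp1_L1 1) => x; rewrite mul1r.
by apply: eq_L1 (exp1_L1 (-1)) => x; rewrite mulN1r.
Qed.

Let id_L1 : L1 nu (fun x => x).
Proof.
apply: (L1_le _ _ cosh_L1) => // x; apply: le_trans (expR_norm_le x).
by have := expR_ge1Dx `|x|; lra.
Qed.

Let sqr_L1 : L1 nu (fun x => x ^+ 2).
Proof.
apply: (L1_le _ _ (L1Z 4 cosh_L1)) => // x.
rewrite normrX; have /(expr_le_expR 2) : 0 <= `|x| / 2 by rewrite divr_ge0.
rewrite exprMn exprVn (_ : 2 * (`|x| / 2) = `|x|); last by field.
by have := expR_norm_le x; lra.
Qed.

Let Ex_exp : Ex nu expR = expR (b ^+ 2 / 2).
Proof.
rewrite (_ : b ^+ 2 / 2 = 1 ^+ 2 * b ^+ 2 / 2); last by ring.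
by rewrite -normal_mgf//; apply: eq_Ex => x; rewrite mul1r.
Qed.

Let Ex_expN : Ex nu (fun x => expR (- x)) = expR (b ^+ 2 / 2).
Proof.
rewrite (_ : b ^+ 2 / 2 = (-1) ^+ 2 * b ^+ 2 / 2); last by ring.
by rewrite -normal_mgf//; apply: eq_Ex => x; rewrite mulN1r.
Qed.

Let exp_L1 : L1 nu expR.
Proof. by apply: eq_L1 (exp1_L1 1) => x; rewrite mul1r. Qed.

Let expN_L1 : L1 nu (fun x => expR (- x)).
Proof. by apply: eq_L1 (exp1_L1 (-1)) => x; rewrite mulN1r. Qed.

Let t2 (x : R) : `|expR x - 1 - x - x ^+ 2 / 2| <= w x /\
  `|expR (- x) - 1 + x - x ^+ 2 / 2| <= w x.
Proof.
split; first exact: le_trans (expR_taylor2 x) (cube_le x).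
have := expR_taylor2 (- x); rewrite normrN sqrrN opprK.
by move=> /le_trans; apply; exact: cube_le.
Qed.

(** Moments are read off the generating function up to order [b^3]: [2 x] differs by at most [2 w]
    from [expR x - expR (- x)], of mean zero. *)
Let mean_le : `|Ex nu (fun x => x)| <= Ex nu w.
Proof.
have E : Ex nu (fun x => 2 * x - (expR x - expR (- x))) = 2 * Ex nu (fun x => x).
  rewrite ExB ?ExB ?ExZ//; [|exact: L1Z|exact: L1B].
  by rewrite Ex_exp Ex_expN; ring.
suff : `|2 * Ex nu (fun x => x)| <= Ex nu (fun x => 2 * w x).
  by rewrite ExZ// normrM ger0_norm// ler_pM2l.
have L : L1 nu (fun x => 2 * x - (expR x - expR (- x))).
  by apply: L1B; [exact: L1Z|exact: L1B].
rewrite -E; apply: (le_trans (Ex_norm L)).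
apply: Ex_le; [exact: L1_norm|exact: L1Z|move=> x].
have [] := t2 x; rewrite !ler_norml => /andP[? ?] /andP[? ?].
by apply/andP; split; lra.
Qed.

(** Likewise [x^2] is compared with [expR x + expR (- x) - 2], whose mean is [2 expR (b^2 / 2) - 2],
    that is [b^2] up to order [b^4 <= b^3]. *)
Let sqr_mean_le : `|Ex nu (fun x => x ^+ 2) - b ^+ 2| <= 2 * Ex nu w + expR 1 * b ^+ 3.
Proof.
have b2 : 0 <= b ^+ 2 by exact: sqr_ge0.
have b21 : b ^+ 2 <= 1 by rewrite exprn_ile1// ltW.
have E : Ex nu (fun x => x ^+ 2 - (expR x + expR (- x) - 2)) =
    Ex nu (fun x => x ^+ 2) - (2 * expR (b ^+ 2 / 2) - 2).
  rewrite ExB//; last by apply: L1B => //; exact: L1_cst.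
  rewrite ExB//; last exact: L1_cst.
  by rewrite ExD// Ex_exp Ex_expN Ex_cst; ring.
have H1 : `|Ex nu (fun x => x ^+ 2) - (2 * expR (b ^+ 2 / 2) - 2)| <= 2 * Ex nu w.
  have L : L1 nu (fun x => x ^+ 2 - (expR x + expR (- x) - 2)).
    by apply: L1B => //; apply: L1B => //; exact: L1_cst.
  rewrite -E -ExZ//; apply: (le_trans (Ex_norm L)).
  apply: Ex_le; [exact: L1_norm|exact: L1Z|move=> x].
  have [] := t2 x; rewrite !ler_norml => /andP[? ?] /andP[? ?].
  by apply/andP; split; lra.
have H2 : `|expR (b ^+ 2 / 2) - 1 - b ^+ 2 / 2| <= expR 1 * (b ^+ 2 / 2) ^+ 2.
  apply: le_trans (expR_taylor1 _) _; rewrite ler_wpM2r ?sqr_ge0// ler_expR.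
  by rewrite ger0_norm; lra.
have H3 : (b ^+ 2 / 2) ^+ 2 <= b ^+ 3 / 4.
  have : b ^+ 4 <= b ^+ 3 by rewrite ler_wiXn2l// ltW.
  by rewrite exprMn -exprM exprVn; lra.
have H4 : expR 1 * (b ^+ 2 / 2) ^+ 2 <= expR 1 * (b ^+ 3 / 4).
  by apply: ler_wpM2l => //; exact: expR_ge0.
have H5 : 0 <= expR 1 * b ^+ 3 by rewrite mulr_ge0 ?expR_ge0 ?exprn_ge0// ltW.
move: H1 H2; rewrite !ler_norml => /andP[? ?] /andP[? ?].
by apply/andP; split; lra.
Qed.

(** The main term is the one of [lindeberg_step], so the two cancel. [Ex nu w = 54 expR 2 b^3] is
    spent three times: on the Taylor remainder, the first and the second moment; hence 162. *)
Lemma normal_logistic_step (l a y : R) : 1 <= l ->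
  `|Ex nu (fun x => logistic l a (y + x)) - logistic l a y
    - b ^+ 2 / 2 * logistic2 l a y| <= l ^+ 3 * ((162 * expR 2 + expR 1) * b ^+ 3).
Proof.
move=> l1; set g := logistic l a; set g1 := logistic1 l a y; set g2 := logistic2 l a y.
have l3 : 0 <= l ^+ 3 by rewrite exprn_ge0; lra.
have gL1 : L1 nu (fun x => g (y + x)).
  apply: (@bounded_L1 _ _ _ _ _ 1).
    apply: (measurableT_comp (measurable_logistic _ _)) => //.
    exact: measurable_funD.
  by move=> x; rewrite ger0_norm ?logistic_ge0 ?logistic_le1.
have L1' : L1 nu (fun x => g1 * x) by exact: L1Z.
have L2' : L1 nu (fun x => g2 / 2 * x ^+ 2) by exact: L1Z.
have L : L1 nu (fun x => g (y + x) - g y - g1 * x - g2 / 2 * x ^+ 2).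
  by apply: L1B => //; apply: L1B => //; apply: L1B => //; exact: L1_cst.
have H0 : `|Ex nu (fun x => g (y + x)) - g y - g1 * Ex nu (fun x => x)
    - g2 / 2 * Ex nu (fun x => x ^+ 2)| <= l ^+ 3 * Ex nu w.
  have E : Ex nu (fun x => g (y + x) - g y - g1 * x - g2 / 2 * x ^+ 2) =
      Ex nu (fun x => g (y + x)) - g y - g1 * Ex nu (fun x => x)
      - g2 / 2 * Ex nu (fun x => x ^+ 2).
    have Lc := L1_cst nu (g y).
    rewrite ExB//; last by apply: L1B => //; exact: L1B.
    rewrite ExB//; last exact: L1B.
    by rewrite ExB// !ExZ// Ex_cst.
  rewrite -E -ExZ//; apply: (le_trans (Ex_norm L)).
  apply: Ex_le; [exact: L1_norm|exact: L1Z|move=> x].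
  have alg (p q u v : R) :
      p - q - u * x - v / 2 * x ^+ 2 = p - q - x * u - x ^+ 2 / 2 * v by ring.
  rewrite alg; apply: (le_trans (logistic_taylor _ l1 y x)).
  apply: ler_wpM2l => //; apply: le_trans (cube_le x).
  by rewrite ler_peMl ?exprn_ge0// -[leLHS]expR0 ler_expR.
have H1 : `|g1 * Ex nu (fun x => x)| <= l ^+ 3 * Ex nu w.
  by rewrite normrM ler_pM// logistic1_le.
have H2 : `|g2 / 2 * (Ex nu (fun x => x ^+ 2) - b ^+ 2)| <=
    l ^+ 3 / 2 * (2 * Ex nu w + expR 1 * b ^+ 3).
  rewrite normrM ler_pM// normrM (ger0_norm (_ : 0 <= 2^-1))//.
  by rewrite ler_wpM2r// logistic2_le.
have H3 : 0 <= l ^+ 3 * (expR 1 * b ^+ 3).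
  by rewrite mulr_ge0// mulr_ge0 ?expR_ge0 ?exprn_ge0// ltW.
have -> : (162 * expR 2 + expR 1) * b ^+ 3 = 3 * Ex nu w + expR 1 * b ^+ 3.
  by rewrite Ex_w; move: (expR 2) (expR 1) (b ^+ 3) => u v t; ring.
move: H0 H1 H2 H3; rewrite -/g.
move: (Ex nu _) (Ex nu _) (Ex nu _) (Ex nu w) => E0 E1 E2 W.
rewrite !ler_norml => /andP[? ?] /andP[? ?] /andP[? ?] ?.
by apply/andP; split; lra.
Qed.

End gaussian_moments.

(** * The central limit theorem *)

Section shift_operator.
Context {R : realType}.
Implicit Types f g : R -> R.

(** A class of test functions integrable under every probability, stable under shift operators, and
    nonnegative, so that Tonelli applies. *)
Definition fuzzy g := measurable_fun setT g /\ forall y, 0 <= g y <= 1.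

Definition shift_op {d} {T : measurableType d} (P : probability T R)
  (u : T -> R) g (y : R) : R := Ex P (fun t => g (y + u t)).

Section one.
Context {d} {T : measurableType d}.
Variables (P : probability T R) (u : T -> R).
Hypothesis mu : measurable_fun setT u.
Local Notation A := (shift_op P u).

Let mpair g : measurable_fun setT g ->
  measurable_fun setT (fun yt : R * T => g (yt.1 + u yt.2)).
Proof.
move=> mg; apply: (measurableT_comp mg).
apply: measurable_funD; first exact: measurable_fst.
exact: (measurableT_comp mu measurable_snd).
Qed.

Lemma fuzzy_L1 g y : fuzzy g -> L1 P (fun t => g (y + u t)).
Proof.
move=> [mg g01]; apply: (@bounded_L1 _ _ _ _ _ 1).
  by apply: (measurableT_comp mg); exact: measurable_funD.
by move=> t; have /andP[g0 g1] := g01 (y + u t); rewrite ger0_norm.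
Qed.

Lemma EFin_shift_op g y : fuzzy g ->
  ((A g y)%:E = \int[P]_t (g (y + u t))%:E)%E.
Proof. by move=> gC; rewrite EFin_Ex//; exact: fuzzy_L1. Qed.

Lemma fuzzy_shift_op g : fuzzy g -> fuzzy (A g).
Proof.
move=> gC; have [mg g01] := gC; split.
  suff : measurable_fun setT (EFin \o A g) by move/measurable_EFinP.
  rewrite (_ : _ \o _ = fubini_F P (fun yt : R * T => (g (yt.1 + u yt.2))%:E)).
    apply: measurable_fun_fubini_tonelli_F.
      by apply/measurable_EFinP; exact: mpair.
    by move=> yt; rewrite lee_fin; have /andP[] := g01 (yt.1 + u yt.2).
  by apply/funext => y; rewrite /= EFin_shift_op.
move=> y; apply/andP; split.
  by apply: Ex_ge0 => t; have /andP[] := g01 (y + u t).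
rewrite -[leRHS](Ex_cst P); apply: Ex_le; [exact: fuzzy_L1|exact: L1_cst|].
by move=> t; have /andP[] := g01 (y + u t).
Qed.

Lemma shift_op_contraction f g e : fuzzy f -> fuzzy g ->
  (forall y, `|f y - g y| <= e) -> forall y, `|A f y - A g y| <= e.
Proof.
move=> fC gC fg y; have Lf := fuzzy_L1 y fC; have Lg := fuzzy_L1 y gC.
rewrite -ExB//; apply: (le_trans (Ex_norm (L1B Lf Lg))).
rewrite -[leRHS](Ex_cst P); apply: Ex_le; [|exact: L1_cst|by []].
exact: L1_norm (L1B Lf Lg).
Qed.

End one.

Section two.
Context {d d'} {T : measurableType d} {T' : measurableType d'}.
Variables (P : probability T R) (u : T -> R).
Variables (Q : probability T' R) (v : T' -> R).
Hypothesis mu : measurable_fun setT u.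
Hypothesis mv : measurable_fun setT v.
Local Notation A := (shift_op P u).
Local Notation B := (shift_op Q v).

Lemma shift_opC g : fuzzy g -> A (B g) = B (A g).
Proof.
move=> gC; have [mg g01] := gC; apply/funext => y; apply: EFin_inj.
rewrite EFin_shift_op//; last exact: fuzzy_shift_op.
rewrite EFin_shift_op//; last exact: fuzzy_shift_op.
pose G (tt : T * T') := (g (y + u tt.1 + v tt.2))%:E.
transitivity (\int[P]_t \int[Q]_t' G (t, t'))%E.
  by apply: eq_integral => t _; rewrite EFin_shift_op.
transitivity (\int[Q]_t' \int[P]_t G (t, t'))%E; last first.
  apply: eq_integral => t' _; rewrite EFin_shift_op//.
  by apply: eq_integral => t _; rewrite /G /= addrAC.
apply: (fubini_tonelli (m1 := P) (m2 := Q) G).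
  apply/measurable_EFinP; apply: (measurableT_comp mg).
  apply: measurable_funD; last exact: (measurableT_comp mv measurable_snd).
  apply: measurable_funD => //; exact: (measurableT_comp mu measurable_fst).
by move=> tt; rewrite lee_fin; have /andP[] := g01 (y + u tt.1 + v tt.2).
Qed.

Lemma fuzzy_iter n g : fuzzy g -> fuzzy (iter n A g).
Proof. by move=> gC; elim: n => //= n IH; exact: fuzzy_shift_op. Qed.

Lemma iter_shift_contraction n f g e : fuzzy f -> fuzzy g ->
  (forall y, `|f y - g y| <= e) -> forall y, `|iter n A f y - iter n A g y| <= e.
Proof.
move=> fC gC fg; elim: n => [|n IH] //= y.
by apply: shift_op_contraction => //; exact: fuzzy_iter.
Qed.

End two.

(* Both iterates are compared through A (B^n f) = B^n (A f). *)
Lemma iter_shift_diff {d d'} {T : measurableType d} {T' : measurableType d'}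
  (P : probability T R) (u : T -> R) (Q : probability T' R) (v : T' -> R)
  (f : R -> R) e n :
  measurable_fun setT u -> measurable_fun setT v -> fuzzy f ->
  (forall y, `|shift_op P u f y - shift_op Q v f y| <= e) ->
  forall y, `|iter n (shift_op P u) f y - iter n (shift_op Q v) f y| <= n%:R * e.
Proof.
move=> mu mv fC fe; set A := shift_op P u; set B := shift_op Q v.
have AB k : A (iter k B f) = iter k B (A f).
  by elim: k => //= k IH; rewrite -IH; apply: shift_opC => //; exact: fuzzy_iter.
elim: n => [|n IH] y; first by rewrite subrr normr0 mul0r.
have H1 : `|A (iter n A f) y - A (iter n B f) y| <= n%:R * e.
  by apply: shift_op_contraction => //; exact: fuzzy_iter.
have H2 : `|iter n B (A f) y - iter n B (B f) y| <= e.
  by apply: iter_shift_contraction => //; exact: fuzzy_shift_op.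
rewrite -AB -iterSr in H2.
rewrite -natr1 mulrDl mul1r; apply: le_trans (lerD H1 H2).
exact: ler_distD.
Qed.

End shift_operator.

Section random_walk.
Context {dO dX : measure_display} {R : realType}.
Context {Omega : measurableType dO} {Xi : measurableType dX}.
Variables (P : probability Omega R) (F : probability Xi R).
Variable xi : nat -> Omega -> Xi.
Hypothesis Hiid : iid_from P F xi.
Variable u : Xi -> R.
Hypothesis mu : measurable_fun setT u.

(** The induction hypothesis is applied to the function already averaged over one step; that step is
    then realised by [xi n], independent of the first [n] observations. *)
Lemma iter_shift_walk n (f : R -> R) y : fuzzy f ->
  iter n (shift_op F u) f y = Ex P (fun w => f (y + \sum_(0 <= i < n) u (xi i w))).
Proof.
elim: n f y => [|n IH] f y fC.
  by rewrite /= -[LHS](Ex_cst P); apply: eq_Ex => w; rewrite big_nil addr0.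
rewrite iterSr IH; last exact: fuzzy_shift_op.
have [mf f01] := fC.
(* The two blocks are [0, ..., n-1] and [n], prolonged by large even and by large odd indices
   respectively to stay disjoint. *)
pose s i := if (i < n)%N then i else i.+1.*2.
pose s' i := if i == 0%N then n else (n + i).*2.+1.
have sinj : injective s by move=> i j; rewrite /s; do 2 case: ifP; lia.
have s'inj : injective s' by move=> i j; rewrite /s'; do 2 case: ifP; lia.
have ss' i j : s i <> s' j by rewrite /s /s'; do 2 case: ifP; lia.
have mwalk : measurable_fun setT
    (fun x : seq_space Xi => \sum_(0 <= i < n) u (x i)).
  by apply: measurable_sum => i; apply: (measurableT_comp mu); exact: measurable_coord.
pose G (xx : seq_space Xi * seq_space Xi) :=
  (f (y + \sum_(0 <= i < n) u (xx.1 i) + u (xx.2 0%N)))%:E.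
have mG : measurable_fun setT G.
  apply/measurable_EFinP; apply: (measurableT_comp mf).
  apply: measurable_funD.
    by apply: measurable_funD => //; exact: (measurableT_comp mwalk measurable_fst).
  apply: (measurableT_comp mu).
  exact: (measurableT_comp (measurable_coord 0%N) measurable_snd).
have G0 xx : (0 <= G xx)%E.
  rewrite lee_fin.
  by have /andP[] := f01 (y + \sum_(0 <= i < n) u (xx.1 i) + u (xx.2 0%N)).
have mS m : measurable_fun setT (fun w => \sum_(0 <= i < m) u (xi i w)).
  apply: measurable_sum => i; apply: (measurableT_comp mu); by case: Hiid.
apply: EFin_inj; rewrite EFin_Ex; last by apply: (fuzzy_L1 _ (mS n)); exact: fuzzy_shift_op.
rewrite EFin_Ex; last exact: (fuzzy_L1 _ (mS n.+1)).
transitivity (\int[P]_w G (sample xi s w, sample xi s' w))%E; last first.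
  apply: eq_integral => w _; rewrite /G /sample /= big_nat_recr//= addrA /s' /=.
  by congr (f (y + _ + _))%:E; apply: eq_big_nat => i /andP[_ ilt]; rewrite /s ilt.
rewrite (block_Tonelli Hiid sinj s'inj ss' mG G0).
apply: eq_integral => w _; rewrite EFin_shift_op// -EFin_Ex; last exact: fuzzy_L1.
set c := y + _; have Lc := @fuzzy_L1 _ _ _ F u mu f c fC.
rewrite -(Ex_coord Hiid n Lc) EFin_Ex; last exact: (L1_coord Hiid).
apply: eq_integral => v _; rewrite /G /sample /= /s' /= /c.
by congr (f (y + _ + _))%:E; apply: eq_big_nat => i /andP[_ ilt]; rewrite /s ilt.
Qed.

End random_walk.

Lemma iter_shift_normal {R : realType} (b : R) (f : R -> R) n y :
  0 < b -> continuous f -> fuzzy f -> (0 < n)%N ->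
  iter n (shift_op (normal_prob 0 b) id) f y =
  Ex (normal_prob 0 (b * Num.sqrt n%:R)) (fun x => f (y + x)).
Proof.
move=> b0 cf fC; case: n => [|n _]; first by rewrite ltnn.
have [mf f01] := fC.
elim: n y => [|n IH] y; first by rewrite /= sqrtr1 mulr1.
have L (p : probability (measurableTypeR R) R) c : L1 p (fun x => f (c + x)).
  exact: (@fuzzy_L1 _ _ _ p id).
rewrite iterS.
set g := iter n.+1 _ f in IH *.
have gC : fuzzy g by apply: fuzzy_iter.
clearbody g.
have E := @EFin_shift_op R _ _ (normal_prob 0 b) id (@measurable_id _ _ _) g y gC.
apply: EFin_inj; transitivity (\int[normal_prob 0 b]_x (g (y + x))%:E)%E.
  exact: E.
clear E.
have cfy : continuous (fun x => f (y + x)).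
  move=> x; apply: (continuous_comp (f := fun x : R => y + x)); last exact: cf.
  by apply: cvgD; [exact: cvg_cst|exact: cvg_id].
have b1 : 0 < b * Num.sqrt n.+1%:R by rewrite mulr_gt0// sqrtr_gt0 ltr0n.
have -> : b * Num.sqrt n.+2%:R =
    Num.sqrt (b ^+ 2 + (b * Num.sqrt n.+1%:R) ^+ 2).
  rewrite exprMn sqr_sqrtr ?ler0n//.
  have -> : b ^+ 2 + b ^+ 2 * n.+1%:R = b ^+ 2 * n.+2%:R by rewrite -(natr1 n.+1); ring.
  by rewrite sqrtrM ?sqr_ge0// sqrtr_sqr gtr0_norm.
move: b1 IH; set b' := b * _ => b1 IH; clearbody b'.
transitivity (\int[normal_prob 0 (Num.sqrt (b ^+ 2 + b' ^+ 2))]_x (f (y + x))%:E)%E; last first.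
  by apply/esym/EFin_Ex.
have fy0 x : 0 <= f (y + x) by have /andP[] := f01 (y + x).
transitivity (\int[normal_prob 0 b]_x \int[normal_prob 0 b']_z (f (y + (x + z)))%:E)%E; last first.
  exact: (normal_convolution cfy fy0 b0 b1).
apply: eq_integral => x _; rewrite IH.
transitivity (\int[normal_prob 0 b']_z (f (y + x + z))%:E)%E.
  exact: EFin_Ex.
by apply: eq_integral => z _; rewrite addrA.
Qed.

Section logistic_clt.
Context {dO dX : measure_display} {R : realType}.
Context {Omega : measurableType dO} {Xi : measurableType dX}.
Variables (P : probability Omega R) (F : probability Xi R).
Variable xi : nat -> Omega -> Xi.
Hypothesis Hiid : iid_from P F xi.
Variables (v : Xi -> R) (sigma : R).
Hypothesis v_L2 : L2 F v.
Hypothesis v_mean : Ex F v = 0.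
Hypothesis sigma_gt0 : 0 < sigma.
Hypothesis v_var : Ex F (fun z => v z ^+ 2) = sigma ^+ 2.

Lemma fuzzy_logistic (l a : R) : 1 <= l -> fuzzy (logistic l a).
Proof.
move=> l1; split; first exact: measurable_logistic.
by move=> y; rewrite logistic_ge0 logistic_le1.
Qed.

(** The cut is at [|v| = sqrt (2 m)]. Below it, the cubic remainder is at most [s] times the cut
    times [v^2], up to [l^3 s^2]. Above it, [v^2 >= 2 m] means [v^2 <= 2 (v^2 - m)], so the crude
    remainder [2 v^2] is at most 4 times the excess over [m]. *)
Lemma lindeberg_step (l a y s m e : R) : 1 <= l -> 0 <= s -> 0 <= m ->
  Ex F (fun z => Num.max (v z ^+ 2 - m) 0) <= e ->
  `|shift_op F (fun z => s * v z) (logistic l a) y - logistic l a y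
    - (sigma * s) ^+ 2 / 2 * logistic2 l a y|
  <= l ^+ 3 * s ^+ 2 * (s * Num.sqrt (2 * m) * sigma ^+ 2 + 4 * e).
Proof.
move=> l1 s0 m0 me; set lam := Num.sqrt _.
have lam2 : lam ^+ 2 = 2 * m by rewrite sqr_sqrtr// mulr_ge0.
have lam0 : 0 <= lam by exact: sqrtr_ge0.
have l3 : 0 <= l ^+ 3 by rewrite exprn_ge0//; lra.
have [mv v2] := v_L2; have v1 := L2_L1 v_L2.
pose tail z := Num.max (v z ^+ 2 - m) 0.
have tail0 z : 0 <= tail z by rewrite le_max lexx orbT.
have tail_L1 : L1 F tail.
  apply: (L1_le _ _ v2) => [|z].
    by apply: measurable_maxr => //; apply: measurable_funB => //; exact: measurable_funX.
  by rewrite ger0_norm// /tail ge_max sqr_ge0 andbT; lra.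
have gF := fuzzy_logistic a l1.
set g := logistic l a; set g1 := logistic1 l a y; set g2 := logistic2 l a y.
pose B z := l ^+ 3 * s ^+ 2 * (s * lam * v z ^+ 2 + 4 * tail z).
have B_L1 : L1 F B by apply: L1Z; apply: L1D; exact: L1Z.
have Ex_B : Ex F B = l ^+ 3 * s ^+ 2 * (s * lam * sigma ^+ 2 + 4 * Ex F tail).
  rewrite ExZ; last by apply: L1D; exact: L1Z.
  by rewrite ExD ?ExZ ?v_var//; exact: L1Z.
have gL1 : L1 F (fun z => g (y + s * v z)).
  by apply: (@fuzzy_L1 _ _ _ F (fun z => s * v z)) => //; exact: measurable_funM.
have Lc := L1_cst F (g y).
have Lv : L1 F (fun z => s * g1 * v z) by exact: L1Z.
have Lv2 : L1 F (fun z => s ^+ 2 / 2 * g2 * v z ^+ 2) by exact: L1Z.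
pose r z := g (y + s * v z) - g y - s * g1 * v z - s ^+ 2 / 2 * g2 * v z ^+ 2.
have r_L1 : L1 F r by apply: L1B => //; apply: L1B => //; exact: L1B.
have Ex_r : Ex F r = shift_op F (fun z => s * v z) g y - g y - (sigma * s) ^+ 2 / 2 * g2.
  rewrite ExB//; last by apply: L1B => //; exact: L1B.
  rewrite ExB//; last exact: L1B.
  rewrite ExB// !ExZ// Ex_cst v_mean v_var /shift_op.
  by move: (Ex _ _) (g y) => p q; field.
rewrite -Ex_r; apply: (le_trans (Ex_norm r_L1)).
apply: (@le_trans _ _ (Ex F B)); last first.
  rewrite Ex_B; apply: ler_wpM2l; first by rewrite mulr_ge0// sqr_ge0.
  by rewrite lerD2l ler_pM2l.
apply: Ex_le => // [|z]; first exact: L1_norm.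
have rE : r z = g (y + s * v z) - g y - s * v z * g1 - (s * v z) ^+ 2 / 2 * g2.
  by rewrite /r; move: (g (y + s * v z)) (g y) => p q; field.
have vz2 : `|v z| ^+ 2 = v z ^+ 2 by rewrite real_normK// num_real.
rewrite rE /B; have [vl|vl] := leP `|v z| lam.
  apply: le_trans (logistic_taylor a l1 y (s * v z)) _.
  have -> : l ^+ 3 * `|s * v z| ^+ 3 = l ^+ 3 * s ^+ 2 * (s * `|v z| * v z ^+ 2).
    by rewrite normrM (ger0_norm s0) -vz2; ring.
  apply: ler_wpM2l; first by rewrite mulr_ge0// sqr_ge0.
  rewrite -[leLHS]addr0; apply: lerD; last by rewrite mulr_ge0.
  by apply: ler_wpM2r; [exact: sqr_ge0|exact: ler_wpM2l].
apply: le_trans (logistic_taylor_crude a l1 y (s * v z)) _.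
have -> : 2 * l ^+ 3 * (s * v z) ^+ 2 = l ^+ 3 * s ^+ 2 * (2 * v z ^+ 2) by ring.
apply: ler_wpM2l; first by rewrite mulr_ge0// sqr_ge0.
have H : 2 * m <= v z ^+ 2 by rewrite -lam2 -vz2 lerXn2r ?nnegrE// ltW.
have H1 : v z ^+ 2 - m <= tail z by rewrite le_max lexx.
have H2 : 0 <= s * lam * v z ^+ 2 by apply: mulr_ge0; [rewrite mulr_ge0|exact: sqr_ge0].
by lra.
Qed.

Lemma logistic_clt (l a e : R) : 1 <= l -> 0 < e -> exists n0, forall n, (n0 <= n)%N ->
  `|Ex P (fun w => logistic l a (Num.sqrt n%:R * smean (iota 0 n) (sample xi id w) v))
    - Ex (normal_prob 0 sigma) (logistic l a)| <= e.
Proof.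
move=> l1 e0; have [mv v2] := v_L2.
have l3 : 0 < l ^+ 3 by rewrite exprn_gt0//; lra.
(* Over [n] steps of size [1 / sqrt n] the tail contributes [4 l^3] times this bound, that is
   [e / 2]. *)
have e1 : 0 < e / (8 * l ^+ 3) by rewrite divr_gt0// mulr_gt0.
have [m m0 tailm] := tail_expectation_small v2 (fun z => sqr_ge0 (v z)) e1.
have [K KE K0] : exists2 K : R, K = 162 * expR 2 + expR 1 & 0 <= K.
  by exists (162 * expR 2 + expR 1) => //; rewrite addr_ge0 ?mulr_ge0 ?expR_ge0.
pose C := l ^+ 3 * (Num.sqrt (2 * m) * sigma ^+ 2 + K * sigma ^+ 3).
have C0 : 0 <= C.
  rewrite /C mulr_ge0 ?(ltW l3)// addr_ge0// mulr_ge0 ?sqrtr_ge0 ?sqr_ge0//.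
  by rewrite exprn_ge0// ltW.
(* [sqrt n >= D] meets two demands: [C / sqrt n <= e / 2], and a normal step [sigma / sqrt n] of
   deviation at most 1. *)
pose D := 2 * C / e + sigma.
have CD : 0 <= 2 * C / e by apply: divr_ge0; [exact: mulr_ge0|exact: ltW].
have D0 : 0 < D by rewrite /D ltr_wpDl.
exists (Num.truncn (D ^+ 2)).+1 => n nD.
have n0 : (0 < n)%N by exact: leq_trans nD.
set t := Num.sqrt n%:R.
have t0 : 0 < t by rewrite sqrtr_gt0 ltr0n.
have tt : t ^+ 2 = n%:R by rewrite sqr_sqrtr.
have Dt : D <= t.
  rewrite -(ger0_norm (ltW D0)) -sqrtr_sqr ler_wsqrtr// ltW//.
  by apply: (lt_le_trans (truncnS_gt _)); rewrite ler_nat.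
set s := t^-1.
have s0 : 0 < s by rewrite invr_gt0.
have ns2 : n%:R * s ^+ 2 = 1 by rewrite -tt exprVn mulfV// expf_neq0// gt_eqF.
have b0 : 0 < sigma * s by rewrite mulr_gt0.
have b1 : sigma * s <= 1.
  by rewrite ler_pdivrMr// mul1r (le_trans _ Dt)// /D lerDr.
have Cs : C * s <= e / 2.
  rewrite ler_pdivrMr//; have : 2 * C / e <= t by rewrite (le_trans _ Dt)// /D lerDl ltW.
  by rewrite ler_pdivrMr// => H; lra.
have gF := fuzzy_logistic a l1.
pose N_ := shift_op (normal_prob 0 (sigma * s)) id.
pose T_ := shift_op F (fun z => s * v z).
pose c := l ^+ 3 * s ^+ 2 * (s * Num.sqrt (2 * m) * sigma ^+ 2 + 4 * (e / (8 * l ^+ 3)))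
  + l ^+ 3 * (K * (sigma * s) ^+ 3).
have step y : `|T_ (logistic l a) y - N_ (logistic l a) y| <= c.
  have H1 := lindeberg_step a y l1 (ltW s0) m0 tailm.
  have H2 : `|N_ (logistic l a) y - logistic l a y
    - (sigma * s) ^+ 2 / 2 * logistic2 l a y| <= l ^+ 3 * (K * (sigma * s) ^+ 3).
    by rewrite KE; exact: normal_logistic_step.
  have alg (p q r u : R) : p - q = (p - r - u) - (q - r - u) by ring.
  rewrite (alg _ _ (logistic l a y) ((sigma * s) ^+ 2 / 2 * logistic2 l a y)).
  by apply: le_trans (ler_normB _ _) _; apply: lerD.
have msv : measurable_fun setT (fun z => s * v z) by exact: measurable_funM.
have := @iter_shift_diff R _ _ _ _ F (fun z => s * v z) (normal_prob 0 (sigma * s))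
  id (logistic l a) c n msv (@measurable_id _ _ _) gF step 0.
have -> : iter n (shift_op F (fun z => s * v z)) (logistic l a) 0 =
    Ex P (fun w => logistic l a (t * smean (iota 0 n) (sample xi id w) v)).
  rewrite (iter_shift_walk Hiid msv)//; apply: eq_Ex => w; congr (logistic l a _).
  rewrite add0r /smean size_iota -mulr_sumr /index_iota subn0 mulrA; congr (_ * _).
  by rewrite /s -tt; field; rewrite gt_eqF.
have -> : iter n (shift_op (normal_prob 0 (sigma * s)) id) (logistic l a) 0 =
    Ex (normal_prob 0 sigma) (logistic l a).
  transitivity (Ex (normal_prob 0 (sigma * s * t)) (fun x => logistic l a (0 + x))).
    exact: (iter_shift_normal 0 b0 (@continuous_logistic R l a) gF n0).
  have -> : sigma * s * t = sigma by rewrite /s; field; rewrite gt_eqF.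
  by apply: eq_Ex => x; rewrite add0r.
move=> /le_trans; apply.
have -> : n%:R * c = C * s + e / 2.
  transitivity (l ^+ 3 * (n%:R * s ^+ 2) *
      (s * Num.sqrt (2 * m) * sigma ^+ 2 + 4 * (e / (8 * l ^+ 3)))
    + l ^+ 3 * (K * sigma ^+ 3 * (n%:R * s ^+ 2) * s)).
    by rewrite /c; move: (Num.sqrt (2 * m)) (e / _) => p q; ring.
  by rewrite ns2 /C; move: (Num.sqrt (2 * m)) => p; field; lra.
by lra.
Qed.

End logistic_clt.

Section indicator.
Context {d} {T : measurableType d} {R : realType}.
Variable P : probability T R.
Implicit Type A : set T.

Lemma L1_indic A : measurable A -> L1 P (\1_A : T -> R).
Proof.
move=> mA; apply: (@bounded_L1 _ _ _ _ _ 1); first exact: measurable_indic.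
by move=> x; rewrite indicE normr_nat lern1; case: (_ \in _).
Qed.

Lemma Ex_indic A : measurable A -> (Ex P (\1_A : T -> R))%:E = P A.
Proof.
move=> mA; rewrite EFin_Ex; last exact: L1_indic.
by rewrite integral_indic// setIT.
Qed.

End indicator.

(** * From logistic test functions to distribution functions *)

Section portmanteau.
Context {dO dX : measure_display} {R : realType}.
Context {Omega : measurableType dO} {Xi : measurableType dX}.
Variables (P : probability Omega R) (F : probability Xi R).
Variable xi : nat -> Omega -> Xi.
Hypothesis Hiid : iid_from P F xi.
Variables (v : Xi -> R) (sigma : R).
Hypothesis v_L2 : L2 F v.
Hypothesis v_mean : Ex F v = 0.
Hypothesis sigma_gt0 : 0 < sigma.
Hypothesis v_var : Ex F (fun z => v z ^+ 2) = sigma ^+ 2.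

Local Notation clt_mean n w :=
  (Num.sqrt n%:R * smean (iota 0 n) (sample xi id w) v).

Variable Y : nat -> Omega -> R.
Hypothesis mY : forall n, measurable_fun setT (Y n).
Hypothesis Y_close : forall e : R, 0 < e -> exists n0, forall n, (n0 <= n)%N ->
  L1 P (fun w => Y n w - clt_mean n w) /\
  Ex P (fun w => `|Y n w - clt_mean n w|) <= e.

Local Notation nu := (normal_prob 0 sigma).
Local Notation half x := (`]-oo, x]%classic : set R).

(** Slutsky's argument: the test function is Lipschitz, so an L1-small perturbation of the
    normalised mean is invisible in the limit. *)
Lemma logistic_close (l a e : R) : 1 <= l -> 0 < e -> exists n0, forall n, (n0 <= n)%N ->
  `|Ex P (fun w => logistic l a (Y n w)) - Ex nu (logistic l a)| <= e.
Proof.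
move=> l1 e0; have l3 : 0 < l ^+ 3 by rewrite exprn_gt0//; lra.
have e2 : 0 < e / 2 by rewrite divr_gt0.
have [n1 H1] := logistic_clt Hiid v_L2 v_mean sigma_gt0 v_var a l1 e2.
have [n2 H2] := Y_close (divr_gt0 e2 l3).
exists (maxn n1 n2) => n; rewrite geq_max => /andP[/H1 {}H1 /H2 [LD {}H2]].
have [mg g01] := fuzzy_logistic a l1.
have bounded (f : Omega -> R) : measurable_fun setT f -> L1 P (fun w => logistic l a (f w)).
  move=> mf; have := @fuzzy_L1 _ _ _ P f mf (logistic l a) 0 (fuzzy_logistic a l1).
  by apply: eq_L1 => w; rewrite add0r.
have mS : measurable_fun setT (fun w => clt_mean n w).
  by apply: measurable_funM => //; exact: L1_meas (L1_smean Hiid _ _ (L2_L1 v_L2)).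
have LS := bounded _ mS; have LY := bounded _ (mY n).
apply: le_trans (ler_distD (Ex P (fun w => logistic l a (clt_mean n w))) _ _) _.
rewrite [leRHS]splitr; apply: lerD => //.
rewrite -ExB//; apply: (le_trans (Ex_norm (L1B LY LS))).
apply: (@le_trans _ _ (l ^+ 3 * Ex P (fun w => `|Y n w - clt_mean n w|))).
  rewrite -ExZ; last exact: L1_norm.
  apply: Ex_le => [||w]; [exact/L1_norm/L1B|exact/L1Z/L1_norm|].
  exact: logistic_lip.
by rewrite mulrC -ler_pdivlMr.
Qed.

(** The indicator up to [x] lies, up to [e / 8], between the logistic functions centred at [x - d]
    and [x + d]; under the normal law these lie between its distribution function at [x - 2 d] and
    at [x + 2 d]. Each side collects four errors of [e / 8]. *)
Lemma cvg_in_distribution_normal : cvg_in_distribution P Y nu.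
Proof.
split => // x cx.
pose p (y : R) := Ex nu (\1_(half y) : _ -> R).
have pE y : (p y)%:E = nu (half y) by exact: Ex_indic.
pose q n := Ex P (\1_(Y n @^-1` half x) : _ -> R).
have mYx n : measurable (Y n @^-1` half x).
  by rewrite -[X in measurable X]setTI; exact: mY.
have qE n : (q n)%:E = P (Y n @^-1` half x) by exact: Ex_indic.
rewrite -pE (_ : (fun n => _) = EFin \o q); last by apply/funext => n; rewrite /= qE.
have {}cx : p y @[y --> x] --> p x.
  apply: (@fine_cvg _ _ _ _ (fun y => (p y)%:E) (p x)).
  rewrite pE (_ : (fun y => (p y)%:E) = fun y => nu (half y)); last by apply/funext.
  exact: cx.
apply: cvg_EFin; first by near=> n.
apply/cvgrPdist_le => e e0.
have e8 : 0 < e / 8 by rewrite divr_gt0.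
have [r /= r0 rP] : nbhs x [set y | `|p x - p y| < e / 8].
  by have /cvgrPdist_lt /(_ _ e8) := cx.
(* So that [x - 2 d] and [x + 2 d] stay strictly within distance [r] of [x]. *)
pose d := r / 4.
have d0 : 0 < d by rewrite divr_gt0.
have near_p y : `|x - y| < r -> `|p x - p y| < e / 8 by exact: rP.
have hi : `|p x - p (x + 2 * d)| < e / 8.
  by apply: near_p; rewrite opprD addNKr normrN ger0_norm /d; lra.
have lo : `|p x - p (x - 2 * d)| < e / 8.
  by apply: near_p; rewrite opprB addrC subrK ger0_norm /d; lra.
have [l l1 lP] := logistic_step d0 e8.
have [n1 H1] := logistic_close (x + d) l1 e8.
have [n2 H2] := logistic_close (x - d) l1 e8.
have mh y : measurable (half y) by [].
have Ln a : L1 nu (logistic l a).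
  have := @fuzzy_L1 _ _ _ nu id (@measurable_id _ _ _) (logistic l a) 0 (fuzzy_logistic a l1).
  by apply: eq_L1 => w; rewrite add0r.
have LP a n : L1 P (fun w => logistic l a (Y n w)).
  have := @fuzzy_L1 _ _ _ P (Y n) (mY n) (logistic l a) 0 (fuzzy_logistic a l1).
  by apply: eq_L1 => w; rewrite add0r.
have step d' (T : measurableType d') (Q : probability T R) f g c : L1 Q f -> L1 Q g ->
    (forall t, f t <= g t + c) -> Ex Q f <= Ex Q g + c.
  move=> Lf Lg fg; rewrite -(Ex_cst Q c) -ExD//; last exact: L1_cst.
  by apply: Ex_le => //; apply: L1D => //; exact: L1_cst.
have indicP (y z : R) : (\1_(half y) z : R) = (z <= y)%R%:R.
  by rewrite indicE mem_setE in_itv.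
have log01 a y := logistic_ge0 l a y; have log1 a y := logistic_le1 l a y.
have A1 n : q n <= Ex P (fun w => logistic l (x + d) (Y n w)) + e / 8.
  apply: step => // [|w]; first exact: L1_indic.
  rewrite -[\1_ _ w]/(\1_(half x) (Y n w)) indicP.
  have [+ _] := lP (x + d) (Y n w); rewrite addrK.
  have := log01 (x + d) (Y n w).
  by case: (Y n w <= x) => /= H; [move=> /(_ isT); lra|lra].
have A2 : Ex nu (logistic l (x + d)) <= p (x + 2 * d) + e / 8.
  apply: step => // [|y]; first exact: L1_indic.
  rewrite indicP; have [_] := lP (x + d) y.
  rewrite -addrA (_ : d + d = 2 * d); last by ring.
  have := log1 (x + d) y.
  by have [yx|xy] := leP y (x + 2 * d); [move=> /= ? _; lra|move=> _ /(_ (ltW xy)) /= ?; lra].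
have B1 n : Ex P (fun w => logistic l (x - d) (Y n w)) <= q n + e / 8.
  apply: step => // [|w]; first exact: L1_indic.
  rewrite -[\1_ _ w]/(\1_(half x) (Y n w)) indicP.
  have [_] := lP (x - d) (Y n w); rewrite subrK /=.
  have := log1 (x - d) (Y n w).
  by have [yx|xy] := leP (Y n w) x; [move=> /= ? _; lra|move=> _ /(_ (ltW xy)) /= ?; lra].
have B2 : p (x - 2 * d) <= Ex nu (logistic l (x - d)) + e / 8.
  apply: step => // [|y]; first exact: L1_indic.
  rewrite indicP; have [+ _] := lP (x - d) y.
  rewrite -addrA (_ : - d - d = - (2 * d)); last by ring.
  have := log01 (x - d) y.
  by case: (y <= x - 2 * d) => /= H; [move=> /(_ isT); lra|lra].
exists (maxn n1 n2) => // n /=; rewrite geq_max => /andP[/H1 {}H1 /H2 {}H2].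
move: hi lo H1 H2 (A1 n) A2 (B1 n) B2.
move: (p x) (p _) (p _) (q n) (Ex P _) (Ex P _) (Ex nu _) (Ex nu _).
move=> p0 p1 p2 qn E1 E2 N1 N2.
rewrite !ltr_norml !ler_norml => /andP[? ?] /andP[? ?] /andP[? ?] /andP[? ?] ? ? ? ?.
by apply/andP; split; lra.
Unshelve. all: by end_near.
Qed.

End portmanteau.

(** * The limit theorem *)

(** The integral of a nonnegative function is a supremum over simple functions below it, hence
    monotone without measurability; this is applied to the pointwise supremum over [X], whose
    measurability is not at hand. *)
Lemma ge0_le_integral_nonmeasurable {d} {T : measurableType d} {R : realType}
  (mu : {measure set T -> \bar R}) (f g : T -> \bar R) :
  (forall x, 0 <= f x)%E -> (forall x, f x <= g x)%E ->
  (\int[mu]_x f x <= \int[mu]_x g x)%E.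
Proof.
move=> f0 fg; rewrite !ge0_integralTE//; last by move=> x; exact: le_trans (fg x).
apply: ereal_sup_le => _ /= [u uf <-].
by exists u => // x; exact: le_trans (fg x).
Qed.

Lemma inf_attained {R : realType} (A : set R) m : A m -> (forall x, A x -> m <= x) ->
  inf A = m.
Proof.
move=> Am mA; apply/eqP; rewrite eq_le; apply/andP; split.
  by apply: ge_inf => //; exists m.
by apply: lb_le_inf; [exists m|].
Qed.

(** * From the hypotheses to a regular problem *)

Section reduction.
Context {dX : measure_display} {R : realType} {d : nat} {Xi : measurableType dX}.
Variables (F : probability Xi R) (X : set 'rV[R]_d) (h : 'rV[R]_d -> Xi -> R).
Hypothesis cptX : compact X.
Hypothesis hmeas : measurable_cost X h.

(** A section of a jointly measurable function; [X] is closed, so the domain of [h] is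
    measurable. *)
Lemma measurable_cost_section x : X x -> measurable_fun setT (h x).
Proof.
move=> Xx; have mX : measurable (X : set (borel_rV R d)).
  rewrite -[X]setCK; apply: measurableC; apply: sub_sigma_algebra => /=.
  by apply: closed_openC; apply: compact_closed => //; exact: norm_hausdorff.
have mD : measurable ([set p | X p.1] : set (borel_rV R d * Xi)).
  by rewrite -[X in measurable X]setTI; exact: measurable_fst.
move=> _ Y mY; have mDY := hmeas mD mY.
rewrite (_ : setT `&` _ = setT `&` (pair (x : borel_rV R d) @^-1`
    ([set p | X p.1] `&` (fun p : borel_rV R d * Xi => h p.1 p.2) @^-1` Y))).
  exact: pair1_measurable.
by apply/seteqP; split => z /= [_]; [move=> Yz; split|case].
Qed.

Variable M : Xi -> R.
Hypothesis Mmeas : measurable_fun setT M.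
Hypothesis hlip : forall z x1 x2, X x1 -> X x2 ->
  `|h x1 z - h x2 z| <= M z * l2norm (x1 - x2).
Hypothesis Mint : ('E_F[fun z => (M z ^+ 2)%R] < +oo)%E.
Hypothesis hsup :
  (\int[F]_z ereal_sup [set (`|h x z| ^+ 2)%:E | x in X] < +oo)%E.
Variable x0 : 'rV[R]_d.
Hypothesis x0_opt : optimal_solution F X h x0.

(* [M] may be negative where [X] is a singleton, and the Lipschitz bound is
   needed for the sup norm. *)
Definition lip_const z := Num.sqrt d%:R * `|M z| + 1.

Lemma lip_const_L2 : L2 F lip_const.
Proof.
apply: L2D; last exact: L2_cst; apply: L2Z; split; first exact: measurableT_comp.
apply: ge0_L1 => [|z|]; [|exact: sqr_ge0|].
- by apply: measurable_funX; exact: measurableT_comp.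
- move: Mint; rewrite unlock; congr (_ < _)%E; apply: eq_integral => z _.
  by rewrite real_normK// num_real.
Qed.

Lemma cost_lip z x y : X x -> X y -> `|h x z - h y z| <= lip_const z * `|x - y|.
Proof.
move=> Xx Xy; apply: (le_trans (hlip z Xx Xy)).
have l0 : 0 <= l2norm (x - y) by exact: sqrtr_ge0.
apply: (@le_trans _ _ (`|M z| * l2norm (x - y))).
  by apply: ler_wpM2r => //; exact: ler_norm.
apply: (@le_trans _ _ (`|M z| * (Num.sqrt d%:R * `|x - y|))).
  by apply: ler_wpM2l => //; exact: l2norm_le.
by rewrite mulrA; apply: ler_wpM2r => //; rewrite mulrC /lip_const lerDl.
Qed.

Lemma optimal_cost_L2 : L2 F (h x0).
Proof.
have [X0 _] := x0_opt; have mh := measurable_cost_section X0.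
split=> //; apply: ge0_L1 => [|z|]; [exact: measurable_funX|exact: sqr_ge0|].
apply: le_lt_trans hsup; apply: ge0_le_integral_nonmeasurable => z.
  by rewrite lee_fin sqr_ge0.
apply: ereal_sup_ubound; exists x0 => //.
by rewrite real_normK// num_real.
Qed.

Lemma compact_radius : exists D, forall x, X x -> `|x - x0| <= D.
Proof.
have [B [_ BX]] := compact_bounded cptX.
exists (B + 1 + `|x0|) => x Xx; apply: (le_trans (ler_normB _ _)).
by rewrite lerD2r; apply: BX => //; rewrite ltrDl.
Qed.

Lemma cost_L2 x : X x -> L2 F (h x).
Proof.
move=> Xx; have [X0 _] := x0_opt.
have L : L2 F (fun z => `|h x0 z| + `|x - x0| * lip_const z).
  apply: L2D; last exact: L2Z lip_const_L2.
  have [mh h2] := optimal_cost_L2; split; first exact: measurableT_comp.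
  by apply: eq_L1 h2 => z; rewrite real_normK// num_real.
apply: L2_le L => [|z]; first exact: measurable_cost_section.
rewrite -[h x z](subrK (h x0 z)) addrC (le_trans (ler_normD _ _))// lerD2l.
by rewrite mulrC cost_lip.
Qed.

Lemma EFin_mean_cost x : X x -> ('E_F[h x] = (Ex F (h x))%:E)%E.
Proof. by move=> Xx; rewrite unlock EFin_Ex//; exact: L2_L1 (cost_L2 Xx). Qed.

Lemma cost_regular_problem : exists K B, regular_problem F X h lip_const K B.
Proof.
have [K [B nets]] := compact_has_nets cptX.
exists K, B; split=> //; [|exact: lip_const_L2|exact: cost_L2|].
- by move=> z; rewrite lerDr mulr_ge0// sqrtr_ge0.
- exact: cost_lip.
Qed.

Lemma optimal_value_mean : optimal_value F X h = Ex F (h x0).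
Proof.
have [X0 opt0] := x0_opt; apply: inf_attained; first by exists x0; rewrite // EFin_mean_cost.
move=> _ [x Xx <-]; rewrite EFin_mean_cost//=.
by have := opt0 _ Xx; rewrite !EFin_mean_cost// lee_fin.
Qed.

Lemma cost_unique_minimizer : essentially_unique_solution F X h ->
  exists D, unique_minimizer F X h x0 D.
Proof.
move=> uniq_opt; have [D DX] := compact_radius; have [X0 opt0] := x0_opt.
exists D; split => // x Xx.
  by have := opt0 _ Xx; rewrite !EFin_mean_cost// lee_fin.
move=> E; apply: uniq_opt => //; split=> // y Xy.
by rewrite EFin_mean_cost// E -EFin_mean_cost//; exact: opt0.
Qed.

Lemma variance_cost : fine ('V_F[h x0])%E = Ex F (fun z => (h x0 z - Ex F (h x0)) ^+ 2).
Proof.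
have [X0 _] := x0_opt; rewrite /variance unlock EFin_mean_cost//= unlock.
by rewrite /Ex /Rintegral; congr fine; apply: eq_integral => z _; rewrite expr2.
Qed.

End reduction.

(** * The limit laws and the bias *)

Section limit_law.
Context {dO dX : measure_display} {R : realType} {d : nat}.
Context {Omega : measurableType dO} {Xi : measurableType dX}.
Variables (P : probability Omega R) (F : probability Xi R).
Variable xi : nat -> Omega -> Xi.
Hypothesis Hiid : iid_from P F xi.
Variables (X : set 'rV[R]_d) (h : 'rV[R]_d -> Xi -> R) (M : Xi -> R) (K B : nat).
Hypothesis reg : regular_problem F X h M K B.
Variables (x0 : 'rV[R]_d) (D : R).
Hypothesis opt : unique_minimizer F X h x0 D.
Hypothesis cptX : compact X.
Variable sigma : R.
Hypothesis sigma_gt0 : 0 < sigma.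
Hypothesis cost_var : Ex F (fun z => (h x0 z - Ex F (h x0)) ^+ 2) = sigma ^+ 2.
Local Notation Z := (Ex F (h x0)).
Local Notation U n k w := (Uregret X h x0 n k (sample xi id w)).
Local Notation mregret k := (mean_regret P xi X h x0 k).

Lemma measurable_saa_Ustat n k : measurable_fun setT (saa_Ustat xi X h n k).
Proof.
apply: measurable_funM => //.
rewrite (_ : (fun _ => _) = fun w => \sum_(A : {set 'I_n})
    if #|A| == k then smean (indices A) (sample xi id w) (h x0)
      - regret X h x0 (indices A) (sample xi id w) else 0); last first.
  apply/funext => w; rewrite big_mkcond; apply: eq_bigr => A _.
  by rewrite /regret opprB addrCA subrr addr0 /indices -map_comp.
apply: measurable_sum => A; case: (#|A| == k) => //; apply: measurable_funB.
  exact: (L1_meas (L1_smean Hiid _ _ (L2_L1 (reg_h_L2 reg (min_in opt))))).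
exact: (L1_meas (L2_L1 (L2_regret Hiid reg opt _ _))).
Qed.

Lemma expected_saa_valueE k : (0 < k)%N ->
  expected_saa_value P xi X h k = Z - mregret k.
Proof.
move=> k0; have hL := L2_L1 (reg_h_L2 reg (min_in opt)).
have sz : (0 < size (iota 0 k))%N by rewrite size_iota.
rewrite /expected_saa_value unlock -(Ex_smean Hiid id sz hL) -ExB.
- rewrite /Ex /Rintegral; congr fine; apply: eq_integral => w _; congr EFin.
  by rewrite /regret opprB addrCA subrr addr0.
- exact: (L1_smean Hiid _ _ hL).
- exact: L2_L1 (L2_regret Hiid reg opt _ _).
Qed.

(** Common to both limit laws. For [c] the expected value [W_k], [Z - c] is the mean of [U] and the
    condition is on fluctuations; for [c = Z] it is 0 and the condition is on the mean itself. *)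
Lemma saa_Ustat_clt (k : nat -> nat) (c : nat -> R) :
  (forall e : R, 0 < e -> exists n0, forall n, (n0 <= n)%N -> (0 < k n <= n)%N /\
     Num.sqrt n%:R * Ex P (fun w => `|U n (k n) w - (Z - c n)|) <= e) ->
  cvg_in_distribution P
    (fun n w => Num.sqrt n%:R * (saa_Ustat xi X h n (k n) w - c n))
    (normal_prob 0 sigma).
Proof.
move=> close; have h2 := reg_h_L2 reg (min_in opt).
have cst_L2 c' : L2 F (fun=> c') by exact: L2_cst.
apply: (cvg_in_distribution_normal Hiid (v := fun z => h x0 z - Z)) => //.
- exact: L2B.
- by rewrite ExB ?Ex_cst ?subrr//; [exact: L2_L1|exact: L1_cst].
- move=> n; apply: measurable_funM => //; apply: measurable_funB => //.
  exact: measurable_saa_Ustat.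
move=> e e0; have [n0 H] := close e e0; exists n0 => n /H[kn {}H].
have n1 : (0 < n)%N by case/andP: kn => k0 /(leq_trans k0).
have sz : (0 < size (iota 0 n))%N by rewrite size_iota.
have E w : Num.sqrt n%:R * (saa_Ustat xi X h n (k n) w - c n)
    - Num.sqrt n%:R * smean (iota 0 n) (sample xi id w) (fun z => h x0 z - Z) =
    - (Num.sqrt n%:R * (U n (k n) w - (Z - c n))).
  by rewrite smeanB smean_cst// (saa_UstatE _ _ _ x0)//; ring.
have LU : L1 P (fun w => U n (k n) w - (Z - c n)).
  apply: L1B; last exact: L1_cst.
  exact: L2_L1 (L2_Uregret Hiid reg opt _ _ _).
split; first by apply: eq_L1 (L1N (L1Z (Num.sqrt n%:R) LU)) => w; rewrite E.
rewrite (@eq_Ex _ _ _ P _ (fun w => Num.sqrt n%:R * `|U n (k n) w - (Z - c n)|)).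
  by rewrite ExZ//; exact: L1_norm.
by move=> w; rewrite E normrN normrM ger0_norm// sqrtr_ge0.
Qed.

Lemma saa_Ustat_clt_expected (k : nat -> nat) :
  (forall n, (k n <= n)%N) -> k n @[n --> \oo] --> \oo ->
  cvg_in_distribution P
    (fun n w => Num.sqrt n%:R *
       (saa_Ustat xi X h n (k n) w - expected_saa_value P xi X h (k n)))
    (normal_prob 0 sigma).
Proof.
move=> kn koo; apply: saa_Ustat_clt => e e0.
(* Variance level [e^2]: [Ex_abs_le] with parameter [e] then gives [(e^2 / e + e) / 2 = e]. *)
have [k0 H] := Uregret_variance Hiid reg opt cptX (exprn_gt0 2 e0).
have [n0 _ n0P] := koo _ (nbhs_infty_ge (maxn k0 1)).
exists n0 => n /n0P /=; rewrite geq_max => /andP[kk0 k1].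
have kkn : (0 < k n <= n)%N by rewrite k1 kn.
split => //; rewrite expected_saa_valueE// subKr.
have {}H := H n (k n) kk0 kkn.
set f := fun w => U n (k n) w - mregret (k n).
have f2 : L2 P f by apply: L2B; [exact: (L2_Uregret Hiid reg opt)|exact: L2_cst].
set t : R := Num.sqrt n%:R.
have t0 : 0 <= t by exact: sqrtr_ge0.
have -> : t * Ex P (fun w => `|f w|) = Ex P (fun w => `|t * f w|).
  rewrite -ExZ; last by apply: L1_norm; exact: L2_L1.
  by apply: eq_Ex => w; rewrite normrM ger0_norm.
apply: (le_trans (Ex_abs_le e0 (L2Z t f2))).
have -> : Ex P (fun w => (t * f w) ^+ 2) = n%:R * Ex P (fun w => f w ^+ 2).
  rewrite -ExZ; last exact: L2_sqr.
  by apply: eq_Ex => w; rewrite exprMn sqr_sqrtr.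
have : n%:R * Ex P (fun w => f w ^+ 2) / e <= e by rewrite ler_pdivrMr// -expr2.
by move: (_ / e) => q; lra.
Qed.

Lemma expected_saa_value_rate :
  (fun k : nat => expected_saa_value P xi X h k - Z)
    =o_\oo (fun k : nat => (Num.sqrt (k%:R : R))^-1).
Proof.
apply/eqoP => e e0.
have /cvgrPdist_le /(_ _ e0) [k0 _ k0P] := mean_regret_cvg0 Hiid reg opt cptX.
exists (maxn k0 1) => // k /=; rewrite geq_max => /andP[/k0P /= H k1].
rewrite expected_saa_valueE// addrAC subrr add0r normrN.
have t0 : 0 < Num.sqrt (k%:R : R) by rewrite sqrtr_gt0 ltr0n.
rewrite normfV (gtr0_norm t0) ler_pdivlMr// mulrC.
have m0 : 0 <= mregret k by exact: (mean_regret_ge0 P xi reg opt).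
by move: H; rewrite sub0r normrN normrM (gtr0_norm t0) ger0_norm.
Qed.

(** The remainder is nonnegative, so its L1 norm is the mean regret, and
    [sqrt n <= sqrt k / sqrt eps] brings in the rate of the bias. *)
Lemma saa_Ustat_clt_optimal (eps : R) (k : nat -> nat) : 0 < eps ->
  (forall n, eps * n%:R <= (k n)%:R /\ (k n <= n)%N) ->
  cvg_in_distribution P
    (fun n w => Num.sqrt n%:R * (saa_Ustat xi X h n (k n) w - Z))
    (normal_prob 0 sigma).
Proof.
move=> eps0 kn; apply: (@saa_Ustat_clt k (fun=> Z)) => e e0.
have s0 : 0 < Num.sqrt eps by rewrite sqrtr_gt0.
have /cvgrPdist_le /(_ _ (mulr_gt0 e0 s0)) [k0 _ k0P] :=
  mean_regret_cvg0 Hiid reg opt cptX.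
exists (Num.truncn ((maxn k0 1)%:R / eps)).+1 => n n0.
have [ek kn'] := kn n.
have : (maxn k0 1 <= k n)%N.
  rewrite -(ler_nat R) (le_trans _ ek)// mulrC -ler_pdivrMr// ltW//.
  by apply: (lt_le_trans (truncnS_gt _)); rewrite ler_nat.
rewrite geq_max => /andP[/k0P /= H k1]; split; first by rewrite k1.
have m0 : 0 <= mregret (k n) by exact: (mean_regret_ge0 P xi reg opt).
rewrite (@eq_Ex _ _ _ P _ (fun w => U n (k n) w)); last first.
  by move=> w; rewrite subrr subr0 ger0_norm// (Uregret_ge0 reg opt).
rewrite (Ex_Uregret Hiid reg opt)//.
rewrite -(ler_pM2r s0); move: H; rewrite sub0r normrN ger0_norm; last first.
  by rewrite mulr_ge0// sqrtr_ge0.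
apply: le_trans; rewrite mulrAC; apply: ler_wpM2r => //.
by rewrite -sqrtrM ?ler0n// ler_wsqrtr// mulrC.
Qed.

End limit_law.

Theorem theorem7 (R : realType) (d : nat)
    (dO dX : measure_display)
    (Omega : measurableType dO) (Xi : measurableType dX)
    (P : probability Omega R) (F : probability Xi R)
    (xi : nat -> Omega -> Xi) (Hiid : iid_from P F xi)
    (X : set 'rV[R]_d) (h : 'rV[R]_d -> Xi -> R)
    (Xcompact : compact X)
    (hmeas : measurable_cost X h)
    (M : Xi -> R) (Mmeas : measurable_fun setT M)
    (hlip : forall z x1 x2, X x1 -> X x2 ->
       `|h x1 z - h x2 z| <= M z * l2norm (x1 - x2))
    (Mint : ('E_F[fun z => (M z ^+ 2)%R] < +oo)%E)
    (hsup : (\int[F]_z ereal_sup [set (`|h x z| ^+ 2)%:E | x in X] < +oo)%E)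
    (delta : R) (delta_gt0 : 0 < delta)
    (hosc : (\int[F \x F]_z ereal_sup
               [set (`|h x z.1 - h x z.2| `^ (2 + delta))%:E | x in X]
             < +oo)%E)
    (hunique : essentially_unique_solution F X h)
    (xstar : 'rV[R]_d) (xstar_opt : optimal_solution F X h xstar)
    (hvar : (0 < 'V_F[h xstar])%E) :
  let sigma := Num.sqrt (fine 'V_F[h xstar]) in
  let Zstar := optimal_value F X h in
  [/\ forall k : nat -> nat,
        (forall n, (k n <= n)%N) -> k n @[n --> \oo] --> \oo ->
        cvg_in_distribution P
          (fun n w => Num.sqrt n%:R *
             (saa_Ustat xi X h n (k n) w - expected_saa_value P xi X h (k n)))
          (normal_prob 0 sigma),
      (fun k : nat => expected_saa_value P xi X h k - Zstar)
        =o_\oo (fun k : nat => (Num.sqrt (k%:R : R))^-1)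
    & forall (eps : R) (k : nat -> nat), 0 < eps ->
        (forall n, eps * n%:R <= (k n)%:R /\ (k n <= n)%N) ->
        cvg_in_distribution P
          (fun n w => Num.sqrt n%:R * (saa_Ustat xi X h n (k n) w - Zstar))
          (normal_prob 0 sigma)].
Proof.
move=> sigma Zstar.
have [K [B reg]] := cost_regular_problem Xcompact hmeas Mmeas hlip Mint hsup xstar_opt.
have [D opt] := cost_unique_minimizer Xcompact hmeas Mmeas hlip Mint hsup xstar_opt hunique.
have ZE : Zstar = Ex F (h xstar).
  exact: (optimal_value_mean Xcompact hmeas Mmeas hlip Mint hsup xstar_opt).
have VE := variance_cost Xcompact hmeas Mmeas hlip Mint hsup xstar_opt.
have cost2 := reg_h_L2 reg (min_in opt).
have V2 : L2 F (fun z => h xstar z - Ex F (h xstar)) by apply: L2B => //; exact: L2_cst.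
(* Positivity passes to the real number because the variance is finite. *)
have V0 : 0 < fine ('V_F[h xstar])%E.
  have VF : ('V_F[h xstar] = (fine 'V_F[h xstar])%:E)%E.
    rewrite VE EFin_Ex; last exact: L2_sqr.
    rewrite /variance unlock.
    rewrite (EFin_mean_cost Xcompact hmeas Mmeas hlip Mint hsup xstar_opt (min_in opt)).
    by rewrite unlock; apply: eq_integral => z _; rewrite expr2.
  by move: hvar; rewrite VF lte_fin.
have sigma0 : 0 < sigma by rewrite sqrtr_gt0.
have sigma2 : Ex F (fun z => (h xstar z - Ex F (h xstar)) ^+ 2) = sigma ^+ 2.
  by rewrite sqr_sqrtr ?VE// ltW// -VE.
rewrite ZE; split.
- move=> k kn koo; exact: (saa_Ustat_clt_expected Hiid reg opt Xcompact sigma0 sigma2 kn koo).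
- exact: (expected_saa_value_rate Hiid reg opt Xcompact).
- move=> eps k eps0 kn; exact: (saa_Ustat_clt_optimal Hiid reg opt Xcompact sigma0 sigma2 eps0 kn).
Qed.
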